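(* The space $\mathrm{Homeo}(M,\alpha)$ equipped with the contact topology admits a left invariant metric that generates its topology.
   Context: Setting. $M$ is a closed (compact, without boundary), connected smooth manifold of dimension $2n+1$ with a cooriented contact structure $\xi=\ker\alpha$, where $\alpha$ is a fixed contact form with Reeb vector field $R$, and $\nu_\alpha=\alpha\wedge(d\alpha)^n$. A smooth strictly contact isotopy is a smooth isotopy $\Phi=\{\phi_t\}_{0\le t\le1}$ with $\phi_0=\mathrm{id}$ and $\phi_t^*\alpha=\alpha$ for all $t$; if $\frac{d}{dt}\phi_t=X_t\circ\phi_t$, its Hamiltonian is $H_t=\alpha(X_t)$, and one writes $\Phi=\Phi_H=\{\phi_H^t\}$. The Hamiltonians so obtained are exactly the smooth basic functions $H\colon[0,1]\times M\to\mathbb R$ ($dH_t(R)=0$ for all $t$). Then $(\Phi_H,H)$ is a smooth strictly contact dynamical system. Norms and metrics. For a function $H$ on $M$, $\|H\|=\max_M H-\min_M H+\left|\frac{1}{\int_M\nu_\alpha}\int_M H\,\nu_\alpha\right|$; for $H\colon[0,1]\times M\to\mathbb R$, $\|H\|_{(1,\infty)}=\int_0^1\|H_t\|\,dt$. Fix a Riemannian distance $d$ on $M$; $\overline d(\phi,\psi)=\max_x d(\phi(x),\psi(x))+\max_x d(\phi^{-1}(x),\psi^{-1}(x))$ for homeomorphisms and $\overline d(\Phi,\Psi)=\max_t\overline d(\phi_t,\psi_t)$ for isotopies. A pair $(\Phi,H)$ of a continuous isotopy of homeomorphisms and a function $H\colon[0,1]\times M\to\mathbb R$ is a topological strictly contact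 dynamical system if there are smooth strictly contact dynamical systems $(\Phi_{H_i},H_i)$ with $\Phi_{H_i}\to\Phi$ uniformly and $\|H-H_i\|_{(1,\infty)}\to0$ ($H\in L^1([0,1],C^0(M))$); one writes $\Phi=\Phi_H$. The set of these is $\mathcal{TSCDS}(M,\alpha)$, with metric $d_\alpha((\Phi_H,H),(\Phi_F,F))=\overline d(\Phi_H,\Phi_F)+\|H-F\|_{(1,\infty)}$. $\mathrm{Homeo}(M,\alpha)$ is the group (under composition) of time-one maps $\phi_H^1$ of topological strictly contact dynamical systems, and its contact topology is the quotient topology induced by the surjection $\mathrm{ev}_1\colon\mathcal{TSCDS}(M,\alpha)\to\mathrm{Homeo}(M,\alpha)$, $(\Phi_H,H)\mapsto\phi_H^1$. *)

(* Defs.v *)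
From HB Require Import structures.
From mathcomp Require Import all_boot all_order all_algebra all_fingroup.
From mathcomp Require Import all_classical all_reals all_analysis.

Set Implicit Arguments.
Unset Strict Implicit.
Unset Printing Implicit Defensive.
Import Order.TTheory GRing.Theory Num.Theory.
Import numFieldNormedType.Exports.
Local Open Scope classical_set_scope.
Local Open Scope ring_scope.

(** ** Calculus in R^m *)

(* [W] is meant to be open. In finite dimension, [Ck k W f] says that f has
   continuous partial derivatives up to order k on W. *)
Fixpoint Ck (R : realType) (U V : normedModType R) (k : nat) (W : set U)
    (f : U -> V) : Prop :=
  match k with
  | 0 => forall x, W x -> {for x, continuous f}
  | k'.+1 => (forall x, W x -> differentiable f x) /\
             (forall v : U, Ck k' W ('D_v f))
  end.

Definition smooth_on (R : realType) (U V : normedModType R) (W : set U)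
    (f : U -> V) : Prop := forall k, Ck k W f.

Definition dotv (R : realType) (m : nat) (u v : 'rV[R]_m) : R :=
  \sum_(k < m) u 0 k * v 0 k.

(* The iterated Lebesgue integral; it is only applied to continuous functions
   with compact support. *)
Fixpoint int_rV (R : realType) (m : nat) : ('rV[R]_m -> R) -> R :=
  match m return ('rV[R]_m -> R) -> R with
  | 0 => fun f => f 0
  | m'.+1 => fun f => \int[@lebesgue_measure R]_x
      int_rV (fun v : 'rV[R]_m' => f (row_mx (x%:M : 'rV[R]_1) v))
  end.

(** ** Closed manifolds *)

Definition closed_connected (M : topologicalType) : Prop :=
  [/\ hausdorff_space M, compact [set: M], connected [set: M] &
      [set: M] !=set0].

(* A smooth structure of dimension m.+1, given by a finite atlas (every smooth
   structure on a compact manifold contains one, and is determined by it).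
   [param i] is the inverse of the chart [chart i : dom i -> img i]; both are
   total functions, with irrelevant values outside their domains. *)
Record atlas (R : realType) (m : nat) (M : topologicalType) := Atlas {
  nchart : nat ;
  dom : 'I_nchart -> set M ;
  img : 'I_nchart -> set 'rV[R]_m.+1 ;
  chart : 'I_nchart -> M -> 'rV[R]_m.+1 ;
  param : 'I_nchart -> 'rV[R]_m.+1 -> M ;
  dom_open : forall i, open (dom i) ;
  img_open : forall i, open (img i) ;
  dom_cover : forall x, exists i, dom i x ;
  chart_img : forall i x, dom i x -> img i (chart i x) ;
  param_dom : forall i y, img i y -> dom i (param i y) ;
  chartK : forall i x, dom i x -> param i (chart i x) = x ;
  paramK : forall i y, img i y -> chart i (param i y) = y ;
  chart_cont : forall i x, dom i x -> {for x, continuous (chart i)} ;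
  param_cont : forall i y, img i y -> {for y, continuous (param i)} ;
  transition_smooth : forall i j,
    smooth_on [set y | img i y /\ dom j (param i y)] (chart j \o param i)
}.

Definition smooth_fun (R : realType) (m : nat) (M : topologicalType)
    (A : atlas R m M) (f : M -> R) : Prop :=
  forall i : 'I_(nchart A), smooth_on (img i) (f \o param i).

(** ** Riemannian distance *)

Record riemannian_metric (R : realType) (m : nat) (M : topologicalType)
    (A : atlas R m M) := RiemannianMetric {
  gmx : 'I_(nchart A) -> 'rV[R]_m.+1 -> 'M[R]_m.+1 ;
  gmx_smooth : forall i, smooth_on (img i) (gmx i) ;
  gmx_sym : forall i y, img i y -> (gmx i y)^T = gmx i y ;
  gmx_pos : forall i y v, img i y -> v != 0 -> 0 < dotv (v *m gmx i y) v ;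
  gmx_compat : forall i j y v w, img i y -> dom j (param i y) ->
    let T := 'd (chart j \o param i) y in
    dotv (T v *m gmx j (chart j (param i y))) (T w) = dotv (v *m gmx i y) w
}.

(* A piecewise smooth path, cut finely enough for every piece to lie in one
   chart, is the list of the coordinate expressions of its pieces, each of them
   parametrized by [0, 1]. *)
Fixpoint is_path (R : realType) (m : nat) (M : topologicalType)
    (A : atlas R m M) (x : M) (p : seq ('I_(nchart A) * (R -> 'rV[R]_m.+1)))
    (y : M) : Prop :=
  match p with
  | [::] => x = y
  | (i, u) :: p' =>
      [/\ exists W : set R,
            [/\ open W, forall t : R, 0 <= t <= 1 -> W t & smooth_on W u],
          forall t : R, 0 <= t <= 1 -> img i (u t),
          param i (u 0) = x &
          is_path (param i (u 1)) p' y]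
  end.

Definition path_length (R : realType) (m : nat) (M : topologicalType)
    (A : atlas R m M) (g : riemannian_metric A)
    (p : seq ('I_(nchart A) * (R -> 'rV[R]_m.+1))) : R :=
  \sum_(s <- p) \int[lebesgue_measure]_(t in `[0, 1])
    Num.sqrt (dotv ('D_1 s.2 t *m gmx g s.1 (s.2 t)) ('D_1 s.2 t)).

Definition riemannian_dist (R : realType) (m : nat) (M : topologicalType)
    (A : atlas R m M) (g : riemannian_metric A) (x y : M) : R :=
  inf [set path_length g p | p in [set p | is_path x p y]].

(** ** Contact forms *)

(* A smooth 1-form, by its coefficients in the charts. *)
Record one_form (R : realType) (m : nat) (M : topologicalType)
    (A : atlas R m M) := OneForm {
  coef : 'I_(nchart A) -> 'rV[R]_m.+1 -> 'rV[R]_m.+1 ;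
  coef_smooth : forall i, smooth_on (img i) (coef i) ;
  coef_compat : forall i j y v, img i y -> dom j (param i y) ->
    dotv (coef j (chart j (param i y))) ('d (chart j \o param i) y v) =
    dotv (coef i y) v
}.

(* The coefficients of d(a), for a 1-form a on an open set of R^m. *)
Definition ext_deriv (R : realType) (m : nat) (a : 'rV[R]_m.+1 -> 'rV[R]_m.+1)
    (y : 'rV[R]_m.+1) (p q : 'I_m.+1) : R :=
  'D_(delta_mx 0 p) a y 0 q - 'D_(delta_mx 0 q) a y 0 p.

(* The value of a /\ (da)^n on the standard basis of R^(2n+1); a wedge of one
   1-form and n 2-forms is 1/(1! 2!^n) times the alternating sum. *)
Definition contact_vol (R : realType) (n : nat)
    (a : 'rV[R]_(n.*2).+1 -> 'rV[R]_(n.*2).+1) (y : 'rV[R]_(n.*2).+1) : R :=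
  2 ^- n * \sum_(s : 'S_(n.*2).+1) (-1) ^+ s * a y 0 (s ord0) *
    \prod_(k < n) ext_deriv a y (s (inord (k.*2).+1)) (s (inord (k.*2).+2)).

Definition contact_form (R : realType) (n : nat) (M : topologicalType)
    (A : atlas R n.*2 M) (alpha : one_form A) : Prop :=
  forall i y, img i y -> contact_vol (coef alpha i) y != 0.

(** ** Integration against nu_alpha = alpha /\ (d alpha)^n *)

Definition partition_of_unity (R : realType) (m : nat) (M : topologicalType)
    (A : atlas R m M) (chi : 'I_(nchart A) -> M -> R) : Prop :=
  [/\ forall i, smooth_fun A (chi i),
      forall i x, 0 <= chi i x,
      forall i, closure [set x | chi i x != 0] `<=` dom i &
      forall x, \sum_i chi i x = 1].

(* M carries the orientation defined by nu_alpha, hence the absolute value. *)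
Definition int_nu (R : realType) (n : nat) (M : topologicalType)
    (A : atlas R n.*2 M) (alpha : one_form A)
    (chi : 'I_(nchart A) -> M -> R) (f : M -> R) : R :=
  \sum_i int_rV (fun y => \1_(img i) y *
    (chi i (param i y) * f (param i y) * `|contact_vol (coef alpha i) y|)).

(** ** Norms of Hamiltonians; [sup] and [inf] are 0 on unbounded sets, and are
    only used for continuous functions on the compact space M *)

Definition supnorm (R : realType) (M : topologicalType) (f : M -> R) : R :=
  sup (range (fun x => `|f x|)).

Definition cnorm (R : realType) (n : nat) (M : topologicalType)
    (A : atlas R n.*2 M) (alpha : one_form A)
    (chi : 'I_(nchart A) -> M -> R) (f : M -> R) : R :=
  sup (range f) - inf (range f) +
  `|(int_nu alpha chi (cst 1))^-1 * int_nu alpha chi f|.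

Definition norm_1oo (R : realType) (n : nat) (M : topologicalType)
    (A : atlas R n.*2 M) (alpha : one_form A)
    (chi : 'I_(nchart A) -> M -> R) (H : R -> M -> R) : R :=
  \int[lebesgue_measure]_(t in `[0, 1]) cnorm alpha chi (H t).

(* H is a representative of an element of the Bochner space
   L^1([0,1], C^0(M)). Every class has a representative which is an everywhere
   limit of simple functions over Borel sets. *)
Definition simple_curve (R : realType) (M : topologicalType)
    (s : R -> M -> R) : Prop :=
  exists (N : nat) (B : 'I_N -> set R) (f : 'I_N -> M -> R),
    [/\ forall k, measurable (B k), forall k, continuous (f k) &
        forall t x, s t x = \sum_(k < N) \1_(B k) t * f k x].

Definition L1C0 (R : realType) (M : topologicalType) (H : R -> M -> R) : Prop :=
  [/\ forall t : R, 0 <= t <= 1 -> continuous (H t),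
      exists s : nat -> R -> M -> R, (forall i, simple_curve (s i)) /\
        forall t : R, 0 <= t <= 1 ->
          (fun i => supnorm (fun x => H t x - s i t x)) @ \oo --> (0 : R) &
      lebesgue_measure.-integrable `[0, 1] (fun t => (supnorm (H t))%:E)].

(** ** Homeomorphisms and isotopies *)

Record homeo (M : topologicalType) := Homeo {
  hmap :> M -> M ;
  hinv : M -> M ;
  hmapK : cancel hmap hinv ;
  hinvK : cancel hinv hmap ;
  hmap_cont : continuous hmap ;
  hinv_cont : continuous hinv
}.

Lemma comp_continuous (M : topologicalType) (f g : M -> M) :
  continuous f -> continuous g -> continuous (f \o g).
Proof. by move=> cf cg x; apply: continuous_comp; [exact: cg|exact: cf]. Qed.

Definition hcomp (M : topologicalType) (f g : homeo M) : homeo M :=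
  Homeo (can_comp (hmapK f) (hmapK g)) (can_comp (hinvK g) (hinvK f))
    (comp_continuous (@hmap_cont M f) (@hmap_cont M g))
    (comp_continuous (@hinv_cont M g) (@hinv_cont M f)).

(* [d] is a distance on M. *)
Definition dbar (R : realType) (M : topologicalType) (d : M -> M -> R)
    (f g : homeo M) : R :=
  sup (range (fun x => d (f x) (g x))) +
  sup (range (fun x => d (hinv f x) (hinv g x))).

(* Only the restriction of an isotopy to [0, 1] matters. *)
Definition dbar_isotopy (R : realType) (M : topologicalType) (d : M -> M -> R)
    (Phi Psi : R -> homeo M) : R :=
  sup [set dbar d (Phi t) (Psi t) | t in [set t : R | 0 <= t <= 1]].

Definition continuous_isotopy (R : realType) (M : topologicalType)
    (Phi : R -> homeo M) : Prop :=
  {within [set t | 0 <= t <= 1] `*` [set: M],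
    continuous (fun z : R * M => Phi z.1 z.2)}.

(* A map on [0, 1] x M is smooth when it extends smoothly, locally in charts,
   to an open subset of R x R^m. *)
Definition smooth_family (R : realType) (m : nat) (M : topologicalType)
    (A : atlas R m M) (f : R -> M -> M) : Prop :=
  forall (i j : 'I_(nchart A)) (t0 : R) y0,
    0 <= t0 <= 1 -> img i y0 -> dom j (f t0 (param i y0)) ->
    exists (W : set (R * 'rV[R]_m.+1)) (F : R * 'rV[R]_m.+1 -> 'rV[R]_m.+1),
      [/\ open W, W (t0, y0), smooth_on W F &
          forall t y, W (t, y) -> 0 <= t <= 1 ->
            [/\ img i y, dom j (f t (param i y)) &
                chart j (f t (param i y)) = F (t, y)]].

(* Equivalently, (t, x) |-> (t, Phi t x) is a diffeomorphism of [0, 1] x M. *)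
Definition smooth_isotopy (R : realType) (m : nat) (M : topologicalType)
    (A : atlas R m M) (Phi : R -> homeo M) : Prop :=
  [/\ smooth_family A (fun t => Phi t),
      smooth_family A (fun t => hinv (Phi t)) &
      forall x, Phi 0 x = x].

(* phi^* alpha = alpha *)
Definition preserves (R : realType) (m : nat) (M : topologicalType)
    (A : atlas R m M) (alpha : one_form A) (phi : M -> M) : Prop :=
  forall i j y v, img i y -> dom j (phi (param i y)) ->
    dotv (coef alpha j (chart j (phi (param i y))))
         ('d (chart j \o phi \o param i) y v) =
    dotv (coef alpha i y) v.

(* H_t = alpha(X_t), where X_t(Phi_t x) = d/dt Phi_t x has the coordinates v in
   the chart j; the derivative is one-sided at t = 0 and t = 1. *)
Definition hamiltonian_of (R : realType) (m : nat) (M : topologicalType)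
    (A : atlas R m M) (alpha : one_form A) (Phi : R -> homeo M)
    (H : R -> M -> R) : Prop :=
  forall (t : R) x j, 0 <= t <= 1 -> dom j (Phi t x) ->
    exists v : 'rV[R]_m.+1,
      (fun h : R => h^-1 *: (chart j (Phi (t + h) x) - chart j (Phi t x)))
        @ within [set h | 0 <= t + h <= 1] ((0 : R)^') --> v /\
      H t (Phi t x) = dotv (coef alpha j (chart j (Phi t x))) v.

Definition smooth_scds (R : realType) (m : nat) (M : topologicalType)
    (A : atlas R m M) (alpha : one_form A) (Phi : R -> homeo M)
    (H : R -> M -> R) : Prop :=
  [/\ smooth_isotopy A Phi,
      forall t : R, 0 <= t <= 1 -> preserves alpha (Phi t) &
      hamiltonian_of alpha Phi H].

(** ** Topological strictly contact dynamical systems *)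

Definition tscds (R : realType) (n : nat) (M : topologicalType)
    (A : atlas R n.*2 M) (alpha : one_form A) (chi : 'I_(nchart A) -> M -> R)
    (d : M -> M -> R) (P : (R -> homeo M) * (R -> M -> R)) : Prop :=
  [/\ continuous_isotopy P.1,
      L1C0 P.2 &
      exists (Phi : nat -> R -> homeo M) (H : nat -> R -> M -> R),
        [/\ forall i, smooth_scds alpha (Phi i) (H i),
            (fun i => dbar_isotopy d (Phi i) P.1) @ \oo --> (0 : R) &
            (fun i => norm_1oo alpha chi (fun t x => P.2 t x - H i t x))
              @ \oo --> (0 : R)]].

(* On representatives this is a pseudometric: it vanishes when the isotopies
   agree on [0, 1] and the Hamiltonians agree almost everywhere. *)
Definition dist_alpha (R : realType) (n : nat) (M : topologicalType)
    (A : atlas R n.*2 M) (alpha : one_form A) (chi : 'I_(nchart A) -> M -> R)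
    (d : M -> M -> R) (P Q : (R -> homeo M) * (R -> M -> R)) : R :=
  dbar_isotopy d P.1 Q.1 +
  norm_1oo alpha chi (fun t x => P.2 t x - Q.2 t x).

Definition ev1 (R : realType) (M : topologicalType)
    (P : (R -> homeo M) * (R -> M -> R)) : homeo M := P.1 1.

Definition Homeo_alpha (R : realType) (n : nat) (M : topologicalType)
    (A : atlas R n.*2 M) (alpha : one_form A) (chi : 'I_(nchart A) -> M -> R)
    (d : M -> M -> R) : set (homeo M) :=
  @ev1 R M @` tscds alpha chi d.

(* The open sets of the metric topology on the subset X, for rho : T -> T -> R;
   only the values of rho on X matter. *)
Definition metric_open (R : realType) (T : Type) (X : set T) (rho : T -> T -> R)
    (U : set T) : Prop :=
  U `<=` X /\
  forall x, U x -> exists2 e : R, 0 < e &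
    forall y, X y -> rho x y < e -> U y.

(* The quotient topology induced by ev1. *)
Definition contact_open (R : realType) (n : nat) (M : topologicalType)
    (A : atlas R n.*2 M) (alpha : one_form A) (chi : 'I_(nchart A) -> M -> R)
    (d : M -> M -> R) (U : set (homeo M)) : Prop :=
  U `<=` Homeo_alpha alpha chi d /\
  metric_open (tscds alpha chi d) (dist_alpha alpha chi d)
    (tscds alpha chi d `&` @ev1 R M @^-1` U).

Definition metric_on (R : realType) (T : Type) (X : set T) (rho : T -> T -> R) :
    Prop :=
  [/\ forall x y, X x -> X y -> 0 <= rho x y,
      forall x y, X x -> X y -> (rho x y = 0 <-> x = y),
      forall x y, X x -> X y -> rho x y = rho y x &
      forall x y z, X x -> X y -> X z -> rho x z <= rho x y + rho y z].

Definition left_invariant (R : realType) (M : topologicalType)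
    (X : set (homeo M)) (rho : homeo M -> homeo M -> R) : Prop :=
  forall f g h, X f -> X g -> X h -> rho (hcomp f g) (hcomp f h) = rho g h.

(* Main.v *)
(** The embedding of M given by a partition of unity and the charts yields a
    distance D that is uniformly equivalent to the Riemannian distance: functions
    on M are Lipschitz for the latter, because their differentials are bounded on
    unit tangent vectors, and short straight segments in charts join nearby
    points. The norm of a Hamiltonian is equivalent to its supremum norm, because
    the mean value lies between the minimum and the maximum. Hence d_alpha is
    topologically equivalent to

      delta((Phi, H), (Psi, F)) = sup_(t, x) D(phi_t^-1 x, psi_t^-1 x) +
                                  int_0^1 sup_x |H_t - F_t| dt.

    Topological strictly contact systems form a group for the product
    (Phi Psi, H + F o phi_t^-1), as limits of smooth ones, and delta is invariant
    under left translations. The infimum of delta over the fibres of ev_1 is then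
    a left invariant pseudometric: by left translation, the infimum is already
    reached, up to any error, with a prescribed lift of the first argument, which
    yields the triangle inequality and the comparison with the quotient topology.
    It separates points because delta bounds D(f^-1 x, g^-1 x). *)
From Pilot Require Import Defs.
From HB Require Import structures.
From mathcomp Require Import all_boot all_order all_algebra all_fingroup.
From mathcomp Require Import all_classical all_reals all_analysis.
From mathcomp Require Import ring lra.
Import Pilot.Defs.
Set Implicit Arguments.
Unset Strict Implicit.
Unset Printing Implicit Defensive.
Import Order.TTheory GRing.Theory Num.Theory.
Import numFieldNormedType.Exports measurable_realfun.
Local Open Scope classical_set_scope.
Local Open Scope ring_scope.

(** * Metrics compatible with a topology *)

(** Comparing inverse maps alone gives exact left invariance, but forward maps are then controlled
    only through the modulus of continuity of one fixed system P: the radius of a delta-ball around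
    P that fits into a given d_alpha-ball depends on P. This is enough for open sets, provided that
    lifts of nearby homeomorphisms can be found near that same P. Hamiltonians are merely integrable
    in time, so H_t has no modulus of continuity uniform in t. Each estimate that moves the argument
    of a Hamiltonian therefore fixes a smooth approximant, takes its modulus, and only then chooses
    how close the isotopies have to be. Integrals are compared only after measurability is known:
    strong measurability in the sense of Bochner makes t |-> q(H_t) measurable for every Lipschitz
    functional q, in particular for the supremum norm and for the norm with the mean value. The
    contact condition enters through the positivity of the total volume, by which the mean value is
    normalized. *)

Definition unit_itv (R : realType) : set R := [set t : R | 0 <= t <= 1].

Lemma unit_itv_compact (R : realType) : compact (@unit_itv R).
Proof.
suff -> : @unit_itv R = `[0, 1]%classic by exact: segment_compact.
by apply/seteqP; split => t; rewrite /unit_itv /= in_itv.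
Qed.

(** The passage from local to uniform estimates. Besides radii it also produces global constants,
    when P bounds something by h^-1. *)
Lemma compact_small (R : realType) (X : topologicalType) (K : set X)
    (P : R -> X -> Prop) : compact K ->
  (forall x, K x -> exists2 r : R, 0 < r & exists2 B : set X, nbhs x B &
     forall h y, 0 < h -> h < r -> B y -> P h y) ->
  exists2 h : R, 0 < h & forall x, K x -> P h x.
Proof.
move=> /compact_near_coveringP cK HP.
have PK : \forall h \near at_right (0 : R), K `<=` P h.
  apply: cK => x /HP [r r0 [B nB HB]].
  exists (B, [set h | 0 < h < r]); first split => //=.
    by apply: filterS2 (nbhs_right_gt (0 : R)) (nbhs_right_lt r0) => h /= -> ->.
  by move=> [y h] /= [By /andP[h0 hr]]; exact: HB.
have [h [h0 Ph]] := filter_ex (filterI (nbhs_right_gt (0 : R)) PK).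
by exists h.
Qed.

(** The topology of M is given beforehand, so a metric is a plain function together with the
    statement that its balls generate this topology. *)
Record compat_metric (R : realType) (M : topologicalType) (D : M -> M -> R) :
    Prop := CompatMetric {
  cm_refl : forall x, D x x = 0 ;
  cm_sym : forall x y, D x y = D y x ;
  cm_tri : forall x y z, D x z <= D x y + D y z ;
  cm_sep : forall x y, D x y = 0 -> x = y ;
  cm_nbhs : forall x (B : set M),
    nbhs x B <-> exists2 e : R, 0 < e & forall y, D x y < e -> B y
}.

Lemma cm_ge0 (R : realType) (M : topologicalType) (D : M -> M -> R) :
  compat_metric D -> forall x y, 0 <= D x y.
Proof.
move=> cD x y; have := cm_tri cD x y x.
rewrite (cm_refl cD) (cm_sym cD y x); lra.
Qed.

Lemma compat_metric_norm (R : realType) :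
  compat_metric (fun x y : R => `|x - y|).
Proof.
split=> [x|x y|x y z|x y|x B].
- by rewrite subrr normr0.
- by rewrite distrC.
- by rewrite (le_trans _ (ler_normD _ _))// addrA subrK.
- by move=> /normr0_eq0 /eqP; rewrite subr_eq0 => /eqP.
- by rewrite -nbhs_ballE; split => [[e e0 H]|[e e0 H]]; exists e.
Qed.

(** The pullback of the l1 distance under the map with components [f i]. *)
Definition family_metric (R : realType) (T : Type) (I : finType)
    (f : I -> T -> R) (x y : T) : R := \sum_i `|f i x - f i y|.

(** Continuity of the components makes balls neighbourhoods. Conversely, the distance to x attains a
    minimum on the compact complement of an open neighbourhood, and the minimum is positive because
    the family separates points. *)
Lemma compat_family_metric (R : realType) (M : topologicalType) (I : finType)
    (f : I -> M -> R) :
  compact [set: M] -> (forall i, continuous (f i)) ->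
  (forall x y, (forall i, f i x = f i y) -> x = y) ->
  compat_metric (family_metric f).
Proof.
move=> cM cf sepf.
have rf x : family_metric f x x = 0.
  by apply: big1 => i _; rewrite subrr normr0.
have sep x y : family_metric f x y = 0 -> x = y.
  move=> /eqP; rewrite psumr_eq0 => [/allP H|i _]; last exact: normr_ge0.
  apply: sepf => i; apply/eqP; rewrite -subr_eq0 -normr_eq0.
  by apply: H; rewrite mem_index_enum.
have ge0 x y : 0 <= family_metric f x y by apply: sumr_ge0.
have cF x : continuous (family_metric f x).
  move=> y; apply: (@cvg_big _ _ +%R) => [|i _]; first exact: add_continuous; apply: cvg_norm; apply: cvgB.
    exact: cvg_cst.
  exact: cf.
split=> //.
- by move=> x y; apply: eq_bigr => i _; rewrite distrC.
- move=> x y z; rewrite /family_metric -big_split/=; apply: ler_sum => i _.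
  by rewrite (le_trans _ (ler_normD _ _))// addrA subrK.
move=> x B; split => [|[e e0 H]]; last first.
  have := cF x x; rewrite /continuous_at rf => /cvgrPdist_lt /(_ _ e0).
  by apply: filterS => y; rewrite sub0r normrN ger0_norm// => /H.
rewrite nbhsE => -[U [oU Ux] UB].
have [U0|/set0P U0] := eqVneq (~` U) set0.
  exists 1 => // y _; apply: UB; apply: contrapT => nU.
  by have : set0 y by rewrite -U0.
have cU : compact (~` U).
  by apply: subclosed_compact cM _ => //; exact: open_closedC.
have [c + cmin] := compact_EVT_min U0 cU (continuous_subspaceT (cF x)).
rewrite inE => nUc; exists (family_metric f x c).
  rewrite lt_neqAle ge0 andbT; apply/eqP => xc.
  by apply: nUc; rewrite -(sep x c).
move=> y; apply: contraPP => nBy; apply/negP; rewrite -leNgt.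
by apply: cmin; rewrite inE => Uy; apply: nBy; exact: UB.
Qed.

(** Uniform continuity on [0, 1] x M, with one modulus for time and space; values at other times are
    unconstrained. *)
Definition unif_cont (R : realType) (M N : Type) (D : M -> M -> R)
    (E : N -> N -> R) (f : R -> M -> N) : Prop :=
  forall e : R, 0 < e -> exists2 h : R, 0 < h & forall s t x y,
    0 <= s <= 1 -> 0 <= t <= 1 -> `|s - t| < h -> D x y < h ->
    E (f s x) (f t y) < e.

Section UnifCont.
Variables (R : realType) (M N : topologicalType).
Variables (D : M -> M -> R) (E : N -> N -> R).
Hypothesis cD : compat_metric D.
Hypothesis cE : compat_metric E.

Lemma nbhs_prod_metric (s : R) (x : M) (B : set (R * M)) :
  nbhs (s, x) B <-> exists2 e : R, 0 < e &
    forall t y, `|s - t| < e -> D x y < e -> B (t, y).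
Proof.
split=> [[[B1 B2] /= [nB1 nB2] HB]|[e e0 H]].
  move: nB1; rewrite -nbhs_ballE => -[e1 e10 H1].
  move/(cm_nbhs cD): nB2 => [e2 e20 H2].
  exists (Num.min e1 e2); first by rewrite lt_min e10 e20.
  move=> t y; rewrite !lt_min => /andP[st _] /andP[_ xy].
  by apply: HB; split => /=; [exact: H1|exact: H2].
exists (ball s e, [set y | D x y < e]) => /=.
  split; first exact: nbhsx_ballx.
  by apply/(cm_nbhs cD); exists e.
by move=> [t y] /= [st xy]; apply: H.
Qed.

Lemma within_unitP (f : R -> M -> N) (s : R) (x : M) : 0 <= s <= 1 ->
  ((fun z : R * M => f z.1 z.2) @
     within (@unit_itv R `*` [set: M]) (nbhs (s, x)) --> f s x) <->
  (forall e : R, 0 < e -> exists2 h : R, 0 < h & forall (t : R) (y : M), 0 <= t <= 1 ->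
     `|s - t| < h -> D x y < h -> E (f s x) (f t y) < e).
Proof.
move=> s01; split=> [H e e0|H].
  have /H : nbhs (f s x) [set z | E (f s x) z < e].
    by apply/(cm_nbhs cE); exists e.
  rewrite /fmap /= /within /= => /nbhs_prod_metric [h h0 Hh].
  by exists h => // t y t01 st xy; apply: (Hh t y) => //; split.
move=> B /(cm_nbhs cE)[e e0 He]; have [h h0 Hh] := H e e0.
apply/nbhs_prod_metric; exists h => // t y st xy [/= t01 _].
by apply: He; apply: Hh.
Qed.

Lemma jcontP (f : R -> M -> N) :
  {within @unit_itv R `*` [set: M], continuous (fun z : R * M => f z.1 z.2)}
  <-> forall (s : R) (x : M), 0 <= s <= 1 ->
  (forall e : R, 0 < e -> exists2 h : R, 0 < h & forall (t : R) (y : M), 0 <= t <= 1 ->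
     `|s - t| < h -> D x y < h -> E (f s x) (f t y) < e).
Proof.
split=> [/subspace_continuousP H s x s01|H].
  by apply/within_unitP => //; apply: (H (s, x)); split.
by apply/subspace_continuousP => -[s x] [/= s01 _]; apply/within_unitP => //; exact: H.
Qed.

(** The Heine-Cantor theorem on the compact product [0, 1] x M. *)
Lemma jcont_unif_cont (f : R -> M -> N) : compact [set: M] ->
  {within @unit_itv R `*` [set: M], continuous (fun z : R * M => f z.1 z.2)}
  <-> unif_cont D E f.
Proof.
move=> cM; split; last first.
  move=> H; apply/jcontP => s x s01 e e0; have [h h0 Hh] := H e e0.
  by exists h => // t y t01; apply: Hh.
move=> /jcontP H e e0.
have cK : compact (@unit_itv R `*` [set: M]).
  by apply: compact_setX => //; exact: unit_itv_compact.
have [|h h0 Hh] := @compact_small _ _ _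
  (fun (h : R) (z : R * M) => 0 <= z.1 <= 1 -> forall (t : R) (y : M), 0 <= t <= 1 -> `|z.1 - t| < h ->
     D z.2 y < h -> E (f z.1 z.2) (f t y) < e) cK.
  move=> [s x] [/= s01 _]; have [h h0 Hh] := H s x s01 (e / 2) (divr_gt0 e0 (ltr0Sn _ 1)).
  have h20 : 0 < h / 2 by rewrite divr_gt0.
  exists (h / 2) => //.
  exists [set z | `|s - z.1| < h / 2 /\ D x z.2 < h / 2].
    by apply/nbhs_prod_metric; exists (h / 2).
  move=> k [s' x'] /= k0 kh [ss xx] s'01 t y t01 st xy.
  have h1 : E (f s x) (f s' x') < e / 2 by apply: Hh => //; lra.
  have h2 : E (f s x) (f t y) < e / 2.
    apply: Hh => //.
      rewrite (le_lt_trans (ler_distD s' s t))//; lra.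
    rewrite (le_lt_trans (cm_tri cD x x' y))//; lra.
  rewrite (le_lt_trans (cm_tri cE _ (f s x) _))//.
  rewrite (cm_sym cE) ; lra.
by exists h => // s t x y s01 t01; apply: (Hh (s, x)).
Qed.

End UnifCont.

(** * Supremum norms and L1([0,1], C0(M)) *)

Section SupNorm.
Variables (R : realType) (M : topologicalType).
Hypothesis cM : compact [set: M].
Hypothesis M0 : [set: M] !=set0.

Lemma compact_bound (f : M -> R) : continuous f ->
  exists2 C : R, 0 <= C & forall x, `|f x| <= C.
Proof.
move=> cf.
have [|c _ H] := compact_EVT_max M0 cM (f := fun x => `|f x|).
  by apply: continuous_subspaceT => x; apply: cvg_norm; exact: cf.
by exists `|f c| => // x; apply: H; rewrite inE.
Qed.

Lemma supnorm_has_sup (f : M -> R) : continuous f ->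
  has_sup (range (fun x => `|f x|)).
Proof.
move=> /compact_bound[C C0 HC]; split.
  by have [x _] := M0; exists `|f x|; exists x.
by exists C => _ [x _ <-].
Qed.

Lemma ler_supnorm (f : M -> R) x : continuous f -> `|f x| <= supnorm f.
Proof. by move=> cf; apply: ub_le_sup; [exact: (supnorm_has_sup cf).2|exists x]. Qed.

Lemma supnorm_le (f : M -> R) c : (forall x, `|f x| <= c) -> supnorm f <= c.
Proof.
move=> H; apply: ge_sup; first by have [x _] := M0; exists `|f x|; exists x.
by move=> _ [x _ <-].
Qed.

Lemma supnorm_ge0 (f : M -> R) : 0 <= supnorm f.
Proof.
(* On an unbounded range [sup] takes its default value 0, so the inequality holds for discontinuous
   functions too. *)
have [x _] := M0; have [ub|nub] := pselect (has_ubound (range (fun x => `|f x|))).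
  by rewrite (le_trans (normr_ge0 (f x)))//; apply: ub_le_sup => //; exists x.
by rewrite /supnorm sup_out// => -[].
Qed.

Lemma supnormD (f g h : M -> R) : continuous f -> continuous g ->
  (forall x, `|h x| <= `|f x| + `|g x|) -> supnorm h <= supnorm f + supnorm g.
Proof.
move=> cf cg H; apply: supnorm_le => x; rewrite (le_trans (H x))//.
by rewrite lerD// ler_supnorm.
Qed.

Lemma supnorm_comp (f : M -> R) (phi : homeo M) : supnorm (f \o phi) = supnorm f.
Proof.
congr sup; apply/seteqP; split => _ [x _ <-]; first by exists (phi x).
by exists (hinv phi x) => //=; rewrite hinvK.
Qed.

Lemma supnorm_dist (f g : M -> R) : continuous f -> continuous g ->
  `|supnorm f - supnorm g| <= supnorm (fun x => f x - g x).
Proof.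
move=> cf cg; have cfg : continuous (fun x => f x - g x).
  by move=> x; apply: cvgB; [exact: cf|exact: cg].
have h1 : supnorm f <= supnorm (fun x => f x - g x) + supnorm g.
  by apply: supnormD => // x; rewrite (le_trans _ (ler_normD _ _))// subrK.
have h2 : supnorm g <= supnorm (fun x => f x - g x) + supnorm f.
  apply: supnormD => // x; have := ler_normB (f x) (f x - g x).
  by rewrite opprB addrC subrK addrC.
by rewrite ler_norml; apply/andP; split; lra.
Qed.

End SupNorm.

(** * Curves in C^0(M) with finitely many values *)

Section SimpleCurves.
Variables (R : realType) (M : topologicalType).
Implicit Types s : R -> M -> R.

Lemma simple_curve_eq s1 s2 : (forall t x, s1 t x = s2 t x) ->
  simple_curve s1 -> simple_curve s2.
Proof.
by move=> E [N [B [f [mB cf H]]]]; exists N, B, f; split => // t x; rewrite -E.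
Qed.

Lemma simple_curve0 : simple_curve (fun (_ : R) (_ : M) => 0 : R).
Proof.
exists 0%N, (fun _ => set0), (fun _ _ => 0); split => //.
- by move=> k x; exact: cvg_cst.
- by move=> t x; rewrite big_ord0.
Qed.

Lemma simple_curve_indic (B : set R) (f : M -> R) : measurable B -> continuous f ->
  simple_curve (fun t x => \1_B t * f x).
Proof.
by move=> mB cf; exists 1%N, (fun _ => B), (fun _ => f); split => // t x; rewrite big_ord1.
Qed.

Lemma simple_curveD s1 s2 : simple_curve s1 -> simple_curve s2 ->
  simple_curve (fun t x => s1 t x + s2 t x).
Proof.
move=> [N1 [B1 [f1 [mB1 cf1 H1]]]] [N2 [B2 [f2 [mB2 cf2 H2]]]].
exists (N1 + N2)%N, (fun k : 'I_(N1 + N2) => match fintype.split k with inl i => B1 i | inr i => B2 i end),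
  (fun k : 'I_(N1 + N2) => match fintype.split k with inl i => f1 i | inr i => f2 i end); split.
- by move=> k; case: fintype.split.
- by move=> k; case: fintype.split.
- move=> t x; rewrite big_split_ord/= H1 H2; congr (_ + _).
    by apply: eq_bigr => i _; rewrite -[lshift _ _]/(unsplit (inl i)) unsplitK.
  by apply: eq_bigr => i _; rewrite -[rshift _ _]/(unsplit (inr i)) unsplitK.
Qed.

Lemma simple_curve_sum (I : Type) (r : seq I) (s : I -> R -> M -> R) :
  (forall i, simple_curve (s i)) ->
  simple_curve (fun t x => \sum_(i <- r) s i t x).
Proof.
move=> H; elim: r => [|i r IH].
  by apply: simple_curve_eq simple_curve0 => t x; rewrite big_nil.
by apply: simple_curve_eq (simple_curveD (H i) IH) => t x; rewrite big_cons.
Qed.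

Lemma simple_curve_restrict (B : set R) s : measurable B -> simple_curve s ->
  simple_curve (fun t x => \1_B t * s t x).
Proof.
move=> mB [N [C [f [mC cf H]]]].
have h k : simple_curve (fun t x => \1_(B `&` C k) t * f k x).
  by apply: simple_curve_indic => //; exact: measurableI.
apply: simple_curve_eq (simple_curve_sum (index_enum _) h) => t x.
rewrite H big_distrr/=; apply: eq_bigr => k _.
by rewrite indicI /= mulrA.
Qed.

Lemma simple_curve_opp s : simple_curve s -> simple_curve (fun t x => - s t x).
Proof.
move=> [N [C [f [mC cf H]]]]; exists N, C, (fun k x => - f k x); split => //.
  by move=> k x; apply: cvgN; exact: cf.
by move=> t x; rewrite H -sumrN; apply: eq_bigr => k _; rewrite mulrN.
Qed.

Lemma simple_curve_continuous s t : simple_curve s -> continuous (s t).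
Proof.
move=> [N [C [f [mC cf H]]]].
have -> : s t = fun x => \sum_(k < N) \1_(C k) t * f k x by apply/funext => x; exact: H.
move=> x; apply: (@cvg_big _ _ +%R) => [|i _]; first exact: add_continuous.
by apply: cvgM; [exact: cvg_cst|exact: cf].
Qed.

(** The function [s t] depends only on the vector of bits recording which sets [C k] contain t.
    Hence any functional q, continuous or not, takes finitely many values along the curve, each on a
    Borel set. *)
Lemma simple_curve_measurable (q : (M -> R) -> R) s (B : set R) :
  simple_curve s -> measurable_fun B (fun t => q (s t)).
Proof.
move=> [N [C [f [mC cf H]]]].
pose b (t : R) := [ffun k : 'I_N => t \in C k].
pose psi (b : {ffun 'I_N -> bool}) := q (fun x => \sum_(k < N) (b k)%:R * f k x).
(* The indicator of the times whose bit vector is c, as a product of measurable factors. *)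
pose w (c : {ffun 'I_N -> bool}) (t : R) : R :=
  \prod_(k <- index_enum 'I_N) (if c k then \1_(C k) t else 1 - \1_(C k) t).
have wE c t : w c t = (c == b t)%:R.
  have [->|/eqP cb] := eqVneq c (b t).
    apply: big1 => k _; rewrite ffunE indicE; case: (t \in C k) => //=.
    by rewrite subr0.
  have [k ck] : exists k, c k != b t k.
    apply: contrapT => /forallNP h; apply: cb; apply/ffunP => k.
    by have /negP := h k; rewrite negbK => /eqP.
  rewrite /w (bigD1 k)//=; move: ck; rewrite ffunE indicE.
  by case: (c k); case: (t \in C k) => //= _; rewrite ?subrr mul0r.
have -> : (fun t => q (s t)) =
    fun t => \sum_(c <- index_enum {ffun 'I_N -> bool}) psi c * w c t.
  apply/funext => t; rewrite (bigD1 (b t))//= big1 ?addr0; last first.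
    by move=> c /negbTE cb; rewrite wE cb mulr0.
  rewrite wE eqxx mulr1; congr q; apply/funext => x; rewrite H.
  by apply: eq_bigr => k _; rewrite ffunE indicE.
apply: measurable_sum => c; apply: measurable_funM; first exact: measurable_cst.
apply: measurable_prod => k _; case: (c k); first exact: measurable_indic.
by apply: measurable_funB; [exact: measurable_cst|exact: measurable_indic].
Qed.

End SimpleCurves.

Section UnifContComp.
Variables (R : realType) (M N P : topologicalType).
Variables (D : M -> M -> R) (E : N -> N -> R) (G : P -> P -> R).
Hypothesis cD : compat_metric D.
Hypothesis cE : compat_metric E.

Lemma unif_cont_comp (g : R -> N -> P) (f : R -> M -> N) :
  unif_cont E G g -> unif_cont D E f ->
  unif_cont D G (fun t x => g t (f t x)).
Proof.
move=> ug uf e e0; have [h h0 Hh] := ug e e0; have [k k0 Hk] := uf h h0.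
exists (Num.min h k); first by rewrite lt_min h0 k0.
move=> s t x y s01 t01; rewrite !lt_min => /andP[sth stk] /andP[_ xyk].
by apply: Hh => //; exact: Hk.
Qed.

(** A map that does not depend on time, seen as a family so that it can be composed with one. *)
Lemma unif_cont_cst (f : M -> N) : compact [set: M] -> continuous f ->
  unif_cont D E (fun _ => f).
Proof.
move=> cM cf; apply/(jcont_unif_cont cD cE) => //.
by apply: continuous_subspaceT => z; apply: continuous_comp; [exact: cvg_snd|exact: cf].
Qed.

Lemma unif_cont_slice (f : R -> M -> N) t : unif_cont D E f -> 0 <= t <= 1 ->
  continuous (f t).
Proof.
move=> uf t01 x B /(cm_nbhs cE)[e e0 He]; have [h h0 Hh] := uf e e0.
apply/(cm_nbhs cD); exists h => // y xy; apply: He; apply: Hh => //.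
by rewrite subrr normr0.
Qed.

End UnifContComp.

(** * Bochner measurability and integrability *)

Section Bochner.
Variables (R : realType) (M : topologicalType) (D : M -> M -> R).
Hypothesis cD : compat_metric D.
Hypothesis cM : compact [set: M].
Hypothesis M0 : [set: M] !=set0.
Let dR : R -> R -> R := fun x y => `|x - y|.
Let cR : compat_metric dR := compat_metric_norm R.

Definition strongly_measurable (H : R -> M -> R) : Prop :=
  exists s : nat -> R -> M -> R, (forall i, simple_curve (s i)) /\
    forall t : R, 0 <= t <= 1 ->
      (fun i => supnorm (fun x => H t x - s i t x)) @ \oo --> (0 : R).

(** Approximation uniform in time, which is stronger than strong measurability and lets a limit of
    such curves be approximated along a diagonal. *)
Definition simply_approximable (H : R -> M -> R) : Prop :=
  forall e : R, 0 < e -> exists2 s, simple_curve s &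
    forall t x, 0 <= t <= 1 -> `|H t x - s t x| <= e.

Lemma continuousB (f g : M -> R) : continuous f -> continuous g ->
  continuous (fun x => f x - g x).
Proof. by move=> cf cg x; apply: cvgB; [exact: cf|exact: cg]. Qed.

(** Along the simple approximants q is measurable, and the Lipschitz bound turns convergence of
    these approximants into pointwise convergence of the values of q. *)
Lemma strongly_measurable_lipschitz (H : R -> M -> R) (q : (M -> R) -> R) C :
  (forall t, 0 <= t <= 1 -> continuous (H t)) -> strongly_measurable H ->
  (forall f g : M -> R, continuous f -> continuous g ->
     `|q f - q g| <= C * supnorm (fun x => f x - g x)) ->
  measurable_fun (`[0, 1]%classic : set R) (fun t : R => q (H t)).
Proof.
move=> cH [s [ss sH]] qC.
apply: (@measurable_fun_cvg _ _ _ _ (fun i t => q (s i t))).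
  by move=> i; exact: simple_curve_measurable.
move=> t; rewrite /= in_itv/= => t01; apply/cvgrPdist_le => e e0.
(* No sign is assumed for C, hence a positive substitute for it. *)
have C1 : 0 < `|C| + 1 by rewrite ltr_wpDl.
have /cvgrPdist_le /(_ (e / (`|C| + 1)) (divr_gt0 e0 C1)) := sH t t01.
apply: filterS => i; rewrite sub0r normrN.
rewrite ger0_norm ?supnorm_ge0// => Hi.
rewrite (le_trans (qC _ _ (cH _ t01) (simple_curve_continuous (ss i))))//.
rewrite (le_trans (_ : _ <= (`|C| + 1) * supnorm (fun x => H t x - s i t x)))//.
  apply: ler_wpM2r; first exact: supnorm_ge0.
  by rewrite (le_trans (ler_norm C))// lerDl.
by rewrite mulrC -ler_pdivlMr.
Qed.

Lemma strongly_measurable_limit (H : R -> M -> R) (K : nat -> R -> M -> R) :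
  (forall t, 0 <= t <= 1 -> continuous (H t)) ->
  (forall i t, 0 <= t <= 1 -> continuous (K i t)) ->
  (forall i, simply_approximable (K i)) ->
  (forall t, 0 <= t <= 1 ->
     (fun i => supnorm (fun x => H t x - K i t x)) @ \oo --> (0 : R)) ->
  strongly_measurable H.
Proof.
move=> cH cK aK HK.
have /choice [s Hs] : forall i, exists s : R -> M -> R, simple_curve s /\
    forall t x, 0 <= t <= 1 -> `|K i t x - s t x| <= i.+1%:R^-1.
  move=> i; have i0 : 0 < i.+1%:R^-1 :> R by rewrite invr_gt0.
  by have [s ss Hs] := aK i _ i0; exists s.
exists s; split=> [i|t t01]; first exact: (Hs i).1.
have H0 : (fun i => supnorm (fun x => H t x - K i t x) + i.+1%:R^-1) @ \oo --> (0 : R).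
  by rewrite -[X in _ --> X]addr0; apply: cvgD; [exact: HK|exact: cvg_harmonic].
apply: (squeeze_cvgr _ _ H0); last exact: cvg_cst.
apply: nearW => i; rewrite supnorm_ge0//=.
apply: supnorm_le => // x.
have -> : H t x - s i t x = (H t x - K i t x) + (K i t x - s i t x) by ring.
rewrite (le_trans (ler_normD _ _))// lerD ?(Hs i).2//.
by apply: (@ler_supnorm _ _ cM M0 (fun x => H t x - K i t x)); apply: continuousB; [exact: cH|exact: cK].
Qed.

(** Time is frozen at the left end of each interval of a subdivision finer than the modulus of
    continuity. *)
Lemma simply_approximable_continuous (H : R -> M -> R) :
  unif_cont D dR H -> simply_approximable H.
Proof.
move=> uH e e0; have [h h0 Hh] := uH e e0.
pose N := (Num.truncn h^-1).+1.
have N0 : 0 < N%:R :> R by rewrite ltr0n.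
have hN : N%:R^-1 < h.
  by rewrite invf_plt ?posrE//; have /truncn_itv/andP[] : 0 <= h^-1 by rewrite invr_ge0 ltW.
(* There are N + 1 half-open intervals, so that t = 1 is covered too, by the one that starts
   there. *)
pose B (k : 'I_N.+1) : set R := `[k%:R / N%:R, k.+1%:R / N%:R[%classic.
have in01 (k : 'I_N.+1) : 0 <= (k%:R / N%:R : R) <= 1.
  by rewrite divr_ge0// ler_pdivrMr// mul1r ler_nat -ltnS ltn_ord.
exists (fun t x => \sum_(k < N.+1) \1_(B k) t * H (k%:R / N%:R) x).
  apply: simple_curve_sum => k; apply: simple_curve_indic.
    exact: measurable_itv.
  exact: (unif_cont_slice cD cR uH (in01 k)).
move=> t x t01.
have /andP[t0 t1] := t01.
have tN0 : 0 <= t * N%:R by rewrite mulr_ge0.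
have /andP[k1 k2] := truncn_itv tN0.
have kN : (Num.truncn (t * N%:R) < N.+1)%N.
  rewrite ltnS -(@ler_nat R) (le_trans k1)//.
  by rewrite -[leRHS]mul1r ler_wpM2r.
pose k := Ordinal kN.
rewrite (bigD1 k)//= big1 ?addr0; last first.
  move=> j jk; rewrite indicE memNset ?mul0r//= /B /= in_itv/= ler_pdivrMr// ltr_pdivlMr//.
  apply/negP/nandP; rewrite -leNgt -ltNge.
  have : (j < k)%N || (k < j)%N by rewrite -neq_ltn.
  case/orP => jk'; [right|left].
    by rewrite (le_trans _ k1)// ler_nat.
  by rewrite (lt_le_trans k2)// ler_nat.
rewrite indicE mem_set ?mul1r; last first.
  by rewrite /B /= in_itv/= ler_pdivrMr// ltr_pdivlMr// k1.
apply/ltW/Hh => //.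
  exact: (in01 k).
  rewrite ger0_norm; last by rewrite subr_ge0 ler_pdivrMr.
  by rewrite (le_lt_trans _ hN)// lerBlDl -[X in _ <= _ + X]mul1r -mulrDl natr1 ler_pdivlMr// ltW.
by rewrite (cm_refl cD).
Qed.

(** Reparametrization destroys simplicity, but each coefficient [f k] becomes a jointly continuous
    family, which is approximable; multiplying by the Borel indicators keeps the approximants
    simple. *)
Lemma simply_approximable_comp (s : R -> M -> R) (Phi : R -> M -> M) :
  simple_curve s -> unif_cont D D Phi ->
  simply_approximable (fun t x => s t (Phi t x)).
Proof.
move=> [N [B [f [mB cf H]]]] uPhi e e0.
(* The N errors add up to at most e; the successor keeps the quotient positive when N = 0. *)
have eN : 0 < e / N.+1%:R by rewrite divr_gt0.
have /choice [r Hr] : forall k, exists r : R -> M -> R, simple_curve r /\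
    forall t x, 0 <= t <= 1 -> `|f k (Phi t x) - r t x| <= e / N.+1%:R.
  move=> k; have uf := unif_cont_comp (unif_cont_cst cD cR cM (cf k)) uPhi.
  by have [r sr Hr] := simply_approximable_continuous uf eN; exists r.
exists (fun t x => \sum_(k < N) \1_(B k) t * r k t x).
  by apply: simple_curve_sum => k; apply: simple_curve_restrict => //; exact: (Hr k).1.
move=> t x t01; rewrite H -sumrB (le_trans (ler_norm_sum _ _ _))//.
rewrite (@le_trans _ _ (\sum_(k < N) e / N.+1%:R))//.
  apply: ler_sum => k _; rewrite -mulrBr normrM.
  rewrite (le_trans _ ((Hr k).2 t x t01))// -[leRHS]mul1r ler_wpM2r//.
  by rewrite indicE; case: (t \in B k); rewrite ?normr1// normr0.
rewrite sumr_const card_ord -[leLHS]mulr_natr -mulrA ger_pMr// mulrC ler_pdivrMr// mul1r.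
by rewrite ler_nat.
Qed.

Local Notation mu := (@lebesgue_measure R).

(** Domination gives integrability once the norm is measurable in time, and it is, since the
    supremum norm is 1-Lipschitz. *)
Lemma L1C0_bounded (H : R -> M -> R) (b : R -> R) :
  (forall t, 0 <= t <= 1 -> continuous (H t)) -> strongly_measurable H ->
  mu.-integrable `[0, 1] (EFin \o b) ->
  (forall t, 0 <= t <= 1 -> supnorm (H t) <= b t) -> L1C0 H.
Proof.
move=> cH mH ib Hb; split => //.
have mq : measurable_fun (`[0, 1]%classic : set R) (fun t : R => supnorm (H t)).
  apply: (strongly_measurable_lipschitz cH mH (C := 1)) => f g cf cg.
  by rewrite mul1r; exact: supnorm_dist.
apply: le_integrable ib => //; first exact/measurable_EFinP.
move=> t; rewrite /= in_itv/= => t01; rewrite lee_fin !ger0_norm ?supnorm_ge0//.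
  exact: Hb.
by rewrite (le_trans _ (Hb t t01))// supnorm_ge0.
Qed.

Lemma L1C0D (H F : R -> M -> R) : L1C0 H -> L1C0 F ->
  L1C0 (fun t x => H t x + F t x).
Proof.
move=> [cH [s [ss sH]] iH] [cF [r [sr rF]] iF].
apply: (@L1C0_bounded _ (fun t => supnorm (H t) + supnorm (F t))).
- by move=> t t01 x; apply: cvgD; [exact: cH|exact: cF].
- exists (fun i t x => s i t x + r i t x); split => [i|t t01].
    exact: simple_curveD.
  have HK : (fun i => supnorm (fun x => H t x - s i t x) +
      supnorm (fun x => F t x - r i t x)) @ \oo --> (0 : R).
    by rewrite -[X in _ --> X]addr0; apply: cvgD; [exact: sH|exact: rF].
  apply: (squeeze_cvgr _ _ HK); last exact: cvg_cst.
  apply: nearW => i; rewrite supnorm_ge0//=.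
  apply: supnormD => //.
  - by apply: continuousB; [exact: cH|exact: simple_curve_continuous].
  - by apply: continuousB; [exact: cF|exact: simple_curve_continuous].
  - by move=> x; rewrite opprD addrACA ler_normD.
- by apply: (integrableD _ iH iF); exact: measurable_itv.
- by move=> t t01; apply: supnormD; [exact: cM| |exact: cH|exact: cF|move=> x; exact: ler_normD].
Qed.

Lemma L1C0N (H : R -> M -> R) : L1C0 H -> L1C0 (fun t x => - H t x).
Proof.
move=> [cH [s [ss sH]] iH].
have e (f : M -> R) : supnorm (fun x => - f x) = supnorm f.
  by congr sup; congr image; apply/funext => x; rewrite normrN.
apply: (@L1C0_bounded _ (fun t => supnorm (H t))) => //.
- by move=> t t01 x; apply: cvgN; exact: cH.
- exists (fun i t x => - s i t x); split => [i|t t01]; first exact: simple_curve_opp.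
  have -> : (fun i => supnorm (fun x => - H t x - - s i t x)) =
      (fun i => supnorm (fun x => H t x - s i t x)).
    apply/funext => i; rewrite -[RHS]e; congr (supnorm _); apply/funext => x.
    by rewrite opprD.
  exact: sH.
- by move=> t t01; rewrite e.
Qed.

Lemma L1C0B (H F : R -> M -> R) : L1C0 H -> L1C0 F ->
  L1C0 (fun t x => H t x - F t x).
Proof. by move=> lH lF; apply: L1C0D => //; exact: L1C0N. Qed.

(** Composition with [Phi t] does not increase supremum norms, so the reparametrized simple curves
    still converge, and each of them is simply approximable. *)
Lemma L1C0_comp (H : R -> M -> R) (Phi : R -> M -> M) :
  L1C0 H -> unif_cont D D Phi -> L1C0 (fun t x => H t (Phi t x)).
Proof.
move=> [cH [s [ss sH]] iH] uPhi.
have cP t : 0 <= t <= 1 -> continuous (Phi t) by apply: (unif_cont_slice cD cD uPhi).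
have le (f : M -> R) t : 0 <= t <= 1 -> continuous f ->
    supnorm (fun x => f (Phi t x)) <= supnorm f.
  by move=> t01 cf; apply: supnorm_le => // x; exact: ler_supnorm.
have cc (f : M -> R) t : 0 <= t <= 1 -> continuous f -> continuous (fun x => f (Phi t x)).
  by move=> t01 cf x; apply: continuous_comp; [exact: cP|exact: cf].
apply: (@L1C0_bounded _ (fun t => supnorm (H t))) => //.
- by move=> t t01; apply: cc => //; exact: cH.
- apply: (@strongly_measurable_limit _ (fun i t x => s i t (Phi t x))).
  + by move=> t t01; apply: cc => //; exact: cH.
  + by move=> i t t01; apply: cc => //; exact: simple_curve_continuous.
  + by move=> i; exact: simply_approximable_comp.
  + move=> t t01; apply: (squeeze_cvgr _ _ (sH t t01)); last exact: cvg_cst.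
    apply: nearW => i; rewrite supnorm_ge0//=.
    apply: (le (fun x => H t x - s i t x)) => //.
    by apply: continuousB; [exact: cH|exact: simple_curve_continuous].
- by move=> t t01; apply: le => //; exact: cH.
Qed.

Lemma unif_cont_bounded (H : R -> M -> R) : unif_cont D dR H ->
  exists2 C, 0 <= C & forall t x, 0 <= t <= 1 -> `|H t x| <= C.
Proof.
move=> /(jcont_unif_cont cD cR _ cM) cH.
have cK : compact (@unit_itv R `*` [set: M]).
  by apply: compact_setX => //; exact: unit_itv_compact.
have K0 : (@unit_itv R `*` [set: M]) !=set0.
  by have [x _] := M0; exists (0, x); split => //; rewrite /unit_itv /= lexx ler01.
have [|c _ Hc] := compact_EVT_max K0 cK (f := fun z => `|H z.1 z.2|).
  by move=> z; apply: continuous_comp; [exact: cH|exact: norm_continuous].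
exists `|H c.1 c.2| => // t x t01; apply: (Hc (t, x)).
by rewrite inE.
Qed.

Lemma L1C0_unif_cont (H : R -> M -> R) : unif_cont D dR H -> L1C0 H.
Proof.
move=> uH; have [C C0 HC] := unif_cont_bounded uH.
have cH t : 0 <= t <= 1 -> continuous (H t) by apply: (unif_cont_slice cD cR uH).
apply: (@L1C0_bounded _ (fun=> C)) => //.
- apply: (@strongly_measurable_limit _ (fun=> H)) => //.
    by move=> _; exact: simply_approximable_continuous.
  move=> t t01; rewrite (_ : (fun _ => _) = fun=> 0); first exact: cvg_cst.
  apply/funext => _; apply/eqP; rewrite eq_le supnorm_ge0// andbT.
  by apply: supnorm_le => // x; rewrite subrr normr0.
- apply: continuous_compact_integrable; first exact: segment_compact.
  by apply: continuous_subspaceT => t; exact: cvg_cst.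
- by move=> t t01; apply: supnorm_le => // x; exact: HC.
Qed.

End Bochner.

(** * Functions of class Ck *)

Section NearDiff.
Variables (R : realType) (U V : normedModType R).

(** The remainder of f serves for g, because a little-o condition at x only sees a neighbourhood;
    uniqueness of the differential does the rest. *)
Lemma near_eq_diff_spec (f g : U -> V) x : {near x, f =1 g} -> differentiable f x ->
  'd g x = 'd f x :> (U -> V) /\ differentiable g x.
Proof.
move=> fg /diff_locallyP[cdf dfx].
have fgx : f x = g x by exact: nbhs_singleton fg.
have h : g \o shift x = cst (g x) + 'd f x +o_ 0 id.
  apply/eqaddoP => e e0; move/eqaddoP : dfx => /(_ e e0).
  have : \forall y \near (0 : U), f (y + x) = g (y + x).
    by move: fg; rewrite (near_shift 0); apply: filterS => y /=; rewrite subr0.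
  apply: filter_app2; apply: nearW => y /= E; rewrite -fgx.
  by rewrite !fctE /= E.
have E := diff_unique cdf h.
split; first exact: E.
by apply/diff_locallyP; rewrite E; split; [exact: cdf|exact: h].
Qed.

Lemma near_eq_differentiable (f g : U -> V) x : {near x, f =1 g} ->
  differentiable f x -> differentiable g x.
Proof. by move=> fg df; have [] := near_eq_diff_spec fg df. Qed.

Lemma near_eq_diff (f g : U -> V) x : {near x, f =1 g} -> differentiable f x ->
  'd g x = 'd f x :> (U -> V).
Proof. by move=> fg df; have [] := near_eq_diff_spec fg df. Qed.

End NearDiff.

Section CkTheory.
Variables (R : realType) (U : normedModType R).
Implicit Types (V : normedModType R) (W : set U).

Lemma Ck_sub V k W W' (f : U -> V) : W' `<=` W -> Ck k W f -> Ck k W' f.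
Proof.
move=> WW; elim: k f => [|k IH] f /=; first by move=> H x /WW /H.
by move=> [df Df]; split => [x /WW /df //|v]; exact: IH.
Qed.

(** Openness of W makes equality on W an equality of germs, which derivatives respect. *)
Lemma Ck_eq V k W (f g : U -> V) : open W -> (forall x, W x -> f x = g x) ->
  Ck k W f -> Ck k W g.
Proof.
move=> oW; elim: k f g => [|k IH] f g fg.
  move=> /= H x Wx; rewrite /prop_for /continuous_at -(fg x Wx).
  apply: cvg_trans (H x Wx); apply: near_eq_cvg.
  by have := open_nbhs_nbhs (conj oW Wx); apply: filterS => y /fg ->.
have nfg x : W x -> {near x, f =1 g}.
  by move=> Wx; have := open_nbhs_nbhs (conj oW Wx); apply: filterS => y /fg ->.
move=> [df Df]; split=> [x Wx|v].
  by apply: near_eq_differentiable (df x Wx); exact: nfg.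
by apply: IH (Df v) => x Wx; apply: near_eq_derive; exact: nfg.
Qed.

Lemma Ck_pred V k W (f : U -> V) : Ck k.+1 W f -> Ck k W f.
Proof.
elim: k f => [|k IH] f.
  by move=> [df _] x Wx; apply: differentiable_continuous; exact: df.
by move=> [df Df]; split => // v; apply: IH; exact: Df.
Qed.

Lemma Ck_cst V k W (c : V) : Ck k W (fun=> c).
Proof.
elim: k c => [|k IH] c /=; first by move=> x _; exact: cvg_cst.
split=> [x _|v]; first exact: differentiable_cst.
by rewrite (_ : 'D_v _ = fun=> 0)//; apply/funext => x; exact: derive_cst.
Qed.

Lemma CkD V k W (f g : U -> V) : open W -> Ck k W f -> Ck k W g ->
  Ck k W (fun x => f x + g x).
Proof.
move=> oW; elim: k f g => [|k IH] f g.
  by move=> cf cg x Wx; apply: cvgD; [exact: cf|exact: cg].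
move=> [df Df] [dg Dg]; split => [x Wx|v].
  by apply: differentiableD; [exact: df|exact: dg].
apply: Ck_eq (IH _ _ (Df v) (Dg v)) => // x Wx.
by rewrite -(@deriveD _ _ _ f g)//; apply: diff_derivable; [exact: df|exact: dg].
Qed.

Lemma CkM k W (f g : U -> R) : open W -> Ck k W f -> Ck k W g ->
  Ck k W (fun x => f x * g x).
Proof.
move=> oW; elim: k f g => [|k IH] f g.
  by move=> cf cg x Wx; apply: cvgM; [exact: cf|exact: cg].
move=> hf hg; have [df Df] := hf; have [dg Dg] := hg; split => [x Wx|v].
  by apply: differentiableM; [exact: df|exact: dg].
apply: (@Ck_eq _ _ _ (fun x => f x * 'D_v g x + g x * 'D_v f x)) => //.
  move=> x Wx; have := @deriveM _ _ f g x v.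
  by move=> ->//; apply: diff_derivable; [exact: df|exact: dg].
apply: CkD => //; apply: IH; [exact: (Ck_pred hf)|exact: Dg|exact: (Ck_pred hg)|exact: Df].
Qed.

Lemma Ck_sum V k W (I : Type) (r : seq I) (f : I -> U -> V) : open W ->
  (forall i, Ck k W (f i)) -> Ck k W (fun x => \sum_(i <- r) f i x).
Proof.
move=> oW H; elim: r => [|i r IH].
  by apply: Ck_eq (Ck_cst k W 0) => // x _; rewrite big_nil.
by apply: Ck_eq (CkD oW (H i) IH) => // x _; rewrite big_cons.
Qed.

Lemma differentiable_coordE m n (F : U -> 'M[R]_(m, n)) i j x : differentiable F x ->
  differentiable (fun z => F z i j) x /\
  forall v, 'D_v (fun z => F z i j) x = 'D_v F x i j.
Proof.
move=> dF; split; last first.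
  by move=> v; rewrite derive_mx ?mxE//; exact: diff_derivable.
exact: (differentiable_comp dF (differentiable_coord _ i j)).
Qed.

Lemma Ck_coord m n k W (F : U -> 'M[R]_(m, n)) i j : open W -> Ck k W F ->
  Ck k W (fun z => F z i j).
Proof.
move=> oW; elim: k F => [|k IH] F.
  move=> cF x Wx; apply: (@continuous_comp _ _ _ F (fun N => N i j) x (cF x Wx)).
  exact: coord_continuous.
move=> [dF DF]; split => [x Wx|v].
  by have [] := differentiable_coordE i j (dF x Wx).
apply: Ck_eq (IH _ (DF v)) => // x Wx.
by have [_ ->] := differentiable_coordE i j (dF x Wx).
Qed.

Lemma row_coords m (F : U -> 'rV[R]_m) :
  F = fun z => \sum_(j < m) F z 0 j *: delta_mx 0 j.
Proof. by apply/funext => z; exact: row_sum_delta. Qed.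

Lemma Ck_row m k W (F : U -> 'rV[R]_m) : open W ->
  (forall j, Ck k W (fun z => F z 0 j)) -> Ck k W F.
Proof.
move=> oW; elim: k F => [|k IH] F H.
  rewrite [F]row_coords => x Wx.
  apply: (@cvg_big _ _ +%R) => [|j _]; first exact: add_continuous.
  by apply: cvgZr_tmp; exact: H.
have dF x : W x -> differentiable F x.
  move=> Wx; rewrite [F]row_coords.
  rewrite (_ : (fun _ => _) = \sum_(j < m) (fun z => F z 0 j *: delta_mx 0 j)); last first.
    by apply/funext => z; rewrite fct_sumE.
  by apply: differentiable_sum => j; apply: differentiableZl; exact: (H j).1.
split => // v; apply: IH => j.
apply: Ck_eq ((H j).2 v) => // x Wx.
by have [_ ->] := differentiable_coordE 0 j (dF x Wx).
Qed.

End CkTheory.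

(** * Calculus on R x R^p *)

Section TimeSpace.
Variables (R : realType) (p : nat).
Local Notation E := 'rV[R]_p.

Definition dir_t : R * E := (1, 0).
Definition dir_x (w : E) : R * E := (0, w).

Lemma time_space_decomp (v : R * E) :
  v = v.1 *: dir_t + \sum_(k < p) v.2 0 k *: dir_x (delta_mx 0 k).
Proof.
have sE (I : Type) (r : seq I) (f : I -> R * E) :
    \sum_(i <- r) f i = (\sum_(i <- r) (f i).1, \sum_(i <- r) (f i).2).
  by elim/big_rec3: _ => //= i a b c _ ->; case: (f i).
rewrite sE; case: v => a w; congr pair => /=.
  rewrite big1 ?addr0 => [|k _]; last by rewrite scaler0.
  by rewrite [a *: 1]mulr1.
by rewrite scaler0 add0r [LHS]row_sum_delta.
Qed.

Lemma diff_time_space (V : normedModType R) (f : R * E -> V) z v : differentiable f z ->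
  'd f z v = v.1 *: 'D_dir_t f z +
    \sum_(k < p) v.2 0 k *: 'D_(dir_x (delta_mx 0 k)) f z.
Proof.
move=> df; rewrite {1}[v]time_space_decomp linearD linearZ linear_sum deriveE//.
congr (_ + _); apply: eq_bigr => k _.
by rewrite linearZ deriveE.
Qed.

Section Comp.
Variables (U : normedModType R).

Lemma derive_comp (V V' : normedModType R) (g : U -> V) (f : V -> V') z v :
  differentiable g z -> differentiable f (g z) ->
  'D_v (fun z => f (g z)) z = 'd f (g z) ('D_v g z).
Proof.
move=> dg df; rewrite deriveE; last exact: differentiable_comp.
by rewrite deriveE// (diff_comp dg df).
Qed.

Lemma derive_pair (V V' : normedModType R) (f : U -> V) (g : U -> V') z v :
  differentiable f z -> differentiable g z ->
  'D_v (fun z => (f z, g z)) z = ('D_v f z, 'D_v g z).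
Proof.
move=> df dg; rewrite deriveE; last exact: differentiable_pair.
by rewrite diff_pair// !deriveE.
Qed.

(** [Ck] differentiates along constant vectors, whereas the chain rule produces a direction that
    varies with z. Expanding this direction in the standard basis gives a finite sum of products, to
    which the induction hypothesis applies; products require scalar values of f. *)
Lemma Ck_comp_scalar k (W : set U) (W' : set (R * E)) (g1 : U -> R) (g2 : U -> E)
    (f : R * E -> R) : open W ->
  (forall z, W z -> W' (g1 z, g2 z)) -> Ck k W g1 -> Ck k W g2 -> Ck k W' f ->
  Ck k W (fun z => f (g1 z, g2 z)).
Proof.
move=> oW WW; elim: k f g1 g2 WW => [|k IH] f g1 g2 WW.
  move=> c1 c2 cf z Wz.
  apply: (@continuous_comp _ _ _ (fun z => (g1 z, g2 z)) f); last exact/cf/WW.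
  have c1z : g1 @ z --> g1 z := c1 z Wz.
  have c2z : g2 @ z --> g2 z := c2 z Wz.
  exact: (cvg_pair c1z c2z).
move=> h1 h2 hf; have [d1 D1] := h1; have [d2 D2] := h2; have [df Df] := hf.
have dg z : W z -> differentiable (fun z => (g1 z, g2 z)) z.
  by move=> Wz; apply: differentiable_pair; [exact: d1|exact: d2].
split=> [z Wz|v].
  exact: (differentiable_comp (dg z Wz) (df _ (WW z Wz))).
have c1 := Ck_pred h1; have c2 := Ck_pred h2.
apply: (@Ck_eq _ _ _ _ _ (fun z => 'D_v g1 z * 'D_dir_t f (g1 z, g2 z) +
    \sum_(k < p) 'D_v g2 z 0 k * 'D_(dir_x (delta_mx 0 k)) f (g1 z, g2 z))) => //.
  move=> z Wz; rewrite (derive_comp _ (dg z Wz) (df _ (WW z Wz))).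
  rewrite diff_time_space; last exact/df/WW.
  by rewrite derive_pair//; [exact: d1|exact: d2].
apply: CkD => //.
  by apply: (CkM oW (D1 v)); exact: (IH ('D_dir_t f) g1 g2 WW c1 c2 (Df _)).
apply: Ck_sum => // j; apply: (CkM oW (Ck_coord _ _ oW (D2 v))).
exact: (IH ('D_(dir_x (delta_mx 0 j)) f) g1 g2 WW c1 c2 (Df _)).
Qed.

Lemma Ck_comp k q (W : set U) (W' : set (R * E)) (g1 : U -> R) (g2 : U -> E)
    (f : R * E -> 'rV[R]_q) : open W -> open W' ->
  (forall z, W z -> W' (g1 z, g2 z)) -> Ck k W g1 -> Ck k W g2 -> Ck k W' f ->
  Ck k W (fun z => f (g1 z, g2 z)).
Proof.
move=> oW oW' WW c1 c2 cf; apply: Ck_row => // j.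
by apply: (@Ck_comp_scalar _ _ W' g1 g2 (fun z => f z 0 j)) => //; exact: Ck_coord.
Qed.

End Comp.

Lemma Ck_fst (U V : normedModType R) k (W : set (U * V)) : Ck k W fst.
Proof.
case: k => [|k]; first by move=> z _; exact: cvg_fst.
have d (z : U * V) : differentiable fst z.
  by apply: linear_differentiable => z'; exact: cvg_fst.
split => // v; rewrite (_ : 'D_v _ = fun=> v.1); first exact: Ck_cst.
apply/funext => z; rewrite deriveE// diff_lin// => z'; exact: cvg_fst.
Qed.

End TimeSpace.

(** * Smooth families in charts *)

Section Dotv.
Variables (R : realType) (p : nat).
Implicit Types u v w : 'rV[R]_p.

Lemma dotvDr u v w : dotv u (v + w) = dotv u v + dotv u w.
Proof. by rewrite /dotv -big_split; apply: eq_bigr => k _; rewrite mxE mulrDr. Qed.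

Lemma dotv0r u : dotv u 0 = 0.
Proof. by apply: big1 => k _; rewrite mxE mulr0. Qed.

End Dotv.

Section TimeCompose.
Variables (R : realType) (p q s : nat).

(** Models t |-> f_t o g_t in coordinates: both families are evaluated at the same time, so the time
    variable is carried along. *)
Lemma smooth_on_time_compose (W1 : set (R * 'rV[R]_p)) (W2 : set (R * 'rV[R]_q))
    (F1 : R * 'rV[R]_p -> 'rV[R]_q) (F2 : R * 'rV[R]_q -> 'rV[R]_s) :
  open W1 -> smooth_on W1 F1 -> open W2 -> smooth_on W2 F2 ->
  open (W1 `&` [set z | W2 (z.1, F1 z)]) /\
  smooth_on (W1 `&` [set z | W2 (z.1, F1 z)]) (fun z => F2 (z.1, F1 z)).
Proof.
move=> o1 s1 o2 s2.
have oW : open (W1 `&` [set z | W2 (z.1, F1 z)]).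
  rewrite openE => z [W1z W2z]; apply: filterI.
    exact: open_nbhs_nbhs (conj o1 W1z).
  have cF : F1 @ z --> F1 z := s1 0%N z W1z.
  have c1 : fst @ z --> z.1 by exact: cvg_fst.
  exact: (cvg_pair c1 cF (open_nbhs_nbhs (conj o2 W2z))).
split=> // k.
apply: (@Ck_comp _ _ _ _ _ _ W2 fst F1 F2) => //.
- by move=> z [].
- exact: Ck_fst.
- by apply: Ck_sub (s1 k) => z [].
Qed.

Lemma derive_time_compose (F1 : R * 'rV[R]_p -> 'rV[R]_q)
    (F2 : R * 'rV[R]_q -> 'rV[R]_s) z v :
  differentiable F1 z -> differentiable F2 (z.1, F1 z) ->
  'D_v (fun z => F2 (z.1, F1 z)) z = 'd F2 (z.1, F1 z) (v.1, 'D_v F1 z).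
Proof.
move=> d1 d2.
have df : differentiable (fst : R * 'rV[R]_p -> R) z.
  exact: (Ck_fst 1 setT).1.
rewrite (@derive_comp _ _ _ _ (fun z => (z.1, F1 z)) F2)//; last exact: differentiable_pair.
rewrite derive_pair//; congr ('d F2 _ (_, _)).
by rewrite deriveE// diff_lin// => z'; exact: cvg_fst.
Qed.

End TimeCompose.

(** * Coordinate expressions of smooth families *)

Section LocalRep.
Variables (R : realType) (m : nat) (M : topologicalType) (A : atlas R m M).
Local Notation E := 'rV[R]_m.+1.
Implicit Types (f g : R -> M -> M) (i j k : 'I_(nchart A)).

(** F may live at times outside [0, 1], where it says nothing about f; this is what makes ordinary
    derivatives available at t = 0 and t = 1. *)
Definition local_rep f i j (W : set (R * E)) (F : R * E -> E) : Prop :=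
  [/\ open W, smooth_on W F & forall t y, W (t, y) -> 0 <= t <= 1 ->
     [/\ img i y, dom j (f t (param i y)) & chart j (f t (param i y)) = F (t, y)]].

Lemma local_rep_exists f i j (t : R) (y : E) : smooth_family A f -> 0 <= t <= 1 -> img i y ->
  dom j (f t (param i y)) -> exists W F, local_rep f i j W F /\ W (t, y).
Proof. by move=> sf t01 iy jf; have [W [F [oW Wy sF H]]] := sf i j t y t01 iy jf; exists W, F. Qed.

Lemma local_rep_differentiable f i j W F z : local_rep f i j W F -> W z ->
  differentiable F z.
Proof. by move=> [_ sF _] Wz; exact: (sF 1%N).1. Qed.

Lemma local_rep_comp f g i j k W1 F1 W2 F2 :
  local_rep g i k W1 F1 -> local_rep f k j W2 F2 ->
  local_rep (fun t x => f t (g t x)) i j (W1 `&` [set z | W2 (z.1, F1 z)])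
    (fun z => F2 (z.1, F1 z)).
Proof.
move=> [ow1 s1 r1] [ow2 s2 r2].
have [oW sW] := smooth_on_time_compose ow1 s1 ow2 s2.
split=> // t y [W1y /= W2y] t01.
have [iy kg gE] := r1 t y W1y t01; have [_] := r2 _ _ W2y t01.
by rewrite -gE chartK.
Qed.

Lemma smooth_family_comp f g : smooth_family A f -> smooth_family A g ->
  smooth_family A (fun t x => f t (g t x)).
Proof.
move=> sf sg i j t y t01 iy jfg.
have [k kg] := dom_cover A (g t (param i y)).
have [W1 [F1 [r1 W1y]]] := local_rep_exists sg t01 iy kg.
have kk := chart_img kg.
have [|W2 [F2 [r2 W2y]]] := local_rep_exists (j := j) sf t01 kk.
  by rewrite chartK.
have [oW sF rF] := local_rep_comp r1 r2.
eexists; eexists; split; [exact: oW| |exact: sF|exact: rF].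
split => //=; have [_ _ rep1] := r1; have [_ _ <-] := rep1 _ _ W1y t01.
exact: W2y.
Qed.

(** Fixing t identifies the differential of the coordinate expression of [f t], in which [preserves]
    is written, with the space derivative of F. *)
Lemma local_rep_slice f i j W F (t : R) (y : E) : local_rep f i j W F -> W (t, y) -> 0 <= t <= 1 ->
  [/\ {near y, (fun y => F (t, y)) =1 chart j \o f t \o param i},
      differentiable (chart j \o f t \o param i) y &
      forall v, 'd (chart j \o f t \o param i) y v = 'D_(dir_x v) F (t, y)].
Proof.
move=> rF Wty t01; have [oW sF H] := rF.
have dF := local_rep_differentiable rF Wty.
have c2 : (fun y' : E => (t, y')) @ y --> (t, y).
  have ct : (fun _ : E => t) @ y --> t := @cvg_cst _ t _ (nbhs y) (nbhs_filter y).
  have ci : (fun y' : E => y') @ y --> y by move=> B.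
  exact: (cvg_pair ct ci).
have nE : {near y, (fun y => F (t, y)) =1 chart j \o f t \o param i}.
  have : \forall y' \near y, W (t, y').
    by apply: (c2 W); exact: open_nbhs_nbhs.
  by apply: filterS => y' Wy'; have [_ _ /= ->] := H t y' Wy' t01.
have did : differentiable (id : E -> E) y by [].
have dct : differentiable (cst t : E -> R) y by exact: differentiable_cst.
have dp : differentiable (fun y' : E => (t, y')) y := differentiable_pair dct did.
have dc : differentiable (fun y => F (t, y)) y := differentiable_comp dp dF.
split=> //; first exact: near_eq_differentiable nE dc.
move=> v; rewrite (near_eq_diff nE dc).
rewrite (diff_comp (f := fun y' : E => (t, y')) dp dF)/= deriveE//; congr ('d F _ _).
by rewrite (diff_pair dct did) diff_cst [in LHS]diff_val.
Qed.

End LocalRep.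

(** * Products and inverses of smooth strictly contact systems *)

Definition hsym (M : topologicalType) (f : homeo M) : homeo M :=
  Homeo (hinvK f) (hmapK f) (@hinv_cont M f) (@hmap_cont M f).

Lemma linear_time_space (R : realType) (p : nat) (V : normedModType R)
    (L : {linear (R * 'rV[R]_p)%type -> V}) a w :
  L (a, w) = a *: L (dir_t R p) + L (dir_x w).
Proof.
rewrite -linearZ -linearD; congr (L _); congr pair => /=.
  by rewrite addr0 [_ *: 1]mulr1.
by rewrite scaler0 add0r.
Qed.

Section Contact.
Variables (R : realType) (m : nat) (M : topologicalType) (A : atlas R m M).
Variable alpha : one_form A.
Local Notation E := 'rV[R]_m.+1.
Implicit Types (f g : R -> M -> M) (i j k : 'I_(nchart A)).

(** For v = (1, 0) this is the rule that the velocity of f_t o g_t is that of f_t plus the image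
    under the differential of f_t of the velocity of g_t. *)
Lemma derive_rep_comp f g i j k W1 F1 W2 F2 (t : R) (y : E) v :
  local_rep g i k W1 F1 -> local_rep f k j W2 F2 -> W1 (t, y) -> W2 (t, F1 (t, y)) ->
  'D_v (fun z => F2 (z.1, F1 z)) (t, y) =
  v.1 *: 'D_(dir_t R m.+1) F2 (t, F1 (t, y)) +
  'D_(dir_x ('D_v F1 (t, y))) F2 (t, F1 (t, y)).
Proof.
move=> r1 r2 W1y W2y.
have d1 := local_rep_differentiable r1 W1y.
have d2 := local_rep_differentiable r2 W2y.
rewrite derive_time_compose// (deriveE _ d1).
rewrite [in RHS](deriveE _ d2) [in RHS](deriveE _ d2).
exact: linear_time_space.
Qed.

Lemma preserves_rep f i j W F (t : R) (y : E) v : local_rep f i j W F -> W (t, y) ->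
  0 <= t <= 1 -> preserves alpha (f t) ->
  dotv (coef alpha j (F (t, y))) ('D_(dir_x v) F (t, y)) = dotv (coef alpha i y) v.
Proof.
move=> rF Wy t01 pf; have [_ _ H] := rF; have [iy jf <-] := H t y Wy t01.
by have [_ _ <-] := local_rep_slice rF Wy t01; exact: pf.
Qed.

Lemma preserves_of_rep f t : 0 <= t <= 1 ->
  (forall i j y v, img i y -> dom j (f t (param i y)) ->
     exists W F, [/\ local_rep f i j W F, W (t, y) &
       dotv (coef alpha j (F (t, y))) ('D_(dir_x v) F (t, y)) =
       dotv (coef alpha i y) v]) ->
  preserves alpha (f t).
Proof.
move=> t01 H i j y v iy jf; have [W [F [rF Wy <-]]] := H i j y v iy jf.
have [_ _ ->] := local_rep_slice rF Wy t01.
by have [_ _ rF'] := rF; have [_ _ ->] := rF' t y Wy t01.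
Qed.

Lemma comp_reps_exist f g i j (t : R) (y : E) :
  smooth_family A f -> smooth_family A g -> 0 <= t <= 1 -> img i y ->
  dom j (f t (g t (param i y))) ->
  exists k W1 F1 W2 F2, [/\ local_rep g i k W1 F1, local_rep f k j W2 F2,
    W1 (t, y), W2 (t, F1 (t, y)) & param k (F1 (t, y)) = g t (param i y)].
Proof.
move=> sf sg t01 iy jfg; have [k kg] := dom_cover A (g t (param i y)).
have [W1 [F1 [r1 W1y]]] := local_rep_exists sg t01 iy kg.
have [_ _ H1] := r1; have [_ _ E1] := H1 t y W1y t01.
have [|W2 [F2 [r2 W2y]]] := local_rep_exists (j := j) sf t01 (chart_img kg).
  by rewrite chartK.
exists k, W1, F1, W2, F2; split => //; first by rewrite -E1.
by rewrite -E1 chartK.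
Qed.

Lemma preserves_comp f g (t : R) : smooth_family A f -> smooth_family A g ->
  0 <= t <= 1 -> preserves alpha (f t) -> preserves alpha (g t) ->
  preserves alpha (fun x => f t (g t x)).
Proof.
move=> sf sg t01 pf pg.
apply: (@preserves_of_rep (fun t x => f t (g t x))) => // i j y v iy jfg.
have [k [W1 [F1 [W2 [F2 [r1 r2 W1y W2y _]]]]]] := comp_reps_exist sf sg t01 iy jfg.
exists (W1 `&` [set z | W2 (z.1, F1 z)]), (fun z => F2 (z.1, F1 z)); split => //.
  exact: local_rep_comp r1 r2.
rewrite (derive_rep_comp _ r1 r2 W1y W2y) /= scale0r add0r.
by rewrite (preserves_rep _ r2 W2y t01 pf) (preserves_rep _ r1 W1y t01 pg).
Qed.

(** Near y the coordinate expression of f_t o g_t, taken back to the chart i, is the identity. *)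
Lemma derive_rep_cancel f g i j W1 F1 W2 F2 (t : R) (y v : E) :
  local_rep g i j W1 F1 -> local_rep f j i W2 F2 -> W1 (t, y) -> W2 (t, F1 (t, y)) ->
  0 <= t <= 1 -> (forall x, f t (g t x) = x) ->
  'D_(dir_x ('D_(dir_x v) F1 (t, y))) F2 (t, F1 (t, y)) = v.
Proof.
move=> r1 r2 W1y W2y t01 fgK.
have := derive_rep_comp (dir_x v) r1 r2 W1y W2y; rewrite scale0r add0r => <-.
have r12 := local_rep_comp r1 r2.
have W12 : (W1 `&` [set z | W2 (z.1, F1 z)]) (t, y) by [].
have [nE dE <-] := local_rep_slice r12 W12 t01.
have nid : {near y, (id : E -> E) =1
    chart i \o (fun x => f t (g t x)) \o param i}.
  have [_ _ H1] := r1; have [iy _ _] := H1 t y W1y t01.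
  have : \forall y' \near y, img i y' by apply: open_nbhs_nbhs; split => //; exact: img_open.
  by apply: filterS => y' iy'; rewrite /= fgK paramK.
have did : differentiable (id : E -> E) y by [].
by rewrite (near_eq_diff nid did) diff_val.
Qed.

(** Invariance of alpha under f_t, applied to the vector Dg_t v, gives alpha(Dg_t v) = alpha(Df_t
    Dg_t v) = alpha(v). *)
Lemma preserves_inv f g (t : R) : smooth_family A f -> smooth_family A g ->
  (forall x, f t (g t x) = x) ->
  0 <= t <= 1 -> preserves alpha (f t) -> preserves alpha (g t).
Proof.
move=> sf sg fgK t01 pf; apply: preserves_of_rep => // i j y v iy jg.
have [W1 [F1 [r1 W1y]]] := local_rep_exists sg t01 iy jg.
have [_ _ H1] := r1; have [_ _ E1] := H1 t y W1y t01.
have gi : dom i (f t (param j (F1 (t, y)))).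
  by rewrite -E1 chartK// fgK; exact: param_dom.
have jF : img j (F1 (t, y)) by rewrite -E1; exact: chart_img.
have [W2 [F2 [r2 W2y]]] := local_rep_exists sf t01 jF gi.
exists W1, F1; split => //.
rewrite -(preserves_rep _ r2 W2y t01 pf) (derive_rep_cancel _ r1 r2 W1y W2y t01 fgK).
have [_ _ H2] := r2; have [_ _ <-] := H2 _ _ W2y t01.
by rewrite -E1 chartK// fgK paramK.
Qed.

Let unit_filter (t : R) := within [set h : R | 0 <= t + h <= 1] (0 : R)^'.

(** Properness gives uniqueness of limits, so that the velocity in [hamiltonian_of] is determined
    even at t = 0 and t = 1. *)
Lemma unit_filter_proper (t : R) : 0 <= t <= 1 -> ProperFilter (unit_filter t).
Proof.
move=> t01; apply: Build_ProperFilter_ex => P PF.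
have /nbhs_ballP[e /= e0 He] :
  nbhs (0 : R) [set h | h != 0 -> 0 <= t + h <= 1 -> P h] := PF.
have m0 : 0 < Num.min (e / 2) (1 / 2) by rewrite lt_min !divr_gt0.
have me : Num.min (e / 2) (1 / 2) < e by rewrite gt_min; apply/orP; left; lra.
have m2 : Num.min (e / 2) (1 / 2) <= 1 / 2 by rewrite ge_min lexx orbT.
set h := Num.min _ _ in m0 me m2.
(* The increment, of size at most 1/2, points towards the farther end of [0, 1]. *)
have [t2|t2] := leP t (1 / 2).
  exists h; apply: He.
  - by rewrite /ball /= sub0r normrN gtr0_norm.
  - by rewrite gt_eqF.
  - by lra.
exists (- h); apply: He.
- by rewrite /ball /= sub0r opprK gtr0_norm.
- by rewrite oppr_eq0 gt_eqF.
- by lra.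
Qed.

(** F represents f only at times in [0, 1], hence the difference quotients of f agree with those of
    F only along the restricted filter. *)
Lemma time_derivative f i j W F (t : R) x : local_rep f i j W F ->
  dom i x -> W (t, chart i x) -> 0 <= t <= 1 ->
  (fun h : R => h^-1 *: (chart j (f (t + h) x) - chart j (f t x))) @ unit_filter t
    --> 'D_(dir_t R m.+1) F (t, chart i x).
Proof.
move=> rF ix Wx t01.
have dF := local_rep_differentiable rF Wx.
have DF : (fun h : R => h^-1 *: (F (h *: dir_t R m.+1 + (t, chart i x)) - F (t, chart i x)))
    @ (0 : R)^' --> 'D_(dir_t R m.+1) F (t, chart i x).
  exact: (diff_derivable (v := dir_t R m.+1) dF).
have {}DF := cvg_within_filter [set h : R | 0 <= t + h <= 1] DF.
have [oW sF H] := rF.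
have cl : (fun h : R => (h + t, chart i x)) @ (0 : R) --> (t, chart i x).
  have ct : (fun h : R => h + t) @ (0 : R) --> t.
    rewrite -[X in _ --> X]add0r.
    by apply: cvgD; [exact: cvg_id|exact: (@cvg_cst _ t _ (nbhs (0:R)) (nbhs_filter _))].
  have cc : (fun h : R => chart i x) @ (0 : R) --> chart i x.
    exact: (@cvg_cst _ (chart i x) _ (nbhs (0:R)) (nbhs_filter _)).
  exact: (cvg_pair ct cc).
have nW : \forall h \near (0 : R), W (h + t, chart i x).
  exact: (cl W (open_nbhs_nbhs (conj oW Wx))).
have nE : within [set h : R | 0 <= t + h <= 1] (0 : R)^' [set h : R |
  h^-1 *: (F (h *: dir_t R m.+1 + (t, chart i x)) - F (t, chart i x)) =
  h^-1 *: (chart j (f (t + h) x) - chart j (f t x))].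
  suff: nbhs (0 : R) [set h | h != 0 -> 0 <= t + h <= 1 ->
    h^-1 *: (F (h *: dir_t R m.+1 + (t, chart i x)) - F (t, chart i x)) =
    h^-1 *: (chart j (f (t + h) x) - chart j (f t x))] by [].
  apply: filterS nW => h Wh _ th01.
  have [_ _ <-] := H _ _ Wx t01; rewrite chartK//.
  have -> : h *: dir_t R m.+1 + (t, chart i x) = (t + h, chart i x).
    rewrite /dir_t; congr pair => /=; last by rewrite scaler0 add0r.
    by rewrite [_ *: 1]mulr1 addrC.
  by rewrite addrC in Wh; have [_ _ <-] := H _ _ Wh th01; rewrite chartK.
move=> B /DF; rewrite /fmap /=; apply: filterS2 nE => h /= E.
by rewrite /= E.
Qed.

(** The velocity supplied by [hamiltonian_of] must be the time derivative of F, by uniqueness of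
    limits. *)
Lemma hamiltonian_rep (Phi : R -> homeo M) H i j W F (t : R) x :
  hamiltonian_of alpha Phi H -> local_rep (fun t => Phi t) i j W F -> dom i x ->
  W (t, chart i x) -> 0 <= t <= 1 ->
  H t (Phi t x) =
  dotv (coef alpha j (F (t, chart i x))) ('D_(dir_t R m.+1) F (t, chart i x)).
Proof.
move=> hH rF ix Wx t01; have [_ _ H1] := rF.
have [iy jf E] := H1 _ _ Wx t01; rewrite chartK// in jf E.
have [v [Dv ->]] := hH t x j t01 jf.
rewrite E; congr (dotv _ _).
have DF := time_derivative rF ix Wx t01.
have PF := unit_filter_proper t01.
exact: (cvg_unique _ Dv DF).
Qed.

Lemma hamiltonian_of_rep (Phi : R -> homeo M) H :
  (forall (t : R) x j, 0 <= t <= 1 -> dom j (Phi t x) -> exists i W F,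
     [/\ local_rep (fun t => Phi t) i j W F, dom i x, W (t, chart i x) &
       H t (Phi t x) =
       dotv (coef alpha j (F (t, chart i x))) ('D_(dir_t R m.+1) F (t, chart i x))]) ->
  hamiltonian_of alpha Phi H.
Proof.
move=> hH t x j t01 jf; have [i [W [F [rF ix Wx ->]]]] := hH t x j t01 jf.
have [_ _ H1] := rF; have [iy _ E] := H1 _ _ Wx t01; rewrite chartK// in E.
exists ('D_(dir_t R m.+1) F (t, chart i x)); split; last by rewrite E.
exact: time_derivative rF ix Wx t01.
Qed.

(** The velocity of the product is X_Phi plus the pushforward of X_Psi by Phi, and alpha takes on
    the pushforward the value it takes on X_Psi, since Phi preserves alpha. *)
Lemma smooth_scds_comp (Phi Psi : R -> homeo M) H K :
  smooth_scds alpha Phi H -> smooth_scds alpha Psi K ->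
  smooth_scds alpha (fun t => hcomp (Phi t) (Psi t))
    (fun t x => H t x + K t (hinv (Phi t) x)).
Proof.
move=> [[sPhi sPhi' Phi0] pPhi hPhi] [[sPsi sPsi' Psi0] pPsi hPsi]; split.
- split.
  + exact: smooth_family_comp sPhi sPsi.
  + exact: smooth_family_comp sPsi' sPhi'.
  + by move=> x; rewrite /= Psi0 Phi0.
- by move=> t t01; apply: preserves_comp sPhi sPsi t01 (pPhi t t01) (pPsi t t01).
- apply: hamiltonian_of_rep => t x j t01 jf.
  have [i ix] := dom_cover A x.
  have [|k [W1 [F1 [W2 [F2 [r1 r2 W1y W2y E]]]]]] :=
    @comp_reps_exist (fun t => Phi t) (fun t => Psi t) i j t (chart i x) sPhi sPsi t01 (chart_img ix).
    by rewrite chartK.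
  exists i, (W1 `&` [set z | W2 (z.1, F1 z)]), (fun z => F2 (z.1, F1 z)); split => //.
    exact: local_rep_comp r1 r2.
  rewrite (derive_rep_comp _ r1 r2 W1y W2y) scale1r dotvDr.
  rewrite [X in _ = _ + X](preserves_rep _ r2 W2y t01 (pPhi t t01)).
  rewrite /= hmapK (hamiltonian_rep hPsi r1 ix W1y t01); congr (_ + _).
  have [_ _ H1] := r1; have [_ kg Ek] := H1 _ _ W1y t01; rewrite chartK// in kg Ek.
  by have := hamiltonian_rep hPhi r2 kg; rewrite Ek => /(_ t W2y t01) ->.
Qed.

(** The product of Phi with its inverse is constant in time. Evaluating alpha on the chain rule for
    this product yields 0 as the sum of H and the Hamiltonian of the inverse moved by Phi. *)
Lemma smooth_scds_inv (Phi : R -> homeo M) H :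
  smooth_scds alpha Phi H ->
  smooth_scds alpha (fun t => hsym (Phi t)) (fun t x => - H t (Phi t x)).
Proof.
move=> [[sPhi sPhi' Phi0] pPhi hPhi]; split.
- by split => //= x; rewrite -{1}(Phi0 x) hmapK.
- move=> t t01.
  apply: (@preserves_inv (fun t => Phi t) (fun t => hinv (Phi t))) => //; last exact: pPhi.
  by move=> x; exact: hinvK.
- apply: hamiltonian_of_rep => t x j t01 jf.
  have [i ix] := dom_cover A x; have iy := chart_img ix.
  have [|W1 [F1 [r1 W1y]]] := local_rep_exists (j := j) sPhi' t01 iy.
    by rewrite chartK.
  exists i, W1, F1; split => //.
  have [_ _ H1] := r1; have [_ jg Ek] := H1 _ _ W1y t01; rewrite chartK// in jg Ek.
  have jF : img j (F1 (t, chart i x)) by rewrite -Ek; exact: chart_img.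
  have [|W2 [F2 [r2 W2y]]] := local_rep_exists (j := i) sPhi t01 jF.
    by rewrite -Ek chartK// hinvK.
  have r12 := local_rep_comp r1 r2.
  have W12 : (W1 `&` [set z | W2 (z.1, F1 z)]) (t, chart i x) by [].
  have D0 : 'D_(dir_t R m.+1) (fun z => F2 (z.1, F1 z)) (t, chart i x) = 0.
    have DF := time_derivative r12 ix W12 t01.
    have PF := unit_filter_proper t01.
    have E0 : (fun h : R => h^-1 *: (chart i (Phi (t + h) (hinv (Phi (t + h)) x)) -
        chart i (Phi t (hinv (Phi t) x)))) = fun=> 0.
      by apply/funext => h; rewrite !hinvK subrr scaler0.
    have {}DF : (fun _ : R => 0 : E) @ unit_filter t -->
      'D_(dir_t R m.+1) (fun z => F2 (z.1, F1 z)) (t, chart i x) by rewrite -E0.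
    apply: (cvg_unique _ DF); first exact: norm_hausdorff.
    exact: (@cvg_cst _ (0 : E) _ (unit_filter t) _).
  have := derive_rep_comp (dir_t R m.+1) r1 r2 W1y W2y; rewrite D0 scale1r => D1.
  have := congr1 (dotv (coef alpha i (F2 (t, F1 (t, chart i x))))) D1.
  rewrite dotv0r dotvDr [X in _ = _ + X](preserves_rep _ r2 W2y t01 (pPhi t t01)).
  have := hamiltonian_rep hPhi r2 jg; rewrite Ek => /(_ t W2y t01) <-.
  by move/esym/eqP; rewrite addrC addr_eq0 => /eqP ->.
Qed.

(** Kept general in q, to serve both for the maps and for the Hamiltonian, each of which is a
    function G of the chart coordinates. *)
Lemma local_rep_cvg (N : topologicalType) (q : R -> M -> N) f i j W F (t : R) x
    (G : R * E -> N) :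
  local_rep f i j W F -> dom i x -> W (t, chart i x) -> 0 <= t <= 1 ->
  {for (t, chart i x), continuous G} ->
  (forall s y, dom i y -> W (s, chart i y) -> 0 <= s <= 1 -> q s y = G (s, chart i y)) ->
  (fun z : R * M => q z.1 z.2) @ within (@unit_itv R `*` [set: M]) (nbhs (t, x))
    --> q t x.
Proof.
move=> [oW _ _] ix Wx t01 cG qG B; rewrite qG// => nB.
have cc : (fun z : R * M => (z.1, chart i z.2)) @ (t, x) --> (t, chart i x).
  have c1 : (fun z : R * M => z.1) @ (t, x) --> t by exact: cvg_fst.
  have c2 : (fun z : R * M => chart i z.2) @ (t, x) --> chart i x.
    have c3 : (fun z : R * M => z.2) @ (t, x) --> x by exact: cvg_snd.
    by apply: cvg_comp c3 _; exact: chart_cont.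
  exact: (cvg_pair c1 c2).
have nW : nbhs (t, x) [set z : R * M | W (z.1, chart i z.2)].
  exact: (cc W (open_nbhs_nbhs (conj oW Wx))).
have nBG : nbhs (t, x) [set z : R * M | B (G (z.1, chart i z.2))].
  exact: (cc (G @^-1` B) (cG B nB)).
have ni : nbhs (t, x) [set z : R * M | dom i z.2].
  have c3 : (fun z : R * M => z.2) @ (t, x) --> x by exact: cvg_snd.
  by apply: (c3 (dom i)); apply: open_nbhs_nbhs; split => //; exact: dom_open.
suff : nbhs (t, x) [set z : R * M | (@unit_itv R `*` [set: M]) z -> B (q z.1 z.2)] by [].
apply: filterS3 nW nBG ni => -[s y] /= Ws Bs iy [/= s01 _].
by rewrite qG.
Qed.

Lemma cvg_dotv (T : Type) (Fl : set_system T) (p : nat) (u v : T -> 'rV[R]_p) a b :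
  Filter Fl -> u @ Fl --> a -> v @ Fl --> b ->
  (fun x => dotv (u x) (v x)) @ Fl --> dotv a b.
Proof.
move=> FF ua vb; rewrite /dotv.
apply: (@cvg_big _ _ +%R) => [|k _]; first exact: add_continuous.
apply: cvgM.
  exact: (@cvg_comp _ _ _ u (fun w : 'rV[R]_p => w 0 k) _ _ _ ua (@coord_continuous _ _ _ 0 k a)).
exact: (@cvg_comp _ _ _ v (fun w : 'rV[R]_p => w 0 k) _ _ _ vb (@coord_continuous _ _ _ 0 k b)).
Qed.

Section Continuity.
Variable D : M -> M -> R.
Hypothesis cD : compat_metric D.
Hypothesis cM : compact [set: M].

Lemma smooth_family_unif_cont f : smooth_family A f -> unif_cont D D f.
Proof.
move=> sf; apply/(jcont_unif_cont cD cD) => //.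
apply/subspace_continuousP => -[t x] [/= t01 _].
have [i ix] := dom_cover A x; have [j jf] := dom_cover A (f t x).
have [|W [F [rF Wx]]] := local_rep_exists (j := j) sf t01 (chart_img ix).
  by rewrite chartK.
have [_ sF H] := rF.
apply: (@local_rep_cvg _ f f i j W F t x (fun z => param j (F z))) => //.
  have cF : F @ (t, chart i x) --> F (t, chart i x) := sF 0%N _ Wx.
  apply: (@cvg_comp _ _ _ F (param j) _ _ _ cF); apply: param_cont.
  by have [_ jj <-] := H _ _ Wx t01; exact: chart_img.
move=> s y iy Ws s01; have [_ jj <-] := H _ _ Ws s01.
by rewrite chartK// chartK.
Qed.

Lemma smooth_scds_unif_cont (Phi : R -> homeo M) H : smooth_scds alpha Phi H ->
  [/\ unif_cont D D (fun t => Phi t), unif_cont D D (fun t => hinv (Phi t)) &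
      unif_cont D (fun x y : R => `|x - y|) H].
Proof.
move=> [[sPhi sPhi' Phi0] pPhi hPhi].
have u1 := smooth_family_unif_cont sPhi; have u2 := smooth_family_unif_cont sPhi'.
split => //.
(* [hamiltonian_of] describes H along trajectories, so continuity is proved for H_t o Phi_t and
   transported by the inverse maps. *)
suff uK : unif_cont D (fun x y : R => `|x - y|) (fun t x => H t (Phi t x)).
  move=> e e0; have [h h0 Hh] := unif_cont_comp uK u2 e0.
  by exists h => // s t x y s01 t01 st xy; have := Hh s t x y s01 t01 st xy; rewrite !hinvK.
apply/(jcont_unif_cont cD (compat_metric_norm R)) => //.
apply/subspace_continuousP => -[t x] [/= t01 _].
have [i ix] := dom_cover A x; have [j jf] := dom_cover A (Phi t x).
have [|W [F [rF Wx]]] := local_rep_exists (j := j) sPhi t01 (chart_img ix).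
  by rewrite chartK.
have [_ sF H1] := rF.
apply: (@local_rep_cvg _ (fun t x => H t (Phi t x)) (fun t => Phi t) i j W F t x
  (fun z => dotv (coef alpha j (F z)) ('D_(dir_t R m.+1) F z))) => //.
  apply: cvg_dotv.
    have cF : F @ (t, chart i x) --> F (t, chart i x) := sF 0%N _ Wx.
    apply: (@cvg_comp _ _ _ F (coef alpha j) _ _ _ cF); apply: (@coef_smooth _ _ _ _ alpha j 0%N).
    by have [_ jj <-] := H1 _ _ Wx t01; exact: chart_img.
  exact: ((sF 1%N).2 (dir_t R m.+1)).
by move=> s y iy Ws s01; exact: (hamiltonian_rep hPhi rF iy Ws s01).
Qed.

End Continuity.

End Contact.

(** * The Riemannian distance *)

Section Quadratic.
Variables (R : realType) (p : nat).
Implicit Types (v : 'rV[R]_p) (G : 'M[R]_p).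

Definition quad G v : R := dotv (v *m G) v.

Lemma norm_coord_le m n (B : 'M[R]_(m, n)) i j : `|B i j| <= `|B|.
Proof.
rewrite [leRHS]/Num.Def.normr /= mx_normrE.
by apply/bigmax_geP; right => /=; exists (i, j).
Qed.

Lemma quadZ G v a : quad G (a *: v) = a ^+ 2 * quad G v.
Proof.
rewrite /quad /dotv big_distrr; apply: eq_bigr => k _ /=.
by rewrite -scalemxAl !mxE expr2; ring.
Qed.

Lemma quad0 G : quad G 0 = 0.
Proof. exact: dotv0r. Qed.

Lemma cvg_quad (T : Type) (Fl : set_system T) (u : T -> 'rV[R]_p) (G : T -> 'M[R]_p)
    (a : 'rV[R]_p) (B : 'M[R]_p) : Filter Fl -> u @ Fl --> a -> G @ Fl --> B ->
  (fun x => quad (G x) (u x)) @ Fl --> quad B a.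
Proof.
move=> FF ua GB; rewrite /quad /dotv.
have cu k : (fun x => u x 0 k) @ Fl --> a 0 k.
  exact: (@cvg_comp _ _ _ u (fun w : 'rV[R]_p => w 0 k) _ _ _ ua (@coord_continuous _ _ _ 0 k a)).
have cG l k : (fun x => G x l k) @ Fl --> B l k.
  exact: (@cvg_comp _ _ _ G (fun w : 'M[R]_p => w l k) _ _ _ GB (@coord_continuous _ _ _ l k B)).
apply: (@cvg_big _ _ +%R) => [|k _]; first exact: add_continuous.
rewrite (_ : (fun x => _) = fun x => (\sum_l u x 0 l * G x l k) * u x 0 k); last first.
  by apply/funext => x; rewrite mxE.
rewrite [(a *m B) 0 k]mxE.
apply: cvgM => //.
apply: (@cvg_big _ _ +%R) => [|l _]; first exact: add_continuous.
exact: cvgM.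
Qed.

Lemma quad_le G v : `|quad G v| <= (\sum_k \sum_l `|G l k|) * `|v| ^+ 2.
Proof.
rewrite /quad /dotv (le_trans (ler_norm_sum _ _ _))// big_distrl/=.
apply: ler_sum => k _; rewrite mxE normrM expr2 mulrA ler_pM//; last exact: norm_coord_le.
rewrite (le_trans (ler_norm_sum _ _ _))// big_distrl/=; apply: ler_sum => l _.
by rewrite normrM mulrC ler_wpM2l//; exact: norm_coord_le.
Qed.

(* Compactness of the unit sphere makes positive definiteness locally uniform. *)
Lemma quad_lower (X : topologicalType) (G : X -> 'M[R]_p) y0 :
  {for y0, continuous G} -> (forall v, v != 0 -> 0 < quad (G y0) v) ->
  exists2 c : R, 0 < c & \forall y \near y0, forall v, c * `|v| ^+ 2 <= quad (G y) v.
Proof.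
move=> cG Gpos.
pose S := [set v : 'rV[R]_p | `|v| = 1].
have cS : compact S.
  apply: bounded_closed_compact.
    by exists 1; split => // a a1 v /= ->; exact: ltW.
  rewrite (_ : S = (fun v => `|v|) @^-1` [set 1])//.
  by apply: closed_comp => [v _|]; [exact: norm_continuous|exact: closed_eq].
pose F := filter_prod (at_right (0 : R)) (nbhs y0).
have FF : Filter F by exact: filter_prod_filter.
have /compact_near_coveringP cov := cS.
have : \forall z \near F, S `<=` (fun v => z.1 < quad (G z.2) v).
  apply: cov => v /= v1.
  have v0 : v != 0 by rewrite -normr_gt0 v1.
  have q0 := Gpos v v0.
  have cq : (fun z : 'rV[R]_p * (R * X) => quad (G z.2.2) z.1) @
      filter_prod (nbhs v) F --> quad (G y0) v.
    apply: cvg_quad; first exact: cvg_fst.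
    apply: (@cvg_comp _ _ _ (fun z : 'rV[R]_p * (R * X) => z.2.2) G _ _ _ _ cG).
    apply: cvg_comp cvg_snd _; exact: cvg_snd.
  have n1 : \forall z \near filter_prod (nbhs v) F, quad (G y0) v / 2 < quad (G z.2.2) z.1.
    apply: (cvgr_gt (quad (G y0) v)) => //; lra.
  have n2 : \forall z \near filter_prod (nbhs v) F, z.2.1 < quad (G y0) v / 2.
    exists (setT, [set z | z.1 < quad (G y0) v / 2]); last by case=> w z [].
    split => /=; first exact: filterT.
    exists ([set h | h < quad (G y0) v / 2], setT); last by case=> h z [].
    by split; [apply: nbhs_right_lt; rewrite divr_gt0|exact: filterT].
  by apply: filterS2 n1 n2 => z /= h1 h2; exact: lt_trans h2 h1.
move=> [[B1 B2] /= [nB1 nB2] HB].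
have [c [c0 Bc]] := filter_ex (filterI (nbhs_right_gt (0 : R)) nB1).
exists c => //; apply: filterS nB2 => y By v.
have [->|v0] := eqVneq v 0; first by rewrite normr0 quad0 expr0n mulr0.
have nv : 0 < `|v| by rewrite normr_gt0.
have Sv : S (`|v|^-1 *: v).
  by rewrite /S /= normrZ normfV normr_id mulVf// gt_eqF.
have /= := HB (c, y) (conj Bc By) _ Sv; rewrite quadZ exprVn => H.
by rewrite -ler_pdivlMr ?exprn_gt0// mulrC ltW.
Qed.

(** The sum of the absolute values of the entries of G bounds the form and is continuous at y0. *)
Lemma quad_upper (X : topologicalType) (G : X -> 'M[R]_p) y0 :
  {for y0, continuous G} ->
  exists2 K : R, 0 < K & \forall y \near y0, forall v, quad (G y) v <= K * `|v| ^+ 2.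
Proof.
move=> cG; pose S (y : X) : R := \sum_k \sum_l `|G y l k|.
have S0 y : 0 <= S y by apply: sumr_ge0 => k _; exact: sumr_ge0.
have cS : S @ y0 --> S y0.
  apply: (@cvg_big _ _ +%R) => [|k _]; first exact: add_continuous.
  apply: (@cvg_big _ _ +%R) => [|l _]; first exact: add_continuous.
  apply: cvg_norm.
  exact: (@cvg_comp _ _ _ G (fun w : 'M[R]_p => w l k) _ _ _ cG (@coord_continuous _ _ _ l k _)).
exists (S y0 + 1); first by rewrite ltr_wpDl.
have := cvgr_lt (S y0) cS (S y0 + 1); rewrite ltrDl ltr01 => /(_ _ isT).
apply: filterS => y Sy v; rewrite (le_trans (ler_norm _))// (le_trans (quad_le _ _))//.
by rewrite ler_wpM2r ?exprn_ge0// ltW.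
Qed.

End Quadratic.

(** * Lengths of paths and derivative bounds *)

Section Geometry.
Variables (R : realType) (m : nat) (M : topologicalType) (A : atlas R m M).
Variable g : riemannian_metric A.
Local Notation E := 'rV[R]_m.+1.
Implicit Types (i j k : 'I_(nchart A)).
Local Notation mu := (@lebesgue_measure R).

Lemma gmx_cont i (y : E) : img i y -> {for y, continuous (gmx g i)}.
Proof. by move=> iy; exact: (@gmx_smooth _ _ _ _ g i 0%N). Qed.

Lemma nbhs_img i (y : E) : img i y -> nbhs y (@img _ _ _ A i).
Proof. by move=> iy; apply: open_nbhs_nbhs; split => //; exact: img_open. Qed.

Lemma nbhs_dom i (x : M) : dom i x -> nbhs x (@dom _ _ _ A i).
Proof. by move=> ix; apply: open_nbhs_nbhs; split => //; exact: dom_open. Qed.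

Lemma nbhs_chart i (x : M) (B : set E) : dom i x -> nbhs (chart i x) B ->
  \forall x' \near x, dom i x' /\ B (chart i x').
Proof.
move=> ix nB; apply: filterI; first exact: nbhs_dom.
exact: (chart_cont ix nB).
Qed.

Definition speed (s : 'I_(nchart A) * (R -> E)) (t : R) : R :=
  Num.sqrt (quad (gmx g s.1 (s.2 t)) ('D_1 s.2 t)).

Definition segment_length (s : 'I_(nchart A) * (R -> E)) : R :=
  \int[mu]_(t in `[0, 1]) speed s t.

Lemma path_lengthE p : path_length g p = \sum_(s <- p) segment_length s.
Proof. by []. Qed.

Lemma path_length_ge0 p : 0 <= path_length g p.
Proof.
rewrite path_lengthE; apply: sumr_ge0 => s _; apply: Rintegral_ge0 => t _.
exact: sqrtr_ge0.
Qed.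

Lemma path_length_cat p q : path_length g (p ++ q) = path_length g p + path_length g q.
Proof. by rewrite /path_length big_cat. Qed.

Lemma is_path_cat (x y z : M) (p q : seq ('I_(nchart A) * (R -> E))) :
  is_path x p y -> is_path y q z -> is_path x (p ++ q) z.
Proof.
elim: p x => [|[i u] p IH] x /=; first by move=> ->.
by move=> [uW iu ux py] qz; split => //; exact: IH.
Qed.

(* [riemannian_dist] is 0, as the infimum of the empty set, at points that no path
   joins, so the triangle inequality needs paths. *)
Definition joined (x y : M) : Prop :=
  exists p : seq ('I_(nchart A) * (R -> E)), is_path x p y.

Lemma dist_ge0 x y : 0 <= riemannian_dist g x y.
Proof.
rewrite /riemannian_dist; set B := [set _ | _ in _].
have [->|/set0P B0] := eqVneq B set0; first by rewrite inf0.
by apply: lb_le_inf => // _ [p _ <-]; exact: path_length_ge0.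
Qed.

Lemma dist_le x y p : is_path x p y -> riemannian_dist g x y <= path_length g p.
Proof.
move=> xpy; apply: ge_inf; last by exists p.
by exists 0 => _ [q _ <-]; exact: path_length_ge0.
Qed.

Lemma dist_adherent x y (e : R) : joined x y -> 0 < e ->
  exists2 p, is_path x p y & path_length g p < riemannian_dist g x y + e.
Proof.
move=> [p xpy] e0.
have hi : has_inf [set path_length g p | p in [set p | is_path x p y]].
  split; first by exists (path_length g p), p.
  by exists 0 => _ [q _ <-]; exact: path_length_ge0.
have [_ [q xqy <-] H] := inf_adherent e0 hi.
by exists q.
Qed.

Lemma dist_tri x y z : joined x y -> joined y z ->
  riemannian_dist g x z <= riemannian_dist g x y + riemannian_dist g y z.
Proof.
move=> xy yz; apply/ler_addgt0Pr => e e0.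
have e2 : 0 < e / 2 by rewrite divr_gt0.
have [p xpy Hp] := dist_adherent xy e2.
have [q yqz Hq] := dist_adherent yz e2.
rewrite (le_trans (dist_le (is_path_cat xpy yqz)))// path_length_cat; lra.
Qed.

Lemma straight_smooth (a b : E) : smooth_on setT (fun t : R => a + t *: (b - a)) /\
  (forall t : R, 'D_1 (fun t : R => a + t *: (b - a)) t = b - a).
Proof.
have D (t v : R) : is_derive t v (fun t : R => a + t *: (b - a)) (v *: (b - a)).
  have h1 : is_derive t v (fun t : R => t *: (b - a)) (v *: (b - a)).
    have dl : differentiable (fun t : R => t *: (b - a)) t.
      exact: (@differentiableZl _ _ _ (fun t : R => t)).
    apply: DeriveDef; first exact: diff_derivable.
    rewrite deriveE// (@diffZl _ _ _ (fun t : R => t))//.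
    by have -> : 'd (fun t : R => t) t v = v by rewrite [in LHS]diff_val.
  rewrite -[v *: (b - a)]add0r.
  exact: (@is_deriveD _ _ _ (cst a) (fun t : R => t *: (b - a)) t v 0 (v *: (b - a)) _ h1).
split; last by move=> t; have [_ ->] := D t 1; rewrite scale1r.
have dd t : differentiable (fun t : R => a + t *: (b - a)) t.
  by apply/derivable1_diffP; have [] := D t 1.
move=> [|k]; first by move=> t _; exact: differentiable_continuous.
split=> // v; rewrite (_ : 'D_v _ = fun=> v *: (b - a)); first exact: Ck_cst.
by apply/funext => t; have [_ ->] := D t v.
Qed.

Lemma speed_continuous i u (W : set R) (t : R) : open W -> smooth_on W u -> W t ->
  img i (u t) -> {for t, continuous (speed (i, u))}.
Proof.
move=> oW su Wt iu; rewrite /prop_for /continuous_at /speed /=.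
have cu : u @ t --> u t := su 0%N t Wt.
have cD : 'D_1 u @ t --> 'D_1 u t := (su 1%N).2 1 t Wt.
have cG : (fun t => gmx g i (u t)) @ t --> gmx g i (u t).
  exact: (@cvg_comp _ _ _ u (gmx g i) _ _ _ cu (gmx_cont iu)).
have cq := @cvg_quad _ _ _ _ _ _ _ _ (nbhs_filter t) cD cG.
exact: (@cvg_comp _ _ _ _ Num.sqrt _ _ _ cq (@sqrt_continuous _ _)).
Qed.

Lemma unit_itvP (t : R) : (`[0, 1]%classic : set R) t <-> 0 <= t <= 1.
Proof. by rewrite /= in_itv. Qed.

Lemma integrable_unit (f : R -> R) : (forall t, 0 <= t <= 1 -> {for t, continuous f}) ->
  mu.-integrable `[0, 1] (EFin \o f).
Proof.
move=> cf; apply: continuous_compact_integrable; first exact: segment_compact.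
by apply: continuous_in_subspaceT => t; rewrite inE => /unit_itvP; exact: cf.
Qed.

Lemma Rintegral_unit_le (f : R -> R) c : (forall t, 0 <= t <= 1 -> {for t, continuous f}) ->
  (forall t, 0 <= t <= 1 -> f t <= c) -> \int[mu]_(t in `[0, 1]) f t <= c.
Proof.
move=> cf fc.
have -> : c = \int[mu]_(t in `[0, 1]) c.
  by rewrite Rintegral_cst//= lebesgue_measure_itv/= lte_fin ltr01 oppr0 addr0 mulr1.
apply: le_Rintegral => //; first exact: integrable_unit.
by apply: integrable_unit => t _; exact: cvg_cst.
Qed.

(** The path is a straight segment in a chart ball on which the metric is at most K times the square
    of the norm. The lemma serves twice, for joining points and for making nearby points d-close. *)
Lemma local_paths (x : M) (e : R) : 0 < e -> exists2 B : set M, nbhs x B &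
  forall y z, B y -> B z -> exists2 p, is_path y p z & path_length g p < e.
Proof.
move=> e0; have [i ix] := dom_cover A x; have iy := chart_img ix.
have [K K0 nK] := quad_upper (gmx_cont iy).
have nB : nbhs (chart i x : E) (@img _ _ _ A i `&`
    [set y | forall v, quad (gmx g i y) v <= K * `|v| ^+ 2]) := @filterI _ _ (nbhs_filter _) _ _ (nbhs_img iy) nK.
have [r /= r0 Hr] := (nbhs_ballP _ _).1 nB.
(* The ends of the segment are less than 2r' apart, so its speed is at most sqrt K * 2r' <= e/2;
   halving restores the strict inequality that integration loses. *)
pose r' := Num.min r (e / (4 * Num.sqrt K)).
have sK : 0 < Num.sqrt K by rewrite sqrtr_gt0.
have r'0 : 0 < r' by rewrite lt_min r0 /= divr_gt0// mulr_gt0.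
exists [set x' | dom i x' /\ ball (chart i x) r' (chart i x')].
  by apply: nbhs_chart => //; exact: nbhsx_ballx.
move=> y z [dy By] [dz Bz].
pose u (t : R) := chart i y + t *: (chart i z - chart i y).
have [su Du] := straight_smooth (chart i y) (chart i z).
have uB t : 0 <= t <= 1 -> ball (chart i x) r (u t).
  move=> /andP[t0 t1]; move: By Bz; rewrite -!ball_normE /ball_ /= => By Bz.
  have -> : chart i x - u t = (1 - t) *: (chart i x - chart i y) +
      t *: (chart i x - chart i z).
    by apply/rowP => k; rewrite /u !mxE; ring.
  have rr : r' <= r by rewrite ge_min lexx.
  rewrite (lt_le_trans _ rr)//.
  rewrite (le_lt_trans (ler_normD _ _))// !normrZ ger0_norm ?subr_ge0// ger0_norm//.
  (* The strict inequality comes from the end whose weight is at least 1/2, since the other weight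
     may vanish. *)
  have [t12|t12] := leP t (1 / 2).
    have h1 : (1 - t) * `|chart i x - chart i y| < (1 - t) * r' by rewrite ltr_pM2l//; lra.
    have h2 : t * `|chart i x - chart i z| <= t * r' by rewrite ler_wpM2l// ltW.
    lra.
  have h1 : (1 - t) * `|chart i x - chart i y| <= (1 - t) * r'.
    by rewrite ler_wpM2l ?subr_ge0// ltW.
  have h2 : t * `|chart i x - chart i z| < t * r' by rewrite ltr_pM2l//; lra.
  lra.
have iu t : 0 <= t <= 1 -> img i (u t) by move=> /uB /Hr [].
have nyz : `|chart i z - chart i y| < 2 * r'.
  move: By Bz; rewrite -!ball_normE /ball_ /= => By Bz.
  rewrite (le_lt_trans (ler_distD (chart i x) _ _))// distrC; lra.
exists [:: (i, u)].
  split => //; last 2 first.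
  - by rewrite /u scale0r addr0 chartK.
  - by rewrite /= /u scale1r addrCA subrr addr0 chartK.
  by exists setT; split => //; exact: openT.
rewrite path_lengthE big_seq1 /segment_length.
have er : Num.sqrt K * (2 * r') <= e / 2.
  have : r' <= e / (4 * Num.sqrt K) by rewrite ge_min lexx orbT.
  rewrite ler_pdivlMr ?mulr_gt0//; lra.
rewrite (@le_lt_trans _ _ (e / 2))//; last lra.
apply: Rintegral_unit_le => t t01.
  exact: (speed_continuous openT su I (iu t t01)).
rewrite (le_trans _ er)// /speed /= Du.
have [_ Kt] := Hr _ (uB t t01).
rewrite (@le_trans _ _ (Num.sqrt (K * `|chart i z - chart i y| ^+ 2)))//.
  by apply: ler_wsqrtr; exact: Kt.
by rewrite sqrtrM ?(ltW K0)// sqrtr_sqr normr_id ler_wpM2l// ltW.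
Qed.

(** The set of points joined to x is open and closed, since any two points of a small neighbourhood
    are joined. *)
Lemma all_joined : connected [set: M] -> forall x y, joined x y.
Proof.
move=> cM x y.
have loc (z : M) : exists2 B : set M, nbhs z B & forall a b, B a -> B b -> joined a b.
  have [B nB HB] := local_paths z (ltr01 : 0 < 1 :> R).
  by exists B => // a b Ba Bb; have [p abp _] := HB a b Ba Bb; exists p.
have jt a b c : joined a b -> joined b c -> joined a c.
  by move=> [p abp] [q bcq]; exists (p ++ q); exact: is_path_cat bcq.
suff -> : joined x = [set: M] by [].
apply: cM.
- by exists x, [::].
- exists (joined x); last by rewrite setTI.
  rewrite openE => z xz; have [B nB HB] := loc z; apply: (filterS _ nB) => w Bw.
  exact: (jt _ _ _ xz (HB _ _ (nbhs_singleton nB) Bw)).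
- exists (joined x); last by rewrite setTI.
  move=> z cz; have [B nB HB] := loc z; have [w [xw Bw]] := cz B nB.
  exact: (jt _ _ _ xw (HB _ _ Bw (nbhs_singleton nB))).
Qed.

Definition c1_fun (f : M -> R) : Prop := forall i, Ck 1 (@img _ _ _ A i) (f \o param i).

Lemma derive_row (V : normedModType R) (F : E -> V) (y v : E) : differentiable F y ->
  'D_v F y = \sum_k v 0 k *: 'D_(delta_mx 0 k) F y.
Proof.
move=> dF; rewrite deriveE// {1}[v]row_sum_delta linear_sum; apply: eq_bigr => k _.
by rewrite linearZ deriveE.
Qed.

(** The partial derivatives bound the derivative along v by a multiple of |v|, and local uniform
    positivity of the metric bounds |v| by the length of v. *)
Lemma derive_local_bound (f : M -> R) i (y0 : E) : c1_fun f -> img i y0 ->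
  exists2 C : R, 0 < C & \forall y \near y0, img i y /\
    forall v, `|'D_v (f \o param i) y| <= C * Num.sqrt (quad (gmx g i y) v).
Proof.
move=> cf iy0.
pose S (y : E) : R := \sum_(k < m.+1) `|'D_(delta_mx 0 k) (f \o param i) y|.
have S0 y : 0 <= S y by exact: sumr_ge0.
have cS : S @ y0 --> S y0.
  apply: (@cvg_big _ _ +%R _ _ _ _ (nbhs y0) _ _ _ (nbhs_filter y0)) => [|k _].
    exact: add_continuous.
  by apply: cvg_norm; exact: ((cf i).2 (delta_mx 0 k) y0 iy0).
have [|c c0 nc] := quad_lower (gmx_cont iy0).
  by move=> v v0; exact: gmx_pos.
have sc : 0 < Num.sqrt c by rewrite sqrtr_gt0.
exists ((S y0 + 1) / Num.sqrt c); first by rewrite divr_gt0// ltr_wpDl.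
have nS : \forall y \near y0, S y < S y0 + 1.
  have := @cvgr_lt _ _ _ (nbhs_filter y0) S (S y0) cS (S y0 + 1).
  by rewrite ltrDl ltr01; exact.
have := @filterI _ _ (nbhs_filter _) _ _ (nbhs_img iy0) (@filterI _ _ (nbhs_filter _) _ _ nS nc).
apply: filterS => y [iy [Sy qy]]; split => // v.
rewrite derive_row; last exact: (cf i).1.
rewrite (@le_trans _ _ (S y * `|v|))//.
  rewrite (le_trans (ler_norm_sum _ _ _))// big_distrl/=; apply: ler_sum => k _.
  by rewrite normrM mulrC ler_wpM2l//; exact: norm_coord_le.
rewrite (@le_trans _ _ ((S y0 + 1) * `|v|))//.
  by rewrite ler_wpM2r// ltW.
rewrite -mulrA ler_wpM2l//; first by rewrite addr_ge0.
rewrite mulrC ler_pdivlMr// mulrC -[`|v|]normr_id -sqrtr_sqr -sqrtrM ?(ltW c0)//.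
by apply: ler_wsqrtr; exact: qy.
Qed.

(** Both sides of the derivative estimate are intrinsic, so an estimate found in one chart around p
    holds in all charts there. *)
Lemma derive_change_chart (f : M -> R) i j p v : c1_fun f -> dom i p -> dom j p ->
  exists w, 'D_v (f \o param j) (chart j p) = 'D_w (f \o param i) (chart i p) /\
    quad (gmx g j (chart j p)) v = quad (gmx g i (chart i p)) w.
Proof.
move=> cf ip jp; exists ('d (chart i \o param j) (chart j p) v).
have jy := chart_img jp.
have iy : dom i (param j (chart j p)) by rewrite chartK.
have dT : differentiable (chart i \o param j) (chart j p).
  exact: (@transition_smooth _ _ _ A j i 1%N).1.
split; last first.
  rewrite /quad -[in LHS](gmx_compat g v v jy iy) /= chartK//.
have di : differentiable (f \o param i) ((chart i \o param j) (chart j p)).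
  by rewrite /= chartK//; apply: (cf i).1; exact: chart_img.
have dj : differentiable (f \o param j) (chart j p) by exact: (cf j).1.
have ij : (chart i \o param j) (chart j p) = chart i p by rewrite /= chartK.
rewrite (deriveE _ dj) deriveE; last by rewrite -ij.
rewrite -ij.
have nE : {near chart j p, (f \o param i) \o (chart i \o param j) =1 f \o param j}.
  have nb : nbhs (chart j p) [set y | dom i (param j y)].
    by apply: (param_cont jy); apply: nbhs_dom.
  by apply: filterS nb => y iy' /=; rewrite chartK.
have E1 := congr1 (fun h : E -> R => h v) (near_eq_diff nE (differentiable_comp dT di)).
apply: (etrans E1).
exact: (congr1 (fun h : E -> R => h v) (diff_comp dT di)).
Qed.

Lemma derive_bound (f : M -> R) : compact [set: M] -> c1_fun f ->
  exists2 C : R, 0 < C & forall i y v, img i y ->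
    `|'D_v (f \o param i) y| <= C * Num.sqrt (quad (gmx g i y) v).
Proof.
move=> cM cf.
(* The constant is written h^-1, so that small h means a weak bound. *)
have [|h h0 Hh] := @compact_small _ _ _ (fun (h : R) (x : M) => forall j, dom j x ->
   forall v, `|'D_v (f \o param j) (chart j x)| <=
     h^-1 * Num.sqrt (quad (gmx g j (chart j x)) v)) cM.
  move=> x _; have [i ix] := dom_cover A x.
  have [C C0 nC] := derive_local_bound cf (chart_img ix).
  exists C^-1; first by rewrite invr_gt0.
  exists [set x' | dom i x' /\ (forall v, `|'D_v (f \o param i) (chart i x')| <=
      C * Num.sqrt (quad (gmx g i (chart i x')) v))].
    by apply: filterS (nbhs_chart ix nC) => x' [ix' [_ H]].
  move=> h x' h0 hC [ix' H] j jx' v.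
  have [w [-> ->]] := derive_change_chart v cf ix' jx'.
  rewrite (le_trans (H w))// ler_wpM2r ?sqrtr_ge0//.
  by rewrite -[C]invrK lef_pV2 ?posrE ?invr_gt0// ltW.
exists h^-1; first by rewrite invr_gt0.
by move=> i y v iy; have := Hh _ I i (param_dom iy) v; rewrite paramK.
Qed.

(** The increment of f is the integral of its derivative along u, which is at most C times the
    speed. *)
Lemma segment_bound (f : M -> R) (C : R) i (u : R -> E) (W : set R) : c1_fun f ->
  (forall i y v, img i y ->
    `|'D_v (f \o param i) y| <= C * Num.sqrt (quad (gmx g i y) v)) ->
  open W -> (forall t : R, 0 <= t <= 1 -> W t) -> smooth_on W u ->
  (forall t : R, 0 <= t <= 1 -> img i (u t)) ->
  `|f (param i (u 1)) - f (param i (u 0))| <= C * segment_length (i, u).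
Proof.
move=> cf Cf oW W01 su iu.
pose phi (t : R) := f (param i (u t)).
have du (t : R) : 0 <= t <= 1 -> differentiable u t by move=> t01; apply: (su 1%N).1; exact: W01.
have df (t : R) : 0 <= t <= 1 -> differentiable (f \o param i) (u t).
  by move=> t01; apply: (cf i).1; exact: iu.
have dphi (t : R) : 0 <= t <= 1 -> differentiable phi t.
  by move=> t01; exact: (differentiable_comp (du t t01) (df t t01)).
have Dphi (t : R) : 0 <= t <= 1 -> 'D_1 phi t = 'D_('D_1 u t) (f \o param i) (u t).
  move=> t01; rewrite (@derive_comp _ _ _ _ u (f \o param i))//; [|exact: du|exact: df].
  by rewrite [in RHS]deriveE//; exact: df.
(* The derivative of phi expanded in partial derivatives, in which form its continuity is
   visible. *)
pose psi (t : R) : R := \sum_k 'D_1 u t 0 k * 'D_(delta_mx 0 k) (f \o param i) (u t).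
have psiE (t : R) : 0 <= t <= 1 -> 'D_1 phi t = psi t.
  by move=> t01; rewrite Dphi// derive_row//; exact: df.
have cpsi (t : R) : 0 <= t <= 1 -> {for t, continuous psi}.
  move=> t01; have Wt := W01 t t01.
  have cu : u @ t --> u t := su 0%N t Wt.
  have cD : 'D_1 u @ t --> 'D_1 u t := (su 1%N).2 1 t Wt.
  apply: (@cvg_big _ _ +%R) => [|k _]; first exact: add_continuous.
  apply: cvgM.
    exact: (@cvg_comp _ _ _ _ (fun w : 'rV[R]_m.+1 => w 0 k) _ _ _ cD (@coord_continuous _ _ _ 0 k _)).
  exact: (@cvg_comp _ _ _ u ('D_(delta_mx 0 k) (f \o param i)) _ _ _ cu ((cf i).2 (delta_mx 0 k) _ (iu t t01))).
have FTC : \int[mu]_(t in `[0, 1]) psi t = phi 1 - phi 0.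
  rewrite /Rintegral (@continuous_FTC2 _ psi phi 0 1)//.
  - by apply: continuous_in_subspaceT => t; rewrite inE => /unit_itvP; exact: cpsi.
  - split.
    + move=> t; rewrite in_itv/= => /andP[t0 t1].
      by apply: diff_derivable; apply: dphi; rewrite !ltW.
    + apply: cvg_at_right_filter; apply: differentiable_continuous; apply: dphi.
      by rewrite lexx ler01.
    + apply: cvg_at_left_filter; apply: differentiable_continuous; apply: dphi.
      by rewrite lexx ler01.
  - move=> t; rewrite in_itv/= => /andP[t0 t1].
    by rewrite derive1E psiE// !ltW.
rewrite -/(phi 1) -/(phi 0) -FTC.
rewrite (le_trans (le_normr_Rintegral _ _))//; first exact: integrable_unit.
rewrite /segment_length -RintegralZl//; last first.
  by apply: integrable_unit => t t01; exact: (speed_continuous oW su (W01 t t01) (iu t t01)).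
apply: le_Rintegral => //.
- apply: integrable_unit => t t01; apply: cvg_norm; exact: cpsi.
- apply: integrable_unit => t t01; apply: cvgM; first exact: cvg_cst.
  exact: (speed_continuous oW su (W01 t t01) (iu t t01)).
- move=> t /unit_itvP t01; rewrite -psiE// Dphi//.
  exact: Cf (iu t t01).
Qed.

Lemma path_bound (f : M -> R) (C : R) x p y : c1_fun f ->
  (forall i y v, img i y ->
    `|'D_v (f \o param i) y| <= C * Num.sqrt (quad (gmx g i y) v)) ->
  is_path x p y -> `|f x - f y| <= C * path_length g p.
Proof.
move=> cf Cf; rewrite path_lengthE; elim: p x => [|[i u] p IH] x /=.
  by move=> ->; rewrite subrr normr0 big_nil mulr0.
move=> [[W [oW W01 su]] iu <- py]; rewrite big_cons mulrDr.
rewrite (le_trans (ler_distD (f (param i (u 1))) _ _))// lerD//; last exact: IH.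
by rewrite distrC; exact: (segment_bound cf Cf oW W01 su iu).
Qed.

End Geometry.

Lemma Ck_local (R : realType) (U V : normedModType R) k (W : set U) (f : U -> V) :
  (forall x, W x -> exists W', [/\ open W', W' x & Ck k W' f]) -> Ck k W f.
Proof.
elim: k f => [|k IH] f H.
  by move=> x /H [W' [oW W'x cf]]; exact: cf.
split=> [x /H [W' [oW W'x cf]]|v]; first exact: cf.1.
by apply: IH => x /H [W' [oW W'x cf]]; exists W'; split => //; exact: cf.2.
Qed.

(** * The embedding given by a partition of unity *)

Section CoordinateFunctions.
Variables (R : realType) (m : nat) (M : topologicalType) (A : atlas R m M).
Variable chi : 'I_(nchart A) -> M -> R.
Hypothesis hchi : partition_of_unity chi.
Local Notation E := 'rV[R]_m.+1.

Lemma smooth_fun_continuous (f : M -> R) : smooth_fun A f -> continuous f.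
Proof.
move=> sf x; have [i ix] := dom_cover A x.
have cF : {for chart i x, continuous (f \o param i)} := sf i 0%N _ (chart_img ix).
have c2 : (f \o param i) \o chart i @ x --> f x.
  have e : f x = (f \o param i) (chart i x) by rewrite /= chartK.
  rewrite e; exact: (@cvg_comp _ _ _ (chart i) (f \o param i) _ _ _ (chart_cont ix) cF).
move=> B /c2; rewrite /fmap /= => nB.
apply: (@filterS2 _ _ (nbhs_filter x) _ _ _ _ nB (nbhs_dom ix)) => y /= By iy.
by rewrite chartK in By.
Qed.

(** [None] stands for chi_i alone and [Some k] for chi_i times the k-th coordinate; the factor chi_i
    kills the irrelevant values of the chart outside its domain. *)
Definition coord_fun (c : 'I_(nchart A) * option 'I_m.+1) (x : M) : R :=
  if c.2 is Some k then chi c.1 x * chart c.1 x 0 k else chi c.1 x.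

Lemma open_param_preimage j (B : set M) : open B ->
  open (@img _ _ _ A j `&` param j @^-1` B).
Proof.
move=> oB; rewrite openE => y [jy By]; apply: filterI; first exact: nbhs_img.
by apply: (param_cont jy); exact: open_nbhs_nbhs.
Qed.

(** Every point lies either in [dom i], where the product has smooth factors, or in the open
    complement of the support of chi_i, where it is 0. *)
Lemma coord_fun_smooth c : smooth_fun A (coord_fun c).
Proof.
have [schi _ supp _] := hchi.
case: c => i [k|] /=; last exact: schi.
move=> j r; apply: Ck_local => y jy.
have [iy|niy] := pselect (dom i (param j y)).
  exists (@img _ _ _ A j `&` param j @^-1` dom i).
  have oW : open (@img _ _ _ A j `&` param j @^-1` (@dom _ _ _ A i)).
    by apply: open_param_preimage; exact: dom_open.
  split => //; rewrite /coord_fun /=.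
  apply: (@CkM _ _ _ _ (chi i \o param j) (fun y => (chart i \o param j) y 0 k)) => //.
    by apply: Ck_sub (schi i j r) => z [].
  by apply: Ck_coord => //; exact: transition_smooth.
exists (@img _ _ _ A j `&` param j @^-1` ~` closure [set x | chi i x != 0]).
have oW : open (@img _ _ _ A j `&` param j @^-1` ~` closure [set x | chi i x != 0]).
  by apply: open_param_preimage; apply: closed_openC; exact: closed_closure.
split => //; first by split => // /supp.
apply: (Ck_eq oW (f := fun=> 0)); last exact: Ck_cst.
move=> z [_ /= nz]; rewrite /coord_fun /=.
have -> : chi i (param j z) = 0; last by rewrite mul0r.
apply/eqP; apply: contrapT => /negP c0; apply: nz.
exact: subset_closure.
Qed.

Lemma partition_pos x : exists i, 0 < chi i x.
Proof.
have [_ chi0 _ chi1] := hchi.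
apply: contrapT => /forallNP H; have := chi1 x.
rewrite big1 => [/eqP|i _]; first by rewrite eq_sym oner_eq0.
by apply/eqP; rewrite eq_le chi0 andbT leNgt; apply/negP.
Qed.

Lemma partition_supp i x : chi i x != 0 -> dom i x.
Proof. by move=> cx; have [_ _ supp _] := hchi; apply: supp; exact: subset_closure. Qed.

(** Some chi_i is positive at x, hence equally so at y. Both points then lie in [dom i], and
    dividing by this common value gives equal coordinates. *)
Lemma coord_fun_sep x y : (forall c, coord_fun c x = coord_fun c y) -> x = y.
Proof.
move=> H; have [i ci] := partition_pos x.
have cxy : chi i x = chi i y := H (i, None).
have ix : dom i x by apply: partition_supp; rewrite gt_eqF.
have iy : dom i y by apply: partition_supp; rewrite -cxy gt_eqF.
rewrite -(chartK ix) -(chartK iy); congr (param i _); apply/rowP => k.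
have := H (i, Some k); rewrite /coord_fun /= -cxy; apply: mulfI.
by rewrite gt_eqF.
Qed.

(* The distance induced by the embedding of M into a Euclidean space given by the
   functions chi_i and the coordinates of chi_i * chart_i. *)
Definition embed_dist : M -> M -> R := family_metric coord_fun.

Lemma compat_embed_dist : compact [set: M] -> compat_metric embed_dist.
Proof.
move=> cM; apply: compat_family_metric => //; last exact: coord_fun_sep.
by move=> c; apply: smooth_fun_continuous; exact: coord_fun_smooth.
Qed.

Lemma embed_dist_bounded : compact [set: M] -> [set: M] !=set0 ->
  exists2 C : R, 0 <= C & forall x y, embed_dist x y <= C.
Proof.
move=> cM M0.
have /choice [C HC] : forall c, exists C : R, forall x, `|coord_fun c x| <= C.
  move=> c; have [|C _ HC] := compact_bound cM M0 (f := coord_fun c); last by exists C.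
  by apply: smooth_fun_continuous; exact: coord_fun_smooth.
have [x0 _] := M0.
exists (\sum_c (C c + C c)).
  by apply: sumr_ge0 => c _; rewrite addr_ge0// (le_trans _ (HC c x0)).
move=> x y; apply: ler_sum => c _.
by rewrite (le_trans (ler_normB _ _))// lerD.
Qed.

(** * Comparison with the Riemannian distance *)

Section RiemannianDist.
Variable g : riemannian_metric A.
Hypothesis cM : compact [set: M].
Hypothesis kM : connected [set: M].
Hypothesis M0 : [set: M] !=set0.
Local Notation d := (riemannian_dist g).

Lemma embed_dist_le : exists2 C : R, 0 < C & forall x y, embed_dist x y <= C * d x y.
Proof.
have /choice [C HC] : forall c, exists C : R, 0 < C /\ forall i y v, img i y ->
    `|'D_v (coord_fun c \o param i) y| <= C * Num.sqrt (quad (gmx g i y) v).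
  move=> c; have [|C C0 HC] := derive_bound g cM (f := coord_fun c); last by exists C.
  by move=> i; exact: coord_fun_smooth.
(* The sum is only known to be nonnegative; adding 1 gives a constant that can be divided by. *)
have S0 : 0 <= \sum_c C c by apply: sumr_ge0 => c _; exact/ltW/(HC c).1.
exists (\sum_c C c + 1); first by rewrite ltr_wpDl.
move=> x y; apply/ler_addgt0Pr => e e0.
have S1 : 0 < \sum_c C c + 1 by rewrite ltr_wpDl.
have [p xpy Hp] := dist_adherent g (all_joined g kM x y) (divr_gt0 e0 S1).
rewrite (@le_trans _ _ ((\sum_c C c) * path_length g p))//.
  rewrite big_distrl; apply: ler_sum => c _; apply: (path_bound (g := g)) xpy.
    by move=> i; exact: coord_fun_smooth.
  exact: (HC c).2.
rewrite (@le_trans _ _ ((\sum_c C c + 1) * path_length g p))//.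
  by rewrite ler_wpM2r ?path_length_ge0// lerDl.
rewrite (@le_trans _ _ ((\sum_c C c + 1) * (d x y + e / (\sum_c C c + 1))))//.
  by rewrite ler_wpM2l ?ltW.
by rewrite mulrDr [_ * (e / _)]mulrCA divff ?gt_eqF// mulr1.
Qed.

Lemma dist_local (x : M) (e : R) : 0 < e ->
  exists2 B : set M, nbhs x B & forall y z, B y -> B z -> d y z < e.
Proof.
move=> e0; have [B nB HB] := local_paths g x e0; exists B => // y z By Bz.
by have [p ypz] := HB y z By Bz; apply: le_lt_trans; exact: dist_le.
Qed.

(** No Lipschitz constant in this direction, only a modulus: a common neighbourhood of two D-close
    points, in which all points are d-close, is found by compactness. *)
Lemma dist_embed_dist (e : R) : 0 < e -> exists2 h : R, 0 < h &
  forall x y, embed_dist x y < h -> d x y < e.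
Proof.
move=> e0; have cD := compat_embed_dist cM.
have [|h h0 Hh] := @compact_small _ _ _ (fun (h : R) (x : M) => forall y,
  embed_dist x y < h -> d x y < e) cM; last by exists h => // x y; exact: Hh.
move=> x _; have [B /(cm_nbhs cD)[r r0 Hr] HB] := dist_local x e0.
exists (r / 2); first by rewrite divr_gt0.
exists [set z | embed_dist x z < r / 2].
  by apply/(cm_nbhs cD); exists (r / 2) => //; rewrite divr_gt0.
move=> h x' h0 hr /= xx' y x'y; apply: HB; apply: Hr; first lra.
rewrite (le_lt_trans (cm_tri cD x x' y))//; lra.
Qed.

Lemma dist_bounded : exists2 C : R, 0 <= C & forall x y, d x y <= C.
Proof.
have [x0 _] := M0; have jM := all_joined g kM.
(* Bounding both orders of the arguments takes the place of the symmetry of d. *)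
have [|h h0 Hh] := @compact_small _ _ _ (fun (h : R) (y : M) =>
  d x0 y <= h^-1 /\ d y x0 <= h^-1) cM.
  move=> y _; have [B nB HB] := dist_local y (ltr01 : 0 < 1 :> R).
  have K0 : 0 < d x0 y + d y x0 + 1 by rewrite ltr_wpDl// addr_ge0// dist_ge0.
  exists (d x0 y + d y x0 + 1)^-1; first by rewrite invr_gt0.
  exists B => // h z h0 hK Bz; have By := nbhs_singleton nB.
  have Kh : d x0 y + d y x0 + 1 <= h^-1.
    by rewrite -[leLHS]invrK lef_pV2 ?posrE ?invr_gt0// ltW.
  have h1 := dist_tri g (jM x0 y) (jM y z); have h2 := dist_tri g (jM z y) (jM y x0).
  have h3 := HB _ _ By Bz; have h4 := HB _ _ Bz By.
  have h5 := dist_ge0 g x0 y; have h6 := dist_ge0 g y x0.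
  by split; lra.
exists (h^-1 + h^-1); first by rewrite addr_ge0// invr_ge0 ltW.
move=> x y; rewrite (le_trans (dist_tri g (jM x x0) (jM x0 y)))//.
have [_ h1] := Hh x I; have [h2 _] := Hh y I; lra.
Qed.

End RiemannianDist.

End CoordinateFunctions.

(** * The iterated integral *)

Section IterInt.
Variable R : realType.
Local Notation mu := (@lebesgue_measure R).

(** Support in an explicit cube, because slices then inherit the same r. *)
Definition cc_fun (m : nat) (r : R) (f : 'rV[R]_m -> R) : Prop :=
  continuous f /\ forall y : 'rV[R]_m, (exists k, r < `|y 0 k|) -> f y = 0.

Definition slice (m : nat) (f : 'rV[R]_m.+1 -> R) (x : R) (v : 'rV[R]_m) : R :=
  f (row_mx (x%:M : 'rV[R]_1) v).

Lemma row_continuous (U : normedModType R) (m : nat) (F : U -> 'rV[R]_m) :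
  (forall k, continuous (fun z => F z 0 k)) -> continuous F.
Proof.
move=> H z; have := @Ck_row R U m 0%N setT F openT; apply => //.
by move=> j x _; exact: H.
Qed.

Lemma row_mx_continuous (m : nat) :
  continuous (fun z : R * 'rV[R]_m => (row_mx (z.1%:M : 'rV[R]_1) z.2 : 'rV[R]_m.+1)).
Proof.
apply: row_continuous => k.
rewrite (_ : (fun z : R * 'rV[R]_m => _) = fun z : R * 'rV[R]_m =>
  if fintype.split (k : 'I_(1 + m)) is inr j then z.2 0 j else z.1); last first.
  apply/funext => z; rewrite mxE; case: fintype.split => // j.
  by rewrite mxE (ord1 j) eqxx mulr1n.
case: fintype.split => [_|j] z; first exact: cvg_fst.
exact: (@cvg_comp _ _ _ snd (fun w : 'rV[R]_m => w 0 j) _ _ _ cvg_snd (@coord_continuous _ _ _ 0 j _)).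
Qed.

Lemma slice_cc m r f x : @cc_fun m.+1 r f -> cc_fun r (slice f x).
Proof.
move=> [cf f0]; split; last first.
  move=> y [k rk]; apply: f0; exists (rshift 1 k : 'I_m.+1).
  by have := row_mxEr (x%:M : 'rV[R]_1) y 0 k => /= ->.
have cp : continuous (fun v : 'rV[R]_m => (x, v)).
  move=> v; have c1 : (fun _ : 'rV[R]_m => x) @ v --> x.
    exact: (@cvg_cst _ x _ (nbhs v) (nbhs_filter v)).
  have c2 : (fun w : 'rV[R]_m => w) @ v --> v by move=> B.
  exact: (cvg_pair c1 c2).
move=> v.
have c1 := continuous_comp (cp v) (@row_mx_continuous m (x, v)).
exact: (continuous_comp c1 (cf _)).
Qed.

Lemma slice_out m r f x : @cc_fun m.+1 r f -> r < `|x| -> slice f x = fun=> 0.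
Proof.
move=> [_ f0] rx; apply/funext => v; apply: f0; exists (lshift m (0 : 'I_1) : 'I_m.+1).
by have := row_mxEl (x%:M : 'rV[R]_1) v 0 0 => /= ->; rewrite mxE eqxx mulr1n.
Qed.

Lemma cc_funD m r (f g : 'rV[R]_m -> R) : cc_fun r f -> cc_fun r g ->
  cc_fun r (fun y => f y + g y).
Proof.
move=> [cf f0] [cg g0]; split=> [y|y yk]; last by rewrite f0// g0// addr0.
exact: (cvgD (cf y) (cg y)).
Qed.

Lemma cc_funZ m r c (f : 'rV[R]_m -> R) : cc_fun r f -> cc_fun r (fun y => c * f y).
Proof.
move=> [cf f0]; split=> [y|y yk]; last by rewrite f0// mulr0.
exact: (@continuousM _ _ (cst c) f y (@cst_continuous _ _ c y) (cf y)).
Qed.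

Lemma int_rV0 m : int_rV (fun _ : 'rV[R]_m => 0) = 0 :> R.
Proof.
elim: m => [//|m IH] /=.
rewrite (_ : (fun x : R => _) = fun=> 0); first by rewrite /Rintegral integral0.
by apply/funext => x; exact: IH.
Qed.

Lemma int_rV_ge0 m (f : 'rV[R]_m -> R) : (forall y, 0 <= f y) -> 0 <= int_rV f.
Proof.
elim: m f => [|m IH] f f0 /=; first exact: f0.
by apply: Rintegral_ge0 => x _; apply: IH => v.
Qed.

(** Reduces the integral over the line to a compact interval, on which continuity implies
    integrability. *)
Lemma int_rVS m r (f : 'rV[R]_m.+1 -> R) : cc_fun r f ->
  int_rV f = \int[mu]_(x in `[- r, r]) int_rV (slice f x).
Proof.
move=> cf; rewrite Rintegral_mkcond /=; congr (Rintegral _ _ _).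
apply/funext => x; rewrite patchE; case: ifPn => //.
rewrite notin_setE /= in_itv/= => /negP; rewrite -ler_norml -ltNge => rx.
by rewrite -/(slice f x) (slice_out cf rx) int_rV0.
Qed.

(** Uniformity in v follows from compactness of the cube, outside of which both slices vanish. *)
Lemma slice_unif m r (f : 'rV[R]_m.+1 -> R) (x0 e : R) : cc_fun r f -> 0 < e ->
  \forall x \near x0, forall v, `|slice f x v - slice f x0 v| < e.
Proof.
move=> cf e0.
pose K := [set v : 'rV[R]_m | forall k, `[- r, r]%classic (v 0 k)].
have cK : compact K.
  by apply: (@rV_compact _ _ (fun=> `[- r, r]%classic)) => _; exact: segment_compact.
have cs : continuous (fun z : R * 'rV[R]_m => slice f z.1 z.2).
  move=> z; apply: (continuous_comp (@row_mx_continuous m z)); exact: cf.1.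
move/compact_near_coveringP : cK => cov.
have : \forall x \near x0, K `<=` (fun v => `|slice f x v - slice f x0 v| < e).
  apply: (cov _ (nbhs x0) (fun x v => `|slice f x v - slice f x0 v| < e) (nbhs_filter x0)) => v _.
  have e2 : 0 < e / 2 by rewrite divr_gt0.
  have /cvgrPdist_lt /(_ (e / 2) e2) := cs (x0, v).
  move=> [[B1 B2] /= [n1 n2] HB].
  exists (B2, B1); first by split.
  move=> [w x] /= [B2w B1x].
  have h1 := HB (x, w) (conj B1x B2w).
  have h2 := HB (x0, w) (conj (nbhs_singleton n1) B2w).
  move: h1 h2 => /= h1 h2.
  rewrite (le_lt_trans (ler_distD (slice f x0 v) _ _))// distrC; lra.
apply: filterS => x Kx v.
have [Kv|nKv] := pselect (K v); first exact: Kx.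
have /existsNP [k nk] := nKv.
have rk : r < `|v 0 k| by rewrite ltNge ler_norml; apply/negP => H; apply: nk; rewrite /= in_itv.
by rewrite !(proj2 (slice_cc _ cf)) ?subrr ?normr0//; exists k.
Qed.

(* Linearity and boundedness of the m-fold integral make the integral over the
   slices continuous, which is what the (m+1)-fold integral needs. *)
Definition int_rV_spec (m : nat) (r : R) : Prop :=
  [/\ forall f g : 'rV[R]_m -> R, cc_fun r f -> cc_fun r g ->
        int_rV (fun y => f y + g y) = int_rV f + int_rV g,
      forall c (f : 'rV[R]_m -> R), cc_fun r f ->
        int_rV (fun y => c * f y) = c * int_rV f &
      forall K (f : 'rV[R]_m -> R), cc_fun r f -> (forall y, `|f y| <= K) ->
        `|int_rV f| <= (2 * r) ^+ m * K].

Lemma int_slice_continuous m (r : R) (f : 'rV[R]_m.+1 -> R) : 0 < r -> int_rV_spec m r ->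
  cc_fun r f ->
  continuous (fun x => int_rV (slice f x)).
Proof.
move=> r0 [IHD IHZ IHB] cf x0; apply/cvgrPdist_lt => e e0.
have P0 : 0 < (2 * r) ^+ m by rewrite exprn_gt0// mulr_gt0.
have e2 : 0 < e / 2 / (2 * r) ^+ m by rewrite !divr_gt0.
have := slice_unif x0 cf e2; apply: filterS => x Hx.
(* A difference is treated as a sum with -1 times the second function, to use the linearity in
   [int_rV_spec]. *)
have cs := slice_cc x0 cf; have cN := cc_funZ (-1) (slice_cc x cf).
rewrite -[X in _ - X]mul1r -mulNr -IHZ; last exact: slice_cc.
rewrite -IHD//.
rewrite (le_lt_trans (IHB (e / 2 / (2 * r) ^+ m) _ (cc_funD cs cN) _))//.
  by move=> v; rewrite mulN1r distrC ltW.
by rewrite mulrC divfK ?gt_eqF//; lra.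
Qed.

Lemma int_rV_props (m : nat) (r : R) : 0 < r -> int_rV_spec m r.
Proof.
move=> r0; elim: m => [|m IH].
  by split => //= K f _ H; rewrite expr0 mul1r; exact: H.
have cG (f : 'rV[R]_m.+1 -> R) : cc_fun r f -> continuous (fun x => int_rV (slice f x)).
  exact: int_slice_continuous.
have [IHD IHZ IHB] := IH.
have iG f : cc_fun r f -> mu.-integrable `[- r, r] (EFin \o (fun x => int_rV (@slice m f x))).
  move=> cf; apply: continuous_compact_integrable; first exact: segment_compact.
  by apply: continuous_subspaceT; exact: cG.
split.
- move=> f g cf cg; rewrite !(int_rVS (r := r))//; last exact: cc_funD.
  rewrite -RintegralD//; [|exact: iG|exact: iG]; apply: eq_Rintegral => x _.
  by rewrite -IHD//; exact: slice_cc.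
- move=> c f cf; rewrite !(int_rVS (r := r))//; last exact: cc_funZ.
  rewrite -RintegralZl//; last exact: iG.
  by apply: eq_Rintegral => x _; rewrite -IHZ//; exact: slice_cc.
- move=> K f cf fK; rewrite (int_rVS cf).
  rewrite (le_trans (le_normr_Rintegral _ _))//; first exact: iG.
  have -> : (2 * r) ^+ m.+1 * K = \int[mu]_(x in `[- r, r]) ((2 * r) ^+ m * K).
    rewrite Rintegral_cst//= lebesgue_measure_itv/= lte_fin gtrN//= exprS opprK; ring.
  apply: le_Rintegral => //.
  + apply: continuous_compact_integrable; first exact: segment_compact.
    by apply: continuous_subspaceT => x; apply: cvg_norm; exact: cG.
  + apply: continuous_compact_integrable; first exact: segment_compact.
    by apply: continuous_subspaceT => x; exact: cvg_cst.
  + by move=> x _; apply: IHB => [|v]; [exact: slice_cc|exact: fK].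
Qed.

Lemma cc_fun_le m r r' (f : 'rV[R]_m -> R) : r <= r' -> cc_fun r f -> cc_fun r' f.
Proof.
move=> rr [cf f0]; split => // y [k yk]; apply: f0; exists k.
exact: le_lt_trans yk.
Qed.

(** By induction the slice through y has a positive integral a, and by continuity nearby slices have
    integral at least a/2. *)
Lemma int_rV_gt0 m (r : R) (f : 'rV[R]_m -> R) y : 0 < r -> cc_fun r f ->
  (forall y, 0 <= f y) -> 0 < f y -> 0 < int_rV f.
Proof.
elim: m f y => [|m IH] f y r0 cf f0 fy; first by rewrite (thinmx0 y) in fy.
(* The larger cube contains an interval around the first coordinate of y, even when that coordinate
   is r or -r. *)
pose r' := r + 1.
have r'0 : 0 < r' by rewrite ltr_wpDl// ltW.
have cf' : cc_fun r' f by apply: cc_fun_le cf; rewrite lerDl.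
pose x0 : R := lsubmx (y : 'rV[R]_(1 + m)) 0 0.
pose v0 : 'rV[R]_m := rsubmx (y : 'rV[R]_(1 + m)).
have yE : f y = slice f x0 v0.
  have xE : x0%:M = lsubmx (y : 'rV[R]_(1 + m)).
    by apply/rowP => k; rewrite (ord1 k) [LHS]mxE eqxx mulr1n.
  by rewrite /slice xE; congr f; exact/esym/(hsubmxK (y : 'rV[R]_(1 + m))).
have G0 x : 0 <= int_rV (slice f x) by apply: int_rV_ge0 => v; exact: f0.
have Gx0 : 0 < int_rV (slice f x0).
  apply: (IH _ v0 r0 (slice_cc x0 cf)) => [v|]; first exact: f0.
  by rewrite -yE.
have x0r : `|x0| <= r.
  rewrite leNgt; apply/negP => rx.
  by move: fy; rewrite yE (slice_out cf rx) ltxx.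
rewrite (int_rVS cf').
have cG := int_slice_continuous r'0 (int_rV_props m r'0) cf'.
set a := int_rV (slice f x0) in Gx0.
have := cG x0 => /cvgrPdist_lt /(_ (a / 2) (divr_gt0 Gx0 (ltr0Sn _ 1))).
move=> /nbhs_ballP[e /= e0 He].
pose h := Num.min (e / 2) (1 / 2).
have h0 : 0 < h by rewrite lt_min !divr_gt0.
have he : h <= e / 2 by rewrite ge_min lexx.
have h1 : h <= 1 / 2 by rewrite ge_min lexx orbT.
have sub : `[x0 - h, x0 + h]%classic `<=` (`[- r', r']%classic : set R).
  move=> x; rewrite /= !in_itv/= => /andP[x1 x2].
  move: x0r; rewrite ler_norml /r' => /andP[r1 r2].
  by apply/andP; split; lra.
have Glow x : (`[x0 - h, x0 + h]%classic : set R) x -> a / 2 <= int_rV (slice f x).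
  rewrite /= in_itv/= => /andP[x1 x2].
  have /He /= : ball x0 e x by rewrite /ball /= ltr_norml; apply/andP; split; lra.
  rewrite -/a ltr_norml => /andP[]; lra.
have iG (b c : R) : mu.-integrable `[b, c] (EFin \o (fun x => int_rV (slice f x))).
  apply: continuous_compact_integrable; first exact: segment_compact.
  by apply: continuous_subspaceT; exact: cG.
have ih : 0 < \int[mu]_(x in `[x0 - h, x0 + h]) (a / 2).
  rewrite Rintegral_cst//= lebesgue_measure_itv/= lte_fin.
  have -> : x0 - h < x0 + h by lra.
  rewrite /= mulr_gt0 ?divr_gt0//; lra.
rewrite (lt_le_trans ih)//.
rewrite (@le_trans _ _ (\int[mu]_(x in `[x0 - h, x0 + h]) int_rV (slice f x)))//.
  apply: le_Rintegral => //.
  apply: continuous_compact_integrable; first exact: segment_compact.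
  by apply: continuous_subspaceT => x; exact: cvg_cst.
rewrite /Rintegral fine_le//.
- by apply: integrable_fin_num => //; exact: iG.
- by apply: integrable_fin_num => //; exact: iG.
- apply: ge0_subset_integral => //; last by move=> x _; rewrite lee_fin.
  by have /integrableP[] := iG (- r') r'.
Qed.

End IterInt.

(** * The mean value and the norm of a Hamiltonian *)

Section ContactVolume.
Variables (R : realType) (n : nat) (M : topologicalType) (A : atlas R n.*2 M).
Variable alpha : one_form A.
Hypothesis halpha : contact_form alpha.
Variable chi : 'I_(nchart A) -> M -> R.
Hypothesis hchi : partition_of_unity chi.
Hypothesis cM : compact [set: M].
Hypothesis M0 : [set: M] !=set0.
Local Notation E := 'rV[R]_(n.*2).+1.
Implicit Types (i : 'I_(nchart A)).

Lemma cvg_prod (T I : Type) (Fl : set_system T) (r : seq I) (F : I -> T -> R) (a : I -> R) :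
  Filter Fl -> (forall j, F j @ Fl --> a j) ->
  (fun x => \prod_(j <- r) F j x) @ Fl --> \prod_(j <- r) a j.
Proof.
move=> FF H; elim: r => [|j r IH].
  by under eq_fun do rewrite big_nil; rewrite big_nil; exact: cvg_cst.
by under eq_fun do rewrite big_cons; rewrite big_cons; apply: cvgM.
Qed.

Lemma contact_vol_continuous i y : img i y ->
  {for y, continuous (contact_vol (coef alpha i))}.
Proof.
move=> iy.
have sa := @coef_smooth _ _ _ _ alpha i.
have ca k : (fun y => coef alpha i y 0 k) @ y --> coef alpha i y 0 k.
  exact: (@cvg_comp _ _ _ (coef alpha i) (fun w : E => w 0 k) _ _ _ (sa 0%N y iy) (@coord_continuous _ _ _ 0 k _)).
have cD p q : (fun y => 'D_(delta_mx 0 p) (coef alpha i) y 0 q) @ y -->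
    'D_(delta_mx 0 p) (coef alpha i) y 0 q.
  have cDp : 'D_(delta_mx 0 p) (coef alpha i) @ y --> 'D_(delta_mx 0 p) (coef alpha i) y.
    exact: ((sa 1%N).2 (delta_mx 0 p) y iy).
  exact: (@cvg_comp _ _ _ ('D_(delta_mx 0 p) (coef alpha i)) (fun w : E => w 0 q) _ _ _ cDp (@coord_continuous _ _ _ 0 q _)).
have cd p q : (fun y => ext_deriv (coef alpha i) y p q) @ y --> ext_deriv (coef alpha i) y p q.
  exact: (cvgB (cD p q) (cD q p)).
rewrite /prop_for /continuous_at /contact_vol.
move: (nbhs y) (nbhs_filter y) ca cd => Fl FF ca cd.
apply: cvgM; first exact: cvg_cst.
apply: (@cvg_big _ _ +%R) => [|s _]; first exact: add_continuous.
apply: cvgM; last by apply: cvg_prod => k; exact: cd.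
by apply: cvgM; [exact: cvg_cst|exact: ca].
Qed.

Definition local_density i (f : M -> R) (y : E) : R :=
  \1_(img i) y * (chi i (param i y) * f (param i y) * `|contact_vol (coef alpha i) y|).

Let supp i := closure [set x | chi i x != 0].

Let chart_supp_compact i : compact (chart i @` supp i).
Proof.
have [_ _ hs _] := hchi.
apply: continuous_compact.
  by apply: continuous_in_subspaceT => x; rewrite inE => /hs; exact: chart_cont.
apply: subclosed_compact cM _ => //; exact: closed_closure.
Qed.

Lemma local_density_out i f y : ~ (chart i @` supp i) y -> local_density i f y = 0.
Proof.
move=> ny; rewrite /local_density indicE.
have [iy|_] := boolP (y \in img i); last by rewrite mul0r.
rewrite inE in iy.
have [->|c0] := eqVneq (chi i (param i y)) 0; first by rewrite !mul0r mulr0.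
by exfalso; apply: ny; exists (param i y); [exact: subset_closure|exact: paramK].
Qed.

(** The chart image of the support of chi_i is compact, hence bounded and closed; the density is
    continuous inside [img i] and vanishes near every other point. The radius is common to all f, as
    additivity of the integral demands. *)
Lemma local_density_cc i : exists2 r : R, 0 < r & forall f : M -> R, continuous f ->
  cc_fun r (local_density i f).
Proof.
have [K [Kr HK]] := compact_bounded (@chart_supp_compact i).
pose r := `|K| + 1.
have r0 : 0 < r by rewrite ltr_wpDl.
exists r => // f cf; split; last first.
  move=> y [k rk]; apply: local_density_out => Sy.
  have Kr' : K < r by rewrite /r (le_lt_trans (ler_norm K))// ltrDl.
  have := HK r Kr' y Sy; apply/negP; rewrite -ltNge (lt_le_trans rk)//.
  exact: norm_coord_le.
move=> y; have [iy|niy] := pselect (img i y).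
  have cmain : (fun y => chi i (param i y) * f (param i y) * `|contact_vol (coef alpha i) y|)
      @ y --> local_density i f y.
    rewrite /local_density indicE mem_set// mul1r.
    have cchi : (chi i \o param i) @ y --> chi i (param i y).
      apply: (@cvg_comp _ _ _ (param i) (chi i) _ _ _ (param_cont iy)).
      by apply: smooth_fun_continuous; have [+ _ _ _] := hchi; exact.
    have cfp : (f \o param i) @ y --> f (param i y).
      exact: (@cvg_comp _ _ _ (param i) f _ _ _ (param_cont iy) (cf _)).
    have cv : contact_vol (coef alpha i) @ y --> contact_vol (coef alpha i) y.
      exact: contact_vol_continuous.
    exact: (cvgM (cvgM cchi cfp) (cvg_norm cv)).
  move=> B /cmain; apply: (@filterS2 _ _ (nbhs_filter y) _ _ _ _ (nbhs_img iy)) => z iz.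
  by rewrite /= /local_density indicE mem_set// mul1r.
have nS : ~ (chart i @` supp i) y.
  move=> [x Sx xy]; apply: niy; rewrite -xy; apply: chart_img.
  by have [_ _ hs _] := hchi; exact: hs.
have oS : open (~` (chart i @` supp i)).
  by apply: closed_openC; apply: compact_closed; [exact: norm_hausdorff|exact: chart_supp_compact].
move=> B; rewrite (local_density_out f nS) => nB.
apply: filterS (open_nbhs_nbhs (conj oS nS)) => z nz.
by rewrite /= local_density_out//; exact: nbhs_singleton.
Qed.

Local Notation int_nu := (int_nu alpha chi).

Lemma int_nuE f : int_nu f = \sum_i int_rV (local_density i f).
Proof. by []. Qed.

Lemma int_nuD (f h : M -> R) : continuous f -> continuous h ->
  int_nu (fun x => f x + h x) = int_nu f + int_nu h.
Proof.
move=> cf ch; rewrite !int_nuE -big_split; apply: eq_bigr => i _.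
have [r r0 Hr] := local_density_cc i; have [HD _ _] := int_rV_props (n.*2).+1 r0.
apply: etrans (HD _ _ (Hr _ cf) (Hr _ ch)); congr (int_rV _).
by apply/funext => y; rewrite /local_density; ring.
Qed.

Lemma int_nuZ c (f : M -> R) : continuous f ->
  int_nu (fun x => c * f x) = c * int_nu f.
Proof.
move=> cf; rewrite !int_nuE big_distrr; apply: eq_bigr => i _.
have [r r0 Hr] := local_density_cc i; have [_ HZ _] := int_rV_props (n.*2).+1 r0.
apply: etrans (HZ _ _ (Hr _ cf)); congr (int_rV _).
by apply/funext => y; rewrite /local_density; ring.
Qed.

Lemma int_nu_ge0 (f : M -> R) : (forall x, 0 <= f x) -> 0 <= int_nu f.
Proof.
move=> f0; rewrite int_nuE; apply: sumr_ge0 => i _; apply: int_rV_ge0 => y.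
have [_ c0 _ _] := hchi.
by rewrite /local_density indicE !mulr_ge0.
Qed.

(** In a chart where chi_i is positive at some point, the contact condition makes the density
    positive there. *)
Lemma int_nu1_gt0 : 0 < int_nu (cst 1).
Proof.
have [x _] := M0; have [i ci] := partition_pos hchi x.
have [_ c0 _ _] := hchi.
have ix : dom i x by apply: (partition_supp hchi); rewrite gt_eqF.
have d0 j y : 0 <= local_density j (cst 1) y by rewrite /local_density indicE !mulr_ge0 /=.
have [r r0 Hr] := local_density_cc i.
rewrite int_nuE (bigD1 i)// ltr_pwDl//.
  apply: (@int_rV_gt0 _ _ r _ (chart i x)) => //.
    by apply: Hr => y; exact: cvg_cst.
  rewrite /local_density indicE mem_set ?mul1r; last exact: chart_img.
  by rewrite chartK// mulr1 mulr_gt0// normr_gt0; exact/halpha/chart_img.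
by apply: sumr_ge0 => j _; apply: int_rV_ge0 => y; exact: d0.
Qed.

Definition mean (f : M -> R) : R := (int_nu (cst 1))^-1 * int_nu f.

Lemma meanD (f h : M -> R) : continuous f -> continuous h ->
  mean (fun x => f x + h x) = mean f + mean h.
Proof. by move=> cf ch; rewrite /mean int_nuD// mulrDr. Qed.

Lemma meanZ c (f : M -> R) : continuous f -> mean (fun x => c * f x) = c * mean f.
Proof. by move=> cf; rewrite /mean int_nuZ// mulrCA. Qed.

Lemma mean_cst c : mean (fun=> c) = c.
Proof.
have -> : (fun _ : M => c) = (fun x => c * cst 1 x) by apply/funext => x; rewrite mulr1.
rewrite meanZ; last by move=> x; exact: cvg_cst.
by rewrite /mean mulVf ?mulr1// gt_eqF// int_nu1_gt0.
Qed.

Lemma mean_le (f h : M -> R) : continuous f -> continuous h ->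
  (forall x, f x <= h x) -> mean f <= mean h.
Proof.
move=> cf ch fh.
have cd : continuous (fun x => h x - f x) by exact: continuousB.
have -> : mean h = mean f + mean (fun x => h x - f x).
  by rewrite -meanD//; congr mean; apply/funext => x; rewrite addrC subrK.
rewrite lerDl /mean mulr_ge0 ?invr_ge0 ?(ltW int_nu1_gt0)//.
by apply: int_nu_ge0 => x; rewrite subr_ge0.
Qed.

Section Range.
Variable f : M -> R.
Hypothesis cf : continuous f.

Lemma range_bound x : - supnorm f <= f x <= supnorm f.
Proof. by rewrite -ler_norml; exact: ler_supnorm. Qed.

Lemma has_ubound_range : has_ubound (range f).
Proof. by exists (supnorm f) => _ [x _ <-]; have /andP[] := range_bound x. Qed.

Lemma has_lbound_range : has_lbound (range f).
Proof. by exists (- supnorm f) => _ [x _ <-]; have /andP[] := range_bound x. Qed.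

Lemma le_sup_range x : f x <= sup (range f).
Proof. by apply: ub_le_sup; [exact: has_ubound_range|exists x]. Qed.

Lemma inf_range_le x : inf (range f) <= f x.
Proof. by apply: ge_inf; [exact: has_lbound_range|exists x]. Qed.

Lemma range_neq0 : range f !=set0.
Proof. by have [x _] := M0; exists (f x); exists x. Qed.

Lemma sup_range_le c : (forall x, f x <= c) -> sup (range f) <= c.
Proof. by move=> H; apply: ge_sup; [exact: range_neq0|move=> _ [x _ <-]]. Qed.

Lemma le_inf_range c : (forall x, c <= f x) -> c <= inf (range f).
Proof. by move=> H; apply: lb_le_inf; [exact: range_neq0|move=> _ [x _ <-]]. Qed.

Lemma mean_range : inf (range f) <= mean f <= sup (range f).
Proof.
have cc c : continuous (fun _ : M => c : R) by move=> x; exact: cvg_cst.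
rewrite -{1}(mean_cst (inf (range f))) -(mean_cst (sup (range f))).
apply/andP; split; apply: mean_le;
  by [exact: cc|exact: cf|exact: inf_range_le|exact: le_sup_range].
Qed.

End Range.

Local Notation cnorm := (cnorm alpha chi).

Lemma cnormE f : cnorm f = sup (range f) - inf (range f) + `|mean f|.
Proof. by []. Qed.

(** The mean lies in the range interval, so f differs from it by at most the oscillation. *)
Lemma supnorm_le_cnorm (f : M -> R) : continuous f -> supnorm f <= cnorm f.
Proof.
move=> cf; apply: supnorm_le => // x; rewrite cnormE.
have := le_sup_range cf x; have := inf_range_le cf x.
have /andP[] := mean_range cf.
have := ler_norm (mean f); have := ler_norm (- mean f); rewrite normrN.
by rewrite ler_norml => *; apply/andP; split; lra.
Qed.

(** The oscillation contributes 2 and the mean value contributes 1. *)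
Lemma cnorm_le_supnorm (f : M -> R) : continuous f -> cnorm f <= 3 * supnorm f.
Proof.
move=> cf; rewrite cnormE.
have h1 : sup (range f) <= supnorm f.
  by apply: sup_range_le => x; have /andP[] := range_bound cf x.
have h2 : - supnorm f <= inf (range f).
  by apply: le_inf_range => x; have /andP[] := range_bound cf x.
have /andP[h3 h4] := mean_range cf.
have h5 : `|mean f| <= supnorm f by rewrite ler_norml; apply/andP; split; lra.
lra.
Qed.

Lemma cnormD (f h : M -> R) : continuous f -> continuous h ->
  cnorm (fun x => f x + h x) <= cnorm f + cnorm h.
Proof.
move=> cf ch; rewrite !cnormE meanD//.
have h1 : sup (range (fun x => f x + h x)) <= sup (range f) + sup (range h).
  by apply: sup_range_le => x; apply: lerD; exact: le_sup_range.
have h2 : inf (range f) + inf (range h) <= inf (range (fun x => f x + h x)).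
  by apply: le_inf_range => x; apply: lerD; exact: inf_range_le.
have h3 := ler_normD (mean f) (mean h).
lra.
Qed.

(** Provides measurability in time of the norm of a Hamiltonian. *)
Lemma cnorm_lipschitz (f h : M -> R) : continuous f -> continuous h ->
  `|cnorm f - cnorm h| <= 3 * supnorm (fun x => f x - h x).
Proof.
move=> cf ch.
have c1 := continuousB cf ch; have c2 := continuousB ch cf.
have h1 : cnorm f <= cnorm h + 3 * supnorm (fun x => f x - h x).
  rewrite (@le_trans _ _ (cnorm h + cnorm (fun x => f x - h x)))//; last first.
    by rewrite lerD2l; exact: cnorm_le_supnorm.
  rewrite -[in leLHS](_ : (fun x => h x + (f x - h x)) = f); first exact: cnormD.
  by apply/funext => x; rewrite addrC subrK.
have h2 : cnorm h <= cnorm f + 3 * supnorm (fun x => f x - h x).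
  rewrite (@le_trans _ _ (cnorm f + cnorm (fun x => h x - f x)))//; last first.
    rewrite lerD2l (le_trans (cnorm_le_supnorm c2))// ler_wpM2l//.
    apply: supnorm_le => // x; rewrite distrC.
    exact: (@ler_supnorm _ _ cM M0 (fun x => f x - h x)).
  rewrite -[in leLHS](_ : (fun x => f x + (h x - f x)) = h); first exact: cnormD.
  by apply/funext => x; rewrite addrC subrK.
by rewrite ler_norml; apply/andP; split; lra.
Qed.

End ContactVolume.

(** * The group of systems *)

(** The map determines its inverse, and the proofs are irrelevant. Thus a metric can separate points
    for equality of the records. *)
Lemma homeo_ext (M : topologicalType) (f g : homeo M) : (forall x, f x = g x) -> f = g.
Proof.
case: f => f fi fK fiK cf cfi; case: g => g gi gK giK cg cgi /= H.
have e1 : f = g by apply/funext.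
subst g; have e2 : fi = gi by apply/funext => x; rewrite -[x in LHS]giK fK.
by subst gi; congr Homeo; exact: Prop_irrelevance.
Qed.

Lemma homeo_inv_ext (M : topologicalType) (f g : homeo M) :
  (forall x, hinv f x = hinv g x) -> f = g.
Proof. by move=> H; apply: homeo_ext => x; rewrite -[LHS](hinvK g) -H hmapK. Qed.

Section SystemGroup.
Variables (R : realType) (M : topologicalType).
Local Notation sys := ((R -> homeo M) * (R -> M -> R))%type.
Implicit Types P Q : sys.

Definition sys_mul P Q : sys :=
  (fun t => hcomp (P.1 t) (Q.1 t), fun t x => P.2 t x + Q.2 t (hinv (P.1 t) x)).

Definition sys_inv P : sys :=
  (fun t => hsym (P.1 t), fun t x => - P.2 t (P.1 t x)).

Lemma sys_mulKV P Q : sys_mul P (sys_mul (sys_inv P) Q) = Q.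
Proof.
case: Q => Phi H; congr pair.
  by apply/funext => t; apply: homeo_ext => x /=; rewrite hinvK.
by apply/funext => t; apply/funext => x /=; rewrite hinvK addrA subrr add0r.
Qed.

Definition l1_norm (H : R -> M -> R) : R :=
  \int[@lebesgue_measure R]_(t in `[0, 1]) supnorm (H t).

Lemma eq_l1_norm (H K : R -> M -> R) : (forall t, supnorm (H t) = supnorm (K t)) ->
  l1_norm H = l1_norm K.
Proof. by move=> E; apply: eq_Rintegral => t _. Qed.

Lemma supnormN (f : M -> R) : supnorm (fun x => - f x) = supnorm f.
Proof. by congr sup; congr image; apply/funext => x; rewrite normrN. Qed.

Variable D : M -> M -> R.

Definition dist_inv (Phi Psi : R -> homeo M) : R :=
  sup [set D (hinv (Phi z.1) z.2) (hinv (Psi z.1) z.2) |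
       z in @unit_itv R `*` [set: M]].

(* Only the inverse maps are compared: with y = phi^-1(x), the distance between
   (phi psi)^-1(x) and (phi psi')^-1(x) is the one between psi^-1(y) and
   psi'^-1(y), hence the invariance under left translations. *)
Definition sys_dist P Q : R :=
  dist_inv P.1 Q.1 + l1_norm (fun t x => P.2 t x - Q.2 t x).

Lemma sys_dist_mul P Q S : sys_dist (sys_mul P Q) (sys_mul P S) = sys_dist Q S.
Proof.
congr (_ + _).
  congr sup; apply/seteqP; split => _ [[t x] tx <-] /=.
    by exists (t, hinv (P.1 t) x); split => //; have [] := tx.
  exists (t, P.1 t x); first by split => //; have [] := tx.
  by rewrite /= !hmapK.
apply: eq_l1_norm => t.
rewrite -[RHS](supnorm_comp _ (hsym (P.1 t))); congr supnorm.
by apply/funext => x /=; rewrite opprD addrACA subrr add0r.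
Qed.

(** Cancelling P on the left and then multiplying by P0 turns the pair (P, P P0^-1 Q) into (P0,
    Q). *)
Lemma sys_dist_lift P0 P Q : sys_dist P (sys_mul P (sys_mul (sys_inv P0) Q)) =
  sys_dist P0 Q.
Proof.
pose one : sys := (fun=> Homeo (fun x => erefl) (fun x => erefl) (fun x B => id) (fun x B => id), fun _ _ => 0).
have mul1 S : sys_mul S one = S.
  case: S => Phi H; congr pair; first by apply/funext => t; exact: homeo_ext.
  by apply/funext => t; apply/funext => x /=; rewrite addr0.
by rewrite -{1}(mul1 P) sys_dist_mul -(sys_dist_mul P0) mul1 sys_mulKV.
Qed.

Hypothesis cD : compat_metric D.
Hypothesis M0 : [set: M] !=set0.
Variable C : R.
Hypothesis DC : forall x y, D x y <= C.

(** Boundedness of D makes this a genuine supremum, rather than the default value 0. *)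
Lemma dist_inv_ge Phi Psi (t : R) x : 0 <= t <= 1 ->
  D (hinv (Phi t) x) (hinv (Psi t) x) <= dist_inv Phi Psi.
Proof.
move=> t01; apply: ub_le_sup; last by exists (t, x).
by exists C => _ [z _ <-].
Qed.

Lemma dist_inv_le Phi Psi c : (forall (t : R) x, 0 <= t <= 1 ->
  D (hinv (Phi t) x) (hinv (Psi t) x) <= c) -> dist_inv Phi Psi <= c.
Proof.
move=> H; apply: ge_sup; last by move=> _ [[t x] [t01 _] <-]; exact: H.
have [x _] := M0; exists (D (hinv (Phi 0) x) (hinv (Psi 0) x)); exists (0, x) => //.
by split => //; rewrite /unit_itv /= lexx ler01.
Qed.

Lemma dist_inv_ge0 Phi Psi : 0 <= dist_inv Phi Psi.
Proof.
have [x _] := M0; have := @dist_inv_ge Phi Psi 0 x; rewrite lexx ler01 => /(_ isT).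
exact/le_trans/(cm_ge0 cD).
Qed.

Lemma l1_norm_ge0 H : 0 <= l1_norm H.
Proof. by apply: Rintegral_ge0 => t _; exact: supnorm_ge0. Qed.

Lemma sys_dist_ge0 P Q : 0 <= sys_dist P Q.
Proof. by rewrite addr_ge0 ?dist_inv_ge0 ?l1_norm_ge0. Qed.

Lemma sys_dist_refl P : sys_dist P P = 0.
Proof.
have -> : sys_dist P P = dist_inv P.1 P.1 + l1_norm (fun _ _ => 0).
  by congr (_ + _); apply: eq_l1_norm => t; congr supnorm; apply/funext => x; rewrite subrr.
have s0 : supnorm (fun _ : M => 0 : R) = 0.
  by apply/eqP; rewrite eq_le supnorm_ge0// andbT; apply: supnorm_le => // x; rewrite normr0.
have -> : l1_norm (fun _ _ => 0) = 0.
  by rewrite /l1_norm s0 /Rintegral integral0.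
rewrite addr0; apply/eqP; rewrite eq_le dist_inv_ge0 andbT.
by apply: dist_inv_le => t x _; rewrite (cm_refl cD).
Qed.

Lemma sys_dist_sym P Q : sys_dist P Q = sys_dist Q P.
Proof.
congr (_ + _); last first.
  apply: eq_l1_norm => t; rewrite -[RHS]supnormN; congr supnorm.
  by apply/funext => x; rewrite opprB.
by congr sup; congr image; apply/funext => z; rewrite (cm_sym cD).
Qed.

Hypothesis cM : compact [set: M].

Lemma L1C0_integrable (H : R -> M -> R) : L1C0 H ->
  (@lebesgue_measure R).-integrable `[0, 1] (fun t => (supnorm (H t))%:E).
Proof. by case. Qed.

(** The constant c survives unchanged because the time interval has length 1. *)
Lemma l1_norm_le (K A B : R -> M -> R) c : L1C0 K -> L1C0 A -> L1C0 B ->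
  (forall t, 0 <= t <= 1 -> supnorm (K t) <= supnorm (A t) + supnorm (B t) + c) ->
  l1_norm K <= l1_norm A + l1_norm B + c.
Proof.
move=> lK lA lB H.
have ic : (@lebesgue_measure R).-integrable `[0, 1] (EFin \o (fun _ : R => c)).
  by apply: integrable_unit => t _; exact: cvg_cst.
have iAB : (@lebesgue_measure R).-integrable `[0, 1]
    (EFin \o (fun t => supnorm (A t) + supnorm (B t))).
  apply: (integrableD _ (L1C0_integrable lA) (L1C0_integrable lB)).
  exact: measurable_itv.
rewrite /l1_norm -RintegralD//; [|exact: L1C0_integrable|exact: L1C0_integrable].
have -> : c = \int[@lebesgue_measure R]_(t in `[0, 1]) c.
  by rewrite Rintegral_cst//= lebesgue_measure_itv/= lte_fin ltr01 oppr0 addr0 mulr1.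
rewrite -RintegralD//; apply: le_Rintegral => //.
- exact: L1C0_integrable.
- by apply: (integrableD _ iAB ic); exact: measurable_itv.
Qed.

Lemma sys_dist_tri P Q S : L1C0 P.2 -> L1C0 Q.2 -> L1C0 S.2 ->
  sys_dist P S <= sys_dist P Q + sys_dist Q S.
Proof.
move=> lP lQ lS; rewrite addrACA; apply: lerD.
  apply: dist_inv_le => t x t01; rewrite (le_trans (cm_tri cD _ (hinv (Q.1 t) x) _))//.
  by apply: lerD; exact: dist_inv_ge.
rewrite -[leRHS]addr0; apply: l1_norm_le; [exact: L1C0B|exact: L1C0B|exact: L1C0B|].
move=> t t01; rewrite addr0; apply: supnormD => //.
- by apply: continuousB; [case: lP => + _ _; exact|case: lQ => + _ _; exact].
- by apply: continuousB; [case: lQ => + _ _; exact|case: lS => + _ _; exact].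
- by move=> x; rewrite (le_trans _ (ler_normD _ _))// addrA subrK.
Qed.

End SystemGroup.

(** * Topological strictly contact systems *)

Section Systems.
Variables (R : realType) (n : nat) (M : topologicalType).
Hypothesis hM : closed_connected M.
Variables (A : atlas R n.*2 M) (alpha : one_form A).
Hypothesis halpha : contact_form alpha.
Variable chi : 'I_(nchart A) -> M -> R.
Hypothesis hchi : partition_of_unity chi.
Variable g : riemannian_metric A.
Local Notation sys := ((R -> homeo M) * (R -> M -> R))%type.
Local Notation d := (riemannian_dist g).
Local Notation D := (embed_dist chi).
Local Notation real_dist := (fun x y : R => `|x - y|).
Implicit Types (Phi Psi : R -> homeo M) (H K : R -> M -> R) (P Q : sys).

Let cM : compact [set: M]. Proof. by have [] := hM. Qed.
Let kM : connected [set: M]. Proof. by have [] := hM. Qed.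
Let M0 : [set: M] !=set0. Proof. by have [] := hM. Qed.
Let cD : compat_metric D. Proof. exact: compat_embed_dist. Qed.

(** Forward and inverse maps together, in terms of D: the pointwise counterpart of a small
    [dbar_isotopy]. *)
Definition isotopy_close (e : R) Phi Psi : Prop := forall (t : R) x, 0 <= t <= 1 ->
  D (Phi t x) (Psi t x) < e /\ D (hinv (Phi t) x) (hinv (Psi t) x) < e.

Section DistanceOfIsotopies.
Variable C : R.
Hypothesis dC : forall x y, d x y <= C.

Lemma range_dist_bounded (f h : M -> M) : has_ubound (range (fun x => d (f x) (h x))).
Proof. by exists C => _ [x _ <-]. Qed.

Lemma sup_dist_ge0 (f h : M -> M) : 0 <= sup (range (fun x => d (f x) (h x))).
Proof.
have [x _] := M0; apply: (le_trans (dist_ge0 g (f x) (h x))).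
by apply: ub_le_sup; [exact: range_dist_bounded|exists x].
Qed.

Lemma sup_dist_le (f h : M -> M) c : (forall x, d (f x) (h x) <= c) ->
  sup (range (fun x => d (f x) (h x))) <= c.
Proof.
move=> H; apply: ge_sup; last by move=> _ [x _ <-].
by have [x _] := M0; exists (d (f x) (h x)); exists x.
Qed.

Lemma dbar_ge (f h : homeo M) x :
  d (f x) (h x) <= dbar d f h /\ d (hinv f x) (hinv h x) <= dbar d f h.
Proof.
have h1 := sup_dist_ge0 f h; have h2 := sup_dist_ge0 (hinv f) (hinv h).
have h3 : d (f x) (h x) <= sup (range (fun x => d (f x) (h x))).
  by apply: ub_le_sup; [exact: range_dist_bounded|exists x].
have h4 : d (hinv f x) (hinv h x) <= sup (range (fun x => d (hinv f x) (hinv h x))).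
  by apply: ub_le_sup; [exact: range_dist_bounded|exists x].
by rewrite /dbar; split; lra.
Qed.

Lemma dbar_le (f h : homeo M) c :
  (forall x, d (f x) (h x) <= c /\ d (hinv f x) (hinv h x) <= c) -> dbar d f h <= 2 * c.
Proof.
move=> H; have h1 : sup (range (fun x => d (f x) (h x))) <= c.
  by apply: sup_dist_le => x; have [] := H x.
have h2 : sup (range (fun x => d (hinv f x) (hinv h x))) <= c.
  by apply: sup_dist_le => x; have [] := H x.
rewrite /dbar; lra.
Qed.

Lemma dbar_isotopy_ge Phi Psi (t : R) : 0 <= t <= 1 ->
  dbar d (Phi t) (Psi t) <= dbar_isotopy d Phi Psi.
Proof.
move=> t01; apply: ub_le_sup; last by exists t.
by exists (2 * C) => _ [s _ <-]; apply: dbar_le.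
Qed.

Lemma dbar_isotopy_le Phi Psi c : (forall (t : R) x, 0 <= t <= 1 ->
  d (Phi t x) (Psi t x) <= c /\ d (hinv (Phi t) x) (hinv (Psi t) x) <= c) ->
  dbar_isotopy d Phi Psi <= 2 * c.
Proof.
move=> H; apply: ge_sup; last first.
  by move=> _ [t /= t01 <-]; apply: dbar_le => x; exact: H.
by exists (dbar d (Phi 0) (Psi 0)); exists 0 => //=; rewrite lexx ler01.
Qed.

Lemma dbar_isotopy_ge0 Phi Psi : 0 <= dbar_isotopy d Phi Psi.
Proof.
have [x _] := M0; have := @dbar_isotopy_ge Phi Psi 0; rewrite lexx ler01 => /(_ isT).
apply: le_trans; have [h _] := dbar_ge (Phi 0) (Psi 0) x.
exact: le_trans (dist_ge0 g _ _) h.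
Qed.

End DistanceOfIsotopies.

Lemma isotopy_dist_ge0 Phi Psi : 0 <= dbar_isotopy d Phi Psi.
Proof. by have [C C0 HC] := dist_bounded g cM kM M0; exact: (dbar_isotopy_ge0 HC). Qed.

Lemma isotopy_dist_close (e : R) : 0 < e -> exists2 h : R, 0 < h &
  forall Phi Psi, dbar_isotopy d Phi Psi < h -> isotopy_close e Phi Psi.
Proof.
move=> e0; have [B B0 HB] := embed_dist_le hchi g cM kM.
have [C C0 HC] := dist_bounded g cM kM M0.
exists (e / B); first by rewrite divr_gt0.
move=> Phi Psi H t x t01; have h1 := dbar_isotopy_ge HC Phi Psi t01.
have [h2 h3] := dbar_ge HC (Phi t) (Psi t) x.
have key a b : d a b <= dbar d (Phi t) (Psi t) -> D a b < e.
  move=> ab; rewrite (le_lt_trans (HB _ _))// mulrC -ltr_pdivlMr//.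
  by rewrite (le_lt_trans ab)// (le_lt_trans h1).
by split; exact: key.
Qed.

Lemma isotopy_close_dist (e : R) : 0 < e -> exists2 h : R, 0 < h &
  forall Phi Psi, isotopy_close h Phi Psi -> dbar_isotopy d Phi Psi < e.
Proof.
(* Two suprema are added and strictness is lost in each, whence 2 * (e / 4) < e. *)
move=> e0; have e4 : 0 < e / 4 by rewrite divr_gt0.
have [h h0 Hh] := dist_embed_dist hchi g cM e4.
exists h => // Phi Psi HH.
apply: (@le_lt_trans _ _ (2 * (e / 4))); last lra.
apply: dbar_isotopy_le => t x t01; have [h1 h2] := HH t x t01.
by split; exact/ltW/Hh.
Qed.

Lemma continuous_isotopyP Phi :
  continuous_isotopy Phi <-> unif_cont D D (fun t => Phi t).
Proof. exact: (jcont_unif_cont cD cD). Qed.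

(** The pointwise bounds with constants 1 and 3 integrate once the middle function is known to be
    measurable, hence integrable by domination. *)
Lemma norm_1oo_bounds H : L1C0 H ->
  l1_norm H <= norm_1oo alpha chi H <= 3 * l1_norm H.
Proof.
move=> lH; have [cH mH iH] := lH.
have i3 : (@lebesgue_measure R).-integrable `[0, 1] (EFin \o (fun t => 3 * supnorm (H t))).
  by apply: (integrableZl _ 3 iH); exact: measurable_itv.
have mc : measurable_fun (`[0, 1]%classic : set R) (fun t => cnorm alpha chi (H t)).
  apply: (strongly_measurable_lipschitz M0 (q := cnorm alpha chi) cH mH (C := 3)) => f h cf ch.
  exact: (cnorm_lipschitz halpha hchi cM M0).
have c0 t : 0 <= t <= 1 -> supnorm (H t) <= cnorm alpha chi (H t) <= 3 * supnorm (H t).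
  move=> t01; apply/andP; split.
    exact: (supnorm_le_cnorm halpha hchi cM M0 (cH t t01)).
  exact: (cnorm_le_supnorm halpha hchi cM M0 (cH t t01)).
have ic : (@lebesgue_measure R).-integrable `[0, 1] (EFin \o (fun t => cnorm alpha chi (H t))).
  apply: le_integrable i3 => //; first exact/measurable_EFinP.
  move=> t /unit_itvP t01; rewrite lee_fin.
  have /andP[h1 h2] := c0 t t01; have h3 := supnorm_ge0 M0 (H t).
  by rewrite !ger0_norm//; lra.
apply/andP; split.
  by apply: le_Rintegral => // t /unit_itvP t01; have /andP[] := c0 t t01.
rewrite /l1_norm -RintegralZl//.
by apply: le_Rintegral => // t /unit_itvP t01; have /andP[] := c0 t t01.
Qed.

Lemma smooth_scds_L1C0 Phi H : smooth_scds alpha Phi H -> L1C0 H.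
Proof.
move=> sH; have [_ _ uH] := smooth_scds_unif_cont cD cM sH.
exact: (L1C0_unif_cont cD cM M0 uH).
Qed.

(** * Approximation by smooth systems *)

Definition smooth_approx (e : R) P (Psi : R -> homeo M) (G : R -> M -> R) : Prop :=
  [/\ smooth_scds alpha Psi G, isotopy_close e Psi P.1 &
      l1_norm (fun t x => P.2 t x - G t x) < e].

(** Replaces sequences, d and the norm with the mean value by e-approximations in terms of D and the
    supremum norm, the form in which products and inverses are handled. *)
Lemma tscdsP P : tscds alpha chi d P <->
  [/\ unif_cont D D (fun t => P.1 t), L1C0 P.2 &
      forall e : R, 0 < e -> exists Psi G, smooth_approx e P Psi G].
Proof.
split=> [[/continuous_isotopyP cP lP [Phi [H [sH cPhi cH]]]]|[uP lP HP]].
  split => // e e0; have [h h0 Hh] := isotopy_dist_close e0.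
  have /cvgrPdist_lt /(_ h h0) n1 := cPhi.
  have /cvgrPdist_lt /(_ e e0) n2 := cH.
  have [i [h1 h2]] := filter_ex (filterI n1 n2).
  exists (Phi i), (H i); split => //.
    by apply: Hh; move: h1 => /=; rewrite sub0r normrN; exact/le_lt_trans/ler_norm.
  have lB := L1C0B cM M0 lP (smooth_scds_L1C0 (sH i)).
  have /andP[h3 _] := norm_1oo_bounds lB; apply: le_lt_trans h3 _.
  by move: h2 => /=; rewrite sub0r normrN; exact/le_lt_trans/ler_norm.
split => //; first exact/continuous_isotopyP.
have /choice [F HF] : forall i, exists F : sys, smooth_approx i.+1%:R^-1 P F.1 F.2.
  move=> i; have i0 : 0 < i.+1%:R^-1 :> R by rewrite invr_gt0.
  by have [Psi [G PG]] := HP _ i0; exists (Psi, G).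
have small (e : R) : 0 < e -> \forall i \near \oo, (i.+1%:R^-1 : R) < e.
  move=> e0; have /cvgrPdist_lt /(_ e e0) := @cvg_harmonic R.
  by apply: filterS => i; rewrite sub0r normrN ger0_norm ?invr_ge0.
exists (fun i => (F i).1), (fun i => (F i).2); split.
- by move=> i; have [] := HF i.
- apply/cvgrPdist_lt => e e0; have [h h0 Hh] := isotopy_close_dist e0.
  apply: filterS (small h h0) => i ih; rewrite sub0r normrN ger0_norm ?isotopy_dist_ge0//.
  apply: Hh => t x t01; have [_ /(_ t x t01)[h1 h2] _] := HF i.
  by split; exact: lt_trans ih.
(* One third compensates the factor 3 between the two norms. *)
- apply/cvgrPdist_lt => e e0; have e3 : 0 < e / 3 by rewrite divr_gt0.
  apply: filterS (small _ e3) => i ih; have [sF _ nF] := HF i.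
  have /andP[h1 h2] := norm_1oo_bounds (L1C0B cM M0 lP (smooth_scds_L1C0 sF)).
  have h3 := l1_norm_ge0 M0 (fun t x => P.2 t x - (F i).2 t x).
  have h4 := lt_trans nF ih.
  rewrite sub0r normrN ger0_norm; last exact: le_trans h1.
  rewrite (le_lt_trans h2)// mulrC -ltr_pdivlMr//.
Qed.

(** The inverse maps are uniform limits of those of smooth systems, so continuity passes to the
    limit. *)
Lemma unif_cont_hinv P : tscds alpha chi d P -> unif_cont D D (fun t => hinv (P.1 t)).
Proof.
move=> /tscdsP[_ _ HP] e e0; have e3 : 0 < e / 3 by rewrite divr_gt0.
have [Psi [G [sG close _]]] := HP _ e3.
have [_ uPsi _] := smooth_scds_unif_cont cD cM sG.
have [h h0 Hh] := uPsi _ e3; exists h => // s t x y s01 t01 st xy.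
have h1 := Hh s t x y s01 t01 st xy.
have [_ h2] := close s x s01; have [_ h3] := close t y t01.
rewrite (cm_sym cD) in h2.
have h4 := cm_tri cD (hinv (P.1 s) x) (hinv (Psi s) x) (hinv (P.1 t) y).
have h5 := cm_tri cD (hinv (Psi s) x) (hinv (Psi t) y) (hinv (P.1 t) y).
lra.
Qed.

Lemma unif_cont_at (f : R -> M -> M) (e : R) : unif_cont D D f -> 0 < e ->
  exists2 h : R, 0 < h & forall (t : R) x y, 0 <= t <= 1 -> D x y < h -> D (f t x) (f t y) < e.
Proof.
move=> uf e0; have [h h0 Hh] := uf e e0; exists h => // t x y t01 xy.
by apply: Hh => //; rewrite subrr normr0.
Qed.

Lemma unif_cont_at_real (f : R -> M -> R) (e : R) : unif_cont D real_dist f -> 0 < e ->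
  exists2 h : R, 0 < h & forall (t : R) x y, 0 <= t <= 1 -> D x y < h -> `|f t x - f t y| < e.
Proof.
move=> uf e0; have [h h0 Hh] := uf e e0; exists h => // t x y t01 xy.
by apply: Hh => //; rewrite subrr normr0.
Qed.

Lemma L1C0_cont H (t : R) : L1C0 H -> 0 <= t <= 1 -> continuous (H t).
Proof. by move=> [cH _ _]; exact: cH. Qed.

(** The second factor is approximated first: the modulus of continuity of its smooth Hamiltonian F
    decides how close Phi must be to P, so that F o Phi^-1 is uniformly close to F taken at the
    inverse maps of P. *)
Lemma tscds_mul P Q : tscds alpha chi d P -> tscds alpha chi d Q ->
  tscds alpha chi d (sys_mul P Q).
Proof.
move=> tP tQ; have uPi := unif_cont_hinv tP; have uQi := unif_cont_hinv tQ.
have /tscdsP[uP lP aP] := tP; have /tscdsP[uQ lQ aQ] := tQ.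
have lPQ : L1C0 (sys_mul P Q).2 by apply: L1C0D => //; exact: (L1C0_comp cD).
apply/tscdsP; split => //; first exact: unif_cont_comp uP uQ.
move=> e e0; have e4 : 0 < e / 4 by rewrite divr_gt0.
have e2 : 0 < e / 2 by rewrite divr_gt0.
have [h1 h10 H1] := unif_cont_at uP e2.
have m1 : 0 < Num.min (e / 4) h1 by rewrite lt_min e4 h10.
have [Psi [F [sF cF nF]]] := aQ _ m1.
have [_ _ uF] := smooth_scds_unif_cont cD cM sF.
have [h2 h20 H2] := unif_cont_at_real uF e4.
have [h3 h30 H3] := unif_cont_at uQi e2.
have m2 : 0 < Num.min (e / 4) (Num.min h2 h3) by rewrite !lt_min e4 h20 h30.
have [Phi [H [sH cH nH]]] := aP _ m2.
have sHF := smooth_scds_comp sH sF.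
have lF := smooth_scds_L1C0 sF; have lH := smooth_scds_L1C0 sH.
have lHF := smooth_scds_L1C0 sHF.
exists (fun t => hcomp (Phi t) (Psi t)), (fun t x => H t x + F t (hinv (Phi t) x)).
split => //.
  move=> t x t01 /=.
  have [p1 p2] := cH t x t01; have [q1 q2] := cF t x t01.
  have [r1 _] := cH t (Psi t x) t01; have [_ r2] := cF t (hinv (Phi t) x) t01.
  rewrite !lt_min in p2 q1 r1 r2.
  have /andP[q3 q4] := q1; have /andP[r3 _] := r1; have /andP[r4 _] := r2.
  have /and3P[p3 p4 p5] := p2.
  have a1 := H1 t _ _ t01 q4; have a2 := H3 t _ _ t01 p5.
  have b1 := cm_tri cD (Phi t (Psi t x)) (P.1 t (Psi t x)) (P.1 t (Q.1 t x)).
  have b2 := cm_tri cD (hinv (Psi t) (hinv (Phi t) x)) (hinv (Q.1 t) (hinv (Phi t) x))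
    (hinv (Q.1 t) (hinv (P.1 t) x)).
  by split; lra.
rewrite !lt_min in nF nH; have /andP[nF1 _] := nF; have /andP[nH1 _] := nH.
have lK : L1C0 (fun t x => P.2 t x - H t x) by exact: L1C0B.
have lE : L1C0 (fun t x => Q.2 t x - F t x) by exact: L1C0B.
apply: (@le_lt_trans _ _ (l1_norm (fun t x => P.2 t x - H t x) +
    l1_norm (fun t x => Q.2 t x - F t x) + e / 4)); last lra.
apply: l1_norm_le => //; first exact: (L1C0B cM M0 lPQ lHF).
move=> t t01; apply: supnorm_le => // x /=.
have k1 := ler_supnorm cM M0 x (L1C0_cont lK t01).
have k2 := ler_supnorm cM M0 (hinv (P.1 t) x) (L1C0_cont lE t01).
have [_ p2] := cH t x t01; rewrite !lt_min (cm_sym cD) in p2; have /and3P[_ p4 _] := p2.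
have k3 := H2 t _ _ t01 p4.
have -> : P.2 t x + Q.2 t (hinv (P.1 t) x) - (H t x + F t (hinv (Phi t) x)) =
  (P.2 t x - H t x) + (Q.2 t (hinv (P.1 t) x) - F t (hinv (P.1 t) x)) +
  (F t (hinv (P.1 t) x) - F t (hinv (Phi t) x)) by ring.
rewrite (le_trans (ler_normD _ _))// lerD ?(ltW k3)//.
by rewrite (le_trans (ler_normD _ _))// lerD.
Qed.

(* G fixes a modulus of continuity before (Phi, H) is chosen, so that
   H o phi is close to H o Phi in the L1 norm. *)
Lemma tscds_inv P : tscds alpha chi d P -> tscds alpha chi d (sys_inv P).
Proof.
move=> tP; have uPi := unif_cont_hinv tP; have /tscdsP[uP lP aP] := tP.
have lPi : L1C0 (sys_inv P).2 by apply: L1C0N => //; exact: (L1C0_comp cD).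
apply/tscdsP; split => // e e0; have e8 : 0 < e / 8 by rewrite divr_gt0.
have [Psi [G [sG _ nG]]] := aP _ e8.
have [_ _ uG] := smooth_scds_unif_cont cD cM sG.
have [h h0 Hh] := unif_cont_at_real uG e8.
have m1 : 0 < Num.min (e / 8) h by rewrite lt_min e8 h0.
have [Phi [H [sH cH nH]]] := aP _ m1.
have sHi := smooth_scds_inv sH.
have lH := smooth_scds_L1C0 sH; have lG := smooth_scds_L1C0 sG.
have lHi := smooth_scds_L1C0 sHi.
rewrite !lt_min in nH; have /andP[nH1 _] := nH.
exists (fun t => hsym (Phi t)), (fun t x => - H t (Phi t x)); split => //.
  move=> t x t01; have [p1 p2] := cH t x t01.
  by rewrite !lt_min in p1 p2; split; [have /andP[] := p2|have /andP[] := p1]; lra.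
have lK : L1C0 (fun t x => P.2 t x - H t x) by exact: L1C0B.
have lE : L1C0 (fun t x => P.2 t x - G t x) by exact: L1C0B.
(* The error of G occurs at two points, Phi_t x and P_t x; its double lets [l1_norm_le], which has
   room for two functions, account for both. *)
have lE2 : L1C0 (fun t x => (P.2 t x - G t x) + (P.2 t x - G t x)) by exact: L1C0D.
have n2 : l1_norm (fun t x => (P.2 t x - G t x) + (P.2 t x - G t x)) <=
    l1_norm (fun t x => P.2 t x - G t x) + l1_norm (fun t x => P.2 t x - G t x) + 0.
  apply: l1_norm_le => // t t01; rewrite addr0.
  apply: supnormD => //; [exact: (L1C0_cont lE)|exact: (L1C0_cont lE)|].
  by move=> x; exact: ler_normD.
apply: (@le_lt_trans _ _ (l1_norm (fun t x => P.2 t x - H t x) +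
    l1_norm (fun t x => (P.2 t x - G t x) + (P.2 t x - G t x)) + e / 8)); last lra.
apply: l1_norm_le => //; first exact: (L1C0B cM M0 lPi lHi).
move=> t t01; apply: supnorm_le => // x /=.
have k1 := ler_supnorm cM M0 (Phi t x) (L1C0_cont lK t01).
have kE y : `|P.2 t y - G t y| <=
    supnorm (fun x => (P.2 t x - G t x) + (P.2 t x - G t x)) / 2.
  have := ler_supnorm cM M0 y (L1C0_cont lE2 t01).
  by rewrite -mulr2n normrMn mulr2n; lra.
have [p1 _] := cH t x t01; rewrite !lt_min (cm_sym cD) in p1; have /andP[_ p4] := p1.
have k3 := Hh t _ _ t01 p4.
have -> : - P.2 t (P.1 t x) - - H t (Phi t x) =
  - (P.2 t (Phi t x) - H t (Phi t x)) +
  ((P.2 t (Phi t x) - G t (Phi t x)) - (P.2 t (P.1 t x) - G t (P.1 t x))) -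
  (G t (P.1 t x) - G t (Phi t x)) by ring.
rewrite (le_trans (ler_normB _ _))// lerD ?(ltW k3)//.
rewrite (le_trans (ler_normD _ _))// lerD ?normrN//.
rewrite (le_trans (ler_normB _ _))//.
have := kE (Phi t x); have := kE (P.1 t x); lra.
Qed.

Local Notation S := (tscds alpha chi d).
Local Notation delta := (@sys_dist R M D).
Local Notation X := (Homeo_alpha alpha chi d).

Lemma tscds_L1C0 P : S P -> L1C0 P.2.
Proof. by case. Qed.

(** Forward maps: at the point Q_t x the inverse maps give P_t^-1(Q_t x) close to x, and applying
    P_t, which is uniformly continuous, gives Q_t x close to P_t x. The radius depends on P through
    this modulus. *)
Lemma sys_dist_dist_alpha P (e : R) : S P -> 0 < e -> exists2 h : R, 0 < h &
  forall Q, S Q -> delta P Q < h -> dist_alpha alpha chi d P Q < e.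
Proof.
move=> tP e0; have e2 : 0 < e / 2 by rewrite divr_gt0.
have [C C0 HC] := embed_dist_bounded hchi cM M0.
have [h1 h10 H1] := isotopy_close_dist e2.
have /tscdsP[uP lP _] := tP.
have [h2 h20 H2] := unif_cont_at uP h10.
(* The bound e / 6 becomes e / 2 under the factor 3 between the norms. *)
have m0 : 0 < Num.min h1 (Num.min h2 (e / 6)) by rewrite !lt_min h10 h20 divr_gt0.
exists (Num.min h1 (Num.min h2 (e / 6))) => // Q tQ.
rewrite /sys_dist !lt_min => /and3P[d1 d2 d3].
have n0 := l1_norm_ge0 M0 (fun t x => P.2 t x - Q.2 t x).
have i0 := dist_inv_ge0 cD M0 HC P.1 Q.1.
have lPQ := L1C0B cM M0 lP (tscds_L1C0 tQ).
have /andP[_ n1] := norm_1oo_bounds lPQ.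
have c : isotopy_close h1 P.1 Q.1.
  move=> t x t01; split.
    have := dist_inv_ge HC P.1 Q.1 (Q.1 t x) t01; rewrite hmapK => le.
    have := H2 t (hinv (P.1 t) (Q.1 t x)) x t01; rewrite hinvK => H2'.
    by rewrite (cm_sym cD); apply: H2'; lra.
  by have := dist_inv_ge HC P.1 Q.1 x t01; lra.
have := H1 _ _ c; rewrite /dist_alpha; lra.
Qed.

Lemma dist_alpha_sys_dist P (e : R) : S P -> 0 < e -> exists2 h : R, 0 < h &
  forall Q, S Q -> dist_alpha alpha chi d P Q < h -> delta P Q < e.
Proof.
move=> tP e0; have e2 : 0 < e / 2 by rewrite divr_gt0.
have [h1 h10 H1] := isotopy_dist_close e2.
have m0 : 0 < Num.min h1 (e / 2) by rewrite lt_min h10.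
exists (Num.min h1 (e / 2)) => // Q tQ.
rewrite /dist_alpha !lt_min => /andP[d1 d2].
have lPQ := L1C0B cM M0 (tscds_L1C0 tP) (tscds_L1C0 tQ).
have /andP[n1 _] := norm_1oo_bounds lPQ.
have n0 := l1_norm_ge0 M0 (fun t x => P.2 t x - Q.2 t x).
have i0 := isotopy_dist_ge0 P.1 Q.1.
have c : isotopy_close (e / 2) P.1 Q.1 by apply: H1; lra.
have : dist_inv D P.1 Q.1 <= e / 2.
  by apply: dist_inv_le => // t x t01; have [_ /ltW] := c t x t01.
rewrite /sys_dist; lra.
Qed.

(** * The quotient metric on time-one maps *)

Definition lifts (f : homeo M) P : Prop := S P /\ P.1 1 = f.

Lemma HomeoP f : X f <-> exists P, lifts f P.
Proof. by split=> [[P SP <-]|[P [SP <-]]]; [exists P|exists P]. Qed.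

Definition quotient_dist (f h : homeo M) : R :=
  inf [set r | exists P Q, [/\ lifts f P, lifts h Q & r = delta P Q]].

Local Notation rho := quotient_dist.

Lemma delta_ge0 P Q : 0 <= delta P Q.
Proof. by have [C _ HC] := embed_dist_bounded hchi cM M0; exact: (sys_dist_ge0 cD M0 HC). Qed.

Lemma delta_refl P : delta P P = 0.
Proof. by have [C _ HC] := embed_dist_bounded hchi cM M0; exact: (sys_dist_refl cD M0 HC). Qed.

Lemma delta_tri P Q T : S P -> S Q -> S T -> delta P T <= delta P Q + delta Q T.
Proof.
move=> sP sQ sT; have [C _ HC] := embed_dist_bounded hchi cM M0.
by apply: (sys_dist_tri cD M0 HC cM); exact: tscds_L1C0.
Qed.

Lemma quotient_dist_le f h P Q : lifts f P -> lifts h Q -> rho f h <= delta P Q.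
Proof.
move=> lP lQ; apply: ge_inf; last by exists P, Q.
by exists 0 => _ [P' [Q' [_ _ ->]]]; exact: delta_ge0.
Qed.

(* The lift of [f] is arbitrary: translating a pair of lifts on the left moves
   the lift of [f] within its fibre and preserves delta. *)
Lemma quotient_dist_lift f h P r : lifts f P -> X h -> rho f h < r ->
  exists2 Q, lifts h Q & delta P Q < r.
Proof.
move=> lP /HomeoP[Q lQ] fhr.
have hi : has_inf [set r | exists P Q, [/\ lifts f P, lifts h Q & r = delta P Q]].
  split; first by exists (delta P Q), P, Q.
  by exists 0 => _ [P' [Q' [_ _ ->]]]; exact: delta_ge0.
have e0 : 0 < r - rho f h by rewrite subr_gt0.
have [_ [P0 [Q0 [lP0 lQ0 ->]]]] := inf_adherent e0 hi.
rewrite addrC subrK => dr.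
exists (sys_mul P (sys_mul (sys_inv P0) Q0)); last by rewrite sys_dist_lift.
split.
  apply: tscds_mul; first exact: lP.1.
  by apply: tscds_mul; [apply: tscds_inv; exact: lP0.1|exact: lQ0.1].
apply: homeo_ext => x /=.
by rewrite lP.2 lP0.2 lQ0.2 hinvK.
Qed.

Lemma quotient_dist_ge0 f h : X f -> X h -> 0 <= rho f h.
Proof.
move=> /HomeoP[P lP] /HomeoP[Q lQ]; apply: lb_le_inf.
  by exists (delta P Q), P, Q.
by move=> _ [P' [Q' [_ _ ->]]]; exact: delta_ge0.
Qed.

Lemma quotient_dist_metric : metric_on X rho.
Proof.
have [C _ HC] := embed_dist_bounded hchi cM M0.
split; first exact: quotient_dist_ge0.
- move=> f h Xf Xh; split=> [r0|<-]; last first.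
    have /HomeoP[P lP] := Xf; apply/eqP.
    rewrite eq_le quotient_dist_ge0// andbT -(delta_refl P).
    exact: quotient_dist_le.
  apply: homeo_inv_ext => x; apply: (cm_sep cD); apply/eqP.
  rewrite eq_le (cm_ge0 cD) andbT; apply/ler_addgt0Pr => e e0.
  have /HomeoP[P lP] := Xf.
  have [|Q lQ dPQ] := @quotient_dist_lift f h P e lP Xh; first by rewrite r0.
  rewrite add0r -lP.2 -lQ.2 ltW// (le_lt_trans _ dPQ)//.
  have t1 : 0 <= (1 : R) <= 1 by rewrite ler01 lexx.
  rewrite (le_trans (dist_inv_ge HC P.1 Q.1 x t1))// /sys_dist lerDl.
  exact: l1_norm_ge0.
- have sym f h : X f -> X h -> rho f h <= rho h f.
    move=> Xf Xh; have /HomeoP[Q lQ] := Xh; apply/ler_addgt0Pr => e e0.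
    have [|P lP dQP] := @quotient_dist_lift h f Q (rho h f + e) lQ Xf.
      by rewrite ltrDl.
    by rewrite (le_trans (quotient_dist_le lP lQ))// sys_dist_sym// ltW.
  by move=> f h Xf Xh; apply/eqP; rewrite eq_le !sym.
- move=> f h k Xf Xh Xk; apply/ler_addgt0Pr => e e0.
  have e2 : 0 < e / 2 by rewrite divr_gt0.
  have /HomeoP[P lP] := Xf.
  have [|Q lQ dPQ] := @quotient_dist_lift f h P (rho f h + e / 2) lP Xh.
    by rewrite ltrDl.
  have [|T lT dQT] := @quotient_dist_lift h k Q (rho h k + e / 2) lQ Xk.
    by rewrite ltrDl.
  rewrite (le_trans (quotient_dist_le lP lT))//.
  by rewrite (le_trans (delta_tri lP.1 lQ.1 lT.1))//; lra.
Qed.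

Lemma Homeo_comp f h : X f -> X h -> X (hcomp f h).
Proof.
move=> /HomeoP[P lP] /HomeoP[Q lQ]; apply/HomeoP; exists (sys_mul P Q).
by split; [apply: tscds_mul; [exact: lP.1|exact: lQ.1]|rewrite /= lP.2 lQ.2].
Qed.

Lemma Homeo_inv f : X f -> X (hsym f).
Proof.
move=> /HomeoP[P lP]; apply/HomeoP; exists (sys_inv P).
by split; [apply: tscds_inv; exact: lP.1|rewrite /= lP.2].
Qed.

Lemma quotient_dist_left_invariant : left_invariant X rho.
Proof.
have le f h k : X f -> X h -> X k -> rho (hcomp f h) (hcomp f k) <= rho h k.
  move=> /HomeoP[P lP] Xh Xk; have /HomeoP[Q lQ] := Xh; apply/ler_addgt0Pr => e e0.
  have [|T lT dQT] := @quotient_dist_lift h k Q (rho h k + e) lQ Xk.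
    by rewrite ltrDl.
  rewrite (le_trans _ (ltW dQT))// -(sys_dist_mul D P); apply: quotient_dist_le.
    by split; [apply: tscds_mul; [exact: lP.1|exact: lQ.1]|rewrite /= lP.2 lQ.2].
  by split; [apply: tscds_mul; [exact: lP.1|exact: lT.1]|rewrite /= lP.2 lT.2].
(* The reverse inequality is the one just shown, for translation by the inverse of f. *)
move=> f h k Xf Xh Xk; apply/eqP; rewrite eq_le le//=.
have E q : hcomp (hsym f) (hcomp f q) = q by apply: homeo_ext => x /=; rewrite hmapK.
rewrite -{1}(E h) -{1}(E k).
by apply: le; [exact: Homeo_inv|exact: Homeo_comp|exact: Homeo_comp].
Qed.

Lemma quotient_dist_open (U : set (homeo M)) :
  metric_open X rho U <-> contact_open alpha chi d U.
Proof.
split=> [[UX HU]|[UX [_ HU]]]; split => //.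
- split=> [P [SP _] //|P [SP UP]].
  have [e e0 He] := HU _ UP; have [h h0 Hh] := dist_alpha_sys_dist SP e0.
  exists h => // Q SQ PQ; split => //; apply: He; first by exists Q.
  by apply: le_lt_trans (Hh Q SQ PQ); exact: quotient_dist_le.
(* P is fixed before k, because the radius h depends on it; each k close to f then has a lift close
   to this P. *)
- move=> f Uf; have /HomeoP[P lP] := UX f Uf.
  have [|e e0 He] := HU P; first by split; [exact: lP.1|rewrite /= /ev1 lP.2].
  have [h h0 Hh] := sys_dist_dist_alpha lP.1 e0.
  exists h => // k Xk fk; have [Q lQ dPQ] := quotient_dist_lift lP Xk fk.
  by have [_] := He Q lQ.1 (Hh Q lQ.1 dPQ); rewrite /= /ev1 lQ.2.
Qed.

End Systems.

Theorem corollary6p6 (R : realType) (n : nat) (M : topologicalType)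
    (hM : closed_connected M) (A : atlas R n.*2 M)
    (alpha : one_form A) (halpha : contact_form alpha)
    (chi : 'I_(nchart A) -> M -> R) (hchi : partition_of_unity chi)
    (g : riemannian_metric A) :
  let d := riemannian_dist g in
  let HomeoMa := Homeo_alpha alpha chi d in
  exists rho : homeo M -> homeo M -> R,
    [/\ metric_on HomeoMa rho,
        left_invariant HomeoMa rho &
        forall U : set (homeo M),
          metric_open HomeoMa rho U <-> contact_open alpha chi d U].
Proof.
exists (quotient_dist alpha chi g); split.
- exact: quotient_dist_metric.
- exact: quotient_dist_left_invariant.
- exact: quotient_dist_open.
Qed.
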